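(* Let $n\ge 2$ and let $\Omega\subset\subset\mathbb{R}^n$ be a bounded domain with $\partial\Omega\in C^2$. Let $\phi\in C^2(\bar\Omega)$ be a defining function of $\partial\Omega$, i.e. $\phi=0$ and $\nabla\phi\neq 0$ on $\partial\Omega$, and $\phi>0$ in $\Omega\cap\mathcal{N}(\partial\Omega)$ for some neighborhood $\mathcal{N}(\partial\Omega)$ of $\partial\Omega$. Let $a^{ij}=a^{ji}\in C^2(\bar\Omega)$ and $b^i\in C^1(\bar\Omega)$ for $1\le i,j\le n$, and let $f\in C(\bar\Omega\times[0,\infty))$. Assume: (i) $a^{ij}\partial_i\phi\,\partial_j\phi=0$ and $\nabla(a^{ij}\partial_i\phi\,\partial_j\phi)\ne 0$ on $\partial\Omega$; (ii) the matrix $(a^{ij}(x))$ is positive definite for every $x\in\Omega$, and its eigenvalues $\lambda_1,\dots,\lambda_n$ satisfy $\lambda_1,\dots,\lambda_{n-1}\ge c_0$ and $\lambda_n=m(x)\phi(x)$ for some constant $c_0>0$ and some $m\in C(\bar\Omega)$ with $m>0$; (iii) the function $$g(x)=\frac{b^i\partial_i\phi-\partial_j a^{ij}\,\partial_i\phi}{\partial_k a^{ij}\,\partial_i\phi\,\partial_j\phi\,\phi^k},\qquad \phi^k=\frac{\partial_k\phi}{|\nabla\phi|^2},$$ satisfies $g(x)>0$ for all $x\in\partial\Omega$. Suppose $u\in C^2(\Omega)\cap L^\infty(\Omega)$, $u>0$ in $\Omega$, solves $$a^{ij}(x)\partial_{ij}u+b^i(x)\partial_i u+f(x,u)=0\quad\text{in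 }\Omega.$$ Then $u$ extends to $\bar\Omega$ (the extension still being denoted $u$) so that, for some $\beta\in(0,1)$, $$|u(x)-u(y)|\le C|x-y|^\beta\qquad\text{for all }x\in\bar\Omega,\ y\in\partial\Omega,$$ where $C$ and $\beta$ depend only on $|u|_\infty$, $|a^{ij}|_{C^2}$, $|b^i|_{C^1}$, $|\partial\Omega|_{C^2}$, $|f|_{C^0}$ and $n$.
   Context: Repeated indices are summed from $1$ to $n$; $\partial_i=\partial/\partial x_i$, $\partial_{ij}=\partial^2/\partial x_i\partial x_j$. $|u|_\infty$ is the supremum norm of $u$ on $\Omega$; $|a^{ij}|_{C^2}$ and $|b^i|_{C^1}$ are the norms of the coefficients on $\bar\Omega$; $|\partial\Omega|_{C^2}$ is the $C^2$ norm of the boundary; $|f|_{C^0}$ is the supremum of $|f|$ over $\bar\Omega\times[0,|u|_\infty]$. No boundary condition is imposed on $u$.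
   Formalization: C and β may also depend on c_0 and on a lower bound c_1>0 of |∇(a^{ij}∂_iφ∂_jφ)|/|∇φ|² on ∂Ω (which exists for any given data by compactness); with only the listed quantities the uniform claim is false, by oscillating solutions on the unit disc. *)

(* Defs.v *)
From HB Require Import structures.
From mathcomp Require Import all_boot all_order all_algebra.
From mathcomp Require Import all_classical all_reals all_analysis.
Set Implicit Arguments.
Unset Strict Implicit.
Unset Printing Implicit Defensive.
Import Order.TTheory GRing.Theory Num.Theory numFieldNormedType.Exports.
Local Open Scope classical_set_scope.
Local Open Scope ring_scope.

Section Defs.
Context {R : realType}.

(* The library norm of 'rV[R]_n is the maximum norm, hence this definition. *)
Definition enorm {n} (x : 'rV[R]_n) : R := Num.sqrt (\sum_(i < n) x 0 i ^+ 2).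

Definition supnorm {T : Type} (A : set T) (h : T -> R) : R :=
  sup [set `|h x| | x in A].

Section Derivatives.
Context {n : nat}.
Implicit Types (Om : set 'rV[R]_n) (v : 'rV[R]_n -> R).

Definition pd (i : 'I_n) v (x : 'rV[R]_n) : R := 'D_(delta_mx 0 i) v x.

Definition C1_on Om v : Prop :=
  (forall x, Om x -> {for x, continuous v}) /\
  (forall i x, Om x ->
     derivable v x (delta_mx 0 i) /\ {for x, continuous (pd i v)}).

Definition C2_on Om v : Prop :=
  C1_on Om v /\ forall i, C1_on Om (pd i v).

(* For Om open, C^k(closure Om) consists of the functions of C^k(Om) all of
   whose derivatives of order at most k extend continuously to closure Om.
   The functions themselves are given on closure Om, their derivatives need
   only make sense in Om. *)
Definition extends_cont Om (h : 'rV[R]_n -> R) : Prop :=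
  exists2 H : 'rV[R]_n -> R,
    {within closure Om, continuous H} & forall x, Om x -> H x = h x.

Definition C1_bar Om v : Prop :=
  [/\ {within closure Om, continuous v}, C1_on Om v &
      forall i, extends_cont Om (pd i v)].

Definition C2_bar Om v : Prop :=
  [/\ C1_bar Om v, C2_on Om v &
      forall i j, extends_cont Om (pd j (pd i v))].

(* The continuous extension to closure Om of a partial derivative in Om. *)
Definition pd_bar Om (i : 'I_n) v (x : 'rV[R]_n) : R :=
  lim (pd i v y @[y --> within Om (nbhs x)]).

Definition grad_bar Om v (x : 'rV[R]_n) : 'rV[R]_n := \row_i pd_bar Om i v x.

(* Suprema over Om and over closure Om agree by continuity. *)
Definition C1norm Om v : R :=
  supnorm Om v + \sum_(i < n) supnorm Om (pd i v).

Definition C2norm Om v : R :=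
  C1norm Om v + \sum_(i < n) \sum_(j < n) supnorm Om (pd j (pd i v)).

End Derivatives.

Section Domains.
Context {n : nat}.
Implicit Types (Om : set 'rV[R]_n) (phi : 'rV[R]_n -> R).

(* This is the topological boundary when Om is open. *)
Definition bdry Om : set 'rV[R]_n := closure Om `\` Om.

(* In the ball of radius r about p, and in coordinates centred at p, Om is
   the part above (b = false) or below (b = true) the graph of a C^2 function
   of the coordinates other than the k-th; K bounds the C^2 norm of this
   function on the projected ball. *)
Definition C2_chart Om (p : 'rV[R]_n) (r K : R) : Prop :=
  exists (k : 'I_n) (b : bool) (gam : 'rV[R]_(n.-1) -> R),
    [/\ C2_on setT gam,
        C2norm [set z | enorm z < r] gam <= K &
        forall y : 'rV[R]_n, enorm y < r ->
          (Om (p + y) <-> gam (col' k y) < (-1) ^+ b * y 0 k)].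

Definition C2_boundary Om : Prop :=
  forall p, bdry Om p -> exists r K, 0 < r /\ C2_chart Om p r K.

(* The C^2 norm of the boundary controls the charts and the radius on which
   they are available. *)
Definition bdry_C2norm Om : R :=
  inf [set K | 0 < K /\ forall p, bdry Om p -> C2_chart Om p K^-1 K].

Definition bounded_domain Om : Prop :=
  [/\ open Om, connected Om, Om !=set0 & bounded_set Om].

Definition defining_function Om phi : Prop :=
  [/\ C2_bar Om phi,
      forall x, bdry Om x -> phi x = 0 /\ grad_bar Om phi x != 0 &
      exists N : set 'rV[R]_n, [/\ open N, bdry Om `<=` N &
        forall x, (Om `&` N) x -> 0 < phi x]].

End Domains.

Section Operator.
Context {n : nat}.
Implicit Types (Om : set 'rV[R]_n) (phi : 'rV[R]_n -> R).
Implicit Types (a : 'rV[R]_n -> 'M[R]_n) (b : 'rV[R]_n -> 'rV[R]_n).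

Definition char_form Om a phi (x : 'rV[R]_n) : R :=
  \sum_(i < n) \sum_(j < n) a x i j * pd_bar Om i phi x * pd_bar Om j phi x.

Definition pos_def (A : 'M[R]_n) : Prop :=
  forall xi : 'rV[R]_n, xi != 0 -> 0 < (xi *m A *m xi^T) 0 0.

(* The eigenvalues of A, with multiplicity, are the values of lam. *)
Definition eigenvalues (A : 'M[R]_n) (lam : 'I_n -> R) : Prop :=
  char_poly A = \prod_(i < n) ('X - (lam i)%:P).

Definition g_fun Om a b phi (x : 'rV[R]_n) : R :=
  (\sum_(i < n) b x 0 i * pd_bar Om i phi x
   - \sum_(i < n) \sum_(j < n)
       pd_bar Om j (fun y => a y i j) x * pd_bar Om i phi x)
  / (\sum_(k < n) \sum_(i < n) \sum_(j < n)
       pd_bar Om k (fun y => a y i j) x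
       * pd_bar Om i phi x * pd_bar Om j phi x
       * (pd_bar Om k phi x / enorm (grad_bar Om phi x) ^+ 2)).

End Operator.

End Defs.

(* Main.v *)
Require Import Defs.
From HB Require Import structures.
From mathcomp Require Import all_boot all_order all_algebra.
From mathcomp Require Import all_classical all_reals all_analysis.
From mathcomp Require Import ring lra perm.
From mathcomp Require spectral sesquilinear complex.
Set Implicit Arguments.
Unset Strict Implicit.
Unset Printing Implicit Defensive.
Import Order.TTheory GRing.Theory Num.Theory numFieldNormedType.Exports.
Local Open Scope classical_set_scope.
Local Open Scope ring_scope.

(** Doubling the variables proves the estimate. Near a boundary point [p] the
    boundary is a graph; [flat] straightens it and replaces the height above the
    graph by its square root [s]. In these coordinates the degenerate operator
    becomes uniformly elliptic. On the boundary the leading part is positive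
    semidefinite and annihilates the normal [N] ([conor_tends]), so that the mixed
    coefficients, of the form [conor / (2 * s)], vanish there, and the normal
    coefficient [ann / (4 * s ^+ 2)] tends to a quarter of the normal derivative
    of the characteristic form, which is bounded below by [c1] ([dann_limit]).
    Since at most one eigenvalue degenerates, and its eigenvector is nearly normal
    to the boundary, the tangential block stays elliptic ([block_elliptic]).

    The price is a singular normal drift [h / s]. The second derivatives of the
    graph disappear from the boundary value of [h] because the tangential
    derivatives of the conormal vanish ([defect_small]), and the sign of [g_fun]
    becomes the sign of the remaining first order terms ([drift_limit]). It
    follows that [h] is nonnegative and dominates the normal coefficient up to a
    multiple of [s ^+ 2]: the normal component behaves like a Bessel process of
    dimension at least two, which does not reach the boundary. This is why no
    boundary condition enters.

    The function [coupled] compares two values of the solution with a multiple of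
    the square root of the distance, and a logarithmic barrier, which the drift
    makes an almost supersolution, keeps its maximum inside. At an interior
    maximum the concavity of the square root gives a large negative second
    derivative in the direction that joins the two points, while the singular
    drift [h / s] pushes them towards each other up to the oscillation of [h]
    ([bessel_drift_le]); in a small half ball the coefficients are nearly
    constant, and the equation is contradicted if the multiple is large
    ([no_coupled_max], [halfball_holder]).

    In the original coordinates this is an oscillation bound of order [d `^ 4^-1]
    in the part of the domain within distance [d] of [p]
    ([boundary_oscillation]), whence the extension by limits
    ([holder_extension]). The radius and the constants depend on the data only
    through the norms and [c0], [c1], because the infimum in [bdry_C2norm] provides charts of
    uniform size ([chart_of_norm]), which needs the compactness of the boundary. *)

(** * Differentiability of functions with continuous partial derivatives *)

Section OneVariable.
Context {R : realType}.
Implicit Types (f df : R -> R) (a b B : R).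

Lemma mvt_eq f df a b : a <= b ->
  (forall x, a <= x <= b -> is_derive x 1 f (df x)) ->
  exists2 c, a <= c <= b & f b - f a = df c * (b - a).
Proof.
move=> ab fd; have [||c] := @MVT_segment R f df a b ab.
- by move=> x; rewrite in_itv /= => /andP[/ltW ax /ltW xb]; apply: fd; rewrite ax.
- apply: derivable_within_continuous => x; rewrite in_itv /= => xab.
  by have [] := fd x xab.
- by rewrite in_itv /= => cab E; exists c.
Qed.

Lemma mvt_bound f df a b B : a <= b ->
  (forall x, a <= x <= b -> is_derive x 1 f (df x)) ->
  (forall x, a <= x <= b -> `|df x| <= B) ->
  `|f b - f a| <= B * (b - a).
Proof.
move=> ab fd dB; have [c cab ->] := mvt_eq ab fd.
rewrite normrM (ger0_norm (_ : 0 <= b - a)) ?subr_ge0//.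
by rewrite ler_wpM2r ?subr_ge0// dB.
Qed.

Lemma mvt_eqC f df a b :
  (forall x, Num.min a b <= x <= Num.max a b -> is_derive x 1 f (df x)) ->
  exists2 c, Num.min a b <= c <= Num.max a b & f b - f a = df c * (b - a).
Proof.
case: (leP a b) => [ab|/ltW ab] fd; first exact: mvt_eq.
have [c cab E] := mvt_eq ab fd; exists c => //.
by rewrite -(opprB (f a)) E -mulrN opprB.
Qed.

End OneVariable.

Lemma cvg_sum {R : realType} {T : Type} (F : set_system T) {FF : Filter F}
    n (f : 'I_n -> T -> R) (l : 'I_n -> R) :
  (forall i, f i x @[x --> F] --> l i) ->
  (\sum_(i < n) f i x) @[x --> F] --> \sum_(i < n) l i.
Proof. by move=> fl; apply: cvg_big => [|i _]; [exact: add_continuous|exact: fl]. Qed.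

Lemma continuous_sum {R : realType} {T : topologicalType} n (f : 'I_n -> T -> R) :
  (forall i, continuous (f i)) -> continuous (fun x => \sum_(i < n) f i x).
Proof. by move=> cf x; apply: cvg_sum => i; exact: cf. Qed.

Lemma diff_eps {R : realType} {V W : normedModType R} (f : V -> W)
    (df : {linear V -> W}) (x : V) : continuous df ->
  (forall e : R, 0 < e -> exists2 d : R, 0 < d &
    forall h, `|h| < d -> `|f (x + h) - (f x + df h)| <= e * `|h|) ->
  differentiable f x /\ 'd f x = df :> (V -> W).
Proof.
move=> cdf H.
have E : f \o shift x = cst (f x) + df +o_ 0 id.
  apply/eqaddoP => e e0; have [d d0 {}H] := H e e0.
  have B : nbhs (0 : V) (ball (0 : V) d) by exact: nbhsx_ballx.
  apply: (filterS _ B) => h; rewrite -ball_normE /ball_ /= sub0r normrN => hd.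
  by have := H h hd; rewrite !fctE /= (addrC x).
have dE := diff_unique cdf E; split => //.
by apply/diff_locallyP; rewrite dE.
Qed.

Section Taylor.
Context {R : realType} {n : nat}.
Implicit Types (Om : set 'rV[R]_n) (v : 'rV[R]_n -> R) (x h : 'rV[R]_n).

Lemma coord_le_norm x i : `|x 0 i| <= `|x|.
Proof.
rewrite [leRHS]/Num.Def.normr/= mx_normrE.
exact: (le_bigmax _ (fun ij => `|x ij.1 ij.2|) (0, i)).
Qed.

Lemma norm_le_coord x (B : R) : 0 <= B -> (forall i, `|x 0 i| <= B) -> `|x| <= B.
Proof.
move=> B0 H; rewrite [leLHS]/Num.Def.normr/= mx_normrE.
by apply: bigmax_le => // -[i j] _; rewrite ord1 /=.
Qed.

Lemma pd_is_derive v x i (t : R) : derivable v (x + t *: delta_mx 0 i) (delta_mx 0 i) ->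
  is_derive t 1 (fun s : R => v (x + s *: delta_mx 0 i))
    (pd i v (x + t *: delta_mx 0 i)).
Proof.
set e := delta_mx 0 i => dv.
have E : (fun h : R => h^-1 *: (v (x + (h *: 1%R + t) *: e) - v (x + t *: e)))
       = (fun h : R => h^-1 *: (v (h *: e + (x + t *: e)) - v (x + t *: e))).
  apply/funext => h; congr (_ *: (v _ - _)).
  by rewrite scalerDl [h *: 1]mulr1 addrCA.
by apply: DeriveDef; rewrite /derivable /derive /pd /derive /= E.
Qed.

Let trunc (j : nat) h : 'rV[R]_n := \row_i (if (i < j)%N then h 0 i else 0).

Let truncS (j : 'I_n) h : trunc j.+1 h = trunc j h + h 0 j *: delta_mx 0 j.
Proof.
apply/rowP => i; rewrite !mxE eqxx /= ltnS leq_eqVlt.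
case: eqP => [/val_inj ->|/eqP ij] /=.
  by rewrite ltnn eqxx mulr1 add0r.
by rewrite -(inj_eq val_inj) (negbTE ij) mulr0 addr0.
Qed.

(** Along the broken line from [x] to [x + h] with edges parallel to the
    axes, the mean value theorem applies to one partial derivative at a time. *)
Lemma C1_taylor Om v x : open Om -> C1_on Om v -> Om x ->
  forall eps : R, 0 < eps -> exists2 delta : R, 0 < delta &
  forall h, `|h| < delta ->
  `|v (x + h) - v x - \sum_(i < n) pd i v x * h 0 i| <= eps * `|h|.
Proof.
move=> oOm [cv dv] Omx eps eps0.
pose eps' := eps / n.+1%:R.
have eps'0 : 0 < eps' by rewrite divr_gt0.
have : \forall y \near x, Om y /\ forall i : 'I_n, `|pd i v x - pd i v y| <= eps'.
  near=> y; split; first by near: y; exact: open_nbhs_nbhs.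
  move=> i; move: i; near: y; apply: filter_forall => i.
  by have [_ /cvgrPdist_le /(_ _ eps'0)] := dv i x Omx.
move=> /nbhs_normP[delta /= delta0 dH]; exists delta => // h hd.
have inb y : `|y| <= `|h| -> Om (x + y) /\
    forall i : 'I_n, `|pd i v x - pd i v (x + y)| <= eps'.
  move=> yh; apply: dH; rewrite /ball_ /= opprD addNKr normrN.
  exact: le_lt_trans hd.
have step (j : 'I_n) : `|v (x + trunc j.+1 h) - v (x + trunc j h) - pd j v x * h 0 j|
    <= eps' * `|h|.
  rewrite truncS addrA.
  pose g (t : R) := v (x + trunc j h + t *: delta_mx 0 j).
  have mid t : Num.min 0 (h 0 j) <= t <= Num.max 0 (h 0 j) ->
     `|trunc j h + t *: delta_mx 0 j| <= `|h|.
    move=> tb; apply: norm_le_coord => // i; rewrite !mxE eqxx /=.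
    have [->|ij] := eqVneq i j.
      rewrite ltnn add0r mulr1; apply: le_trans (coord_le_norm h j).
      move: tb; rewrite /Num.min /Num.max; case: ltP => h0 /andP[ta tb].
        by rewrite !ger0_norm // ltW.
      by rewrite !ler0_norm // lerN2.
    rewrite mulr0 addr0; case: ifP => _; first exact: coord_le_norm.
    by rewrite normr0.
  have [c cb E] := @mvt_eqC R g (fun t => pd j v (x + trunc j h + t *: delta_mx 0 j))
    0 (h 0 j) (fun t tb => pd_is_derive
      (dv j _ (eq_ind _ Om (inb _ (mid t tb)).1 _ (addrA _ _ _))).1).
  move: E; rewrite /g scale0r addr0 subr0 => ->.
  rewrite -mulrBl normrM ler_pM ?coord_le_norm // -addrA distrC.
  exact: (inb _ (mid c cb)).2.
have tel : v (x + h) - v x =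
    \sum_(j < n) (v (x + trunc j.+1 h) - v (x + trunc j h)).
  rewrite -(big_mkord xpredT (fun j => v (x + trunc j.+1 h) - v (x + trunc j h))).
  rewrite telescope_sumr //; congr (v _ - v _).
    by congr (_ + _); apply/rowP => i; rewrite mxE ltn_ord.
  by rewrite -[LHS]addr0; congr (_ + _); apply/rowP => i; rewrite !mxE.
rewrite tel -sumrB; apply: le_trans (ler_norm_sum _ _ _) _.
apply: (@le_trans _ _ (\sum_(j < n) eps' * `|h|)); first exact: ler_sum.
rewrite sumr_const card_ord -mulrnAl ler_wpM2r // /eps' -mulr_natr.
by rewrite mulrAC ler_pdivrMr ?ltr0Sn // ler_wpM2l ?(ltW eps0) ?ler_nat.
Unshelve. all: by end_near.
Qed.

(** Chain rule along a curve. *)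
Lemma C1_chain Om v (c dc : R -> 'rV[R]_n) (t : R) :
  open Om -> C1_on Om v -> Om (c t) ->
  (forall i, is_derive t 1 (fun s => c s 0 i) (dc t 0 i)) ->
  is_derive t 1 (v \o c) (\sum_(i < n) pd i v (c t) * dc t 0 i).
Proof.
move=> oOm cv Omc dcc.
pose L h := \sum_(i < n) pd i v (c t) * h 0 i.
have linL : linear L.
  move=> k x y; rewrite /L scaler_sumr -big_split; apply: eq_bigr => i _ /=.
  by rewrite !mxE mulrDr mulrCA.
pose LL := GRing.isLinear.Build _ _ _ _ L linL.
pose Ls : {linear 'rV[R]_n -> R} := HB.pack L LL.
have cL : continuous Ls.
  have -> : (Ls : _ -> _) = (fun h => \sum_(i < n) pd i v (c t) * h 0 i) by [].
  apply: continuous_sum => i x.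
  exact: (cvgM (cvg_cst _) (@coord_continuous _ _ _ _ _ x)).
have [dv dvE] : differentiable v (c t) /\ 'd v (c t) = Ls :> ('rV[R]_n -> R).
  apply: diff_eps => // e e0; have [d d0 H] := C1_taylor oOm cv Omc e0.
  by exists d => // h hd; rewrite opprD addrA; exact: H.
have dc' : derivable c t 1.
  by apply/derivable_mxP => i j; rewrite ord1; have [] := dcc j.
have dct : differentiable c t by apply/derivable1_diffP.
have dcomp : differentiable (v \o c) t by apply: differentiable_comp.
apply: DeriveDef; first exact/diff_derivable.
rewrite deriveE // diff_comp //= dvE -deriveE // derive_mx //.
apply: eq_bigr => i _; rewrite !mxE; congr (_ * _).
by have [_ ->] := dcc i.
Qed.

End Taylor.

(** * Second order expansions along curves *)

Section Jets.
Context {R : realType}.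
Implicit Types (g : R -> R) (b c : R).

(** A second order Taylor expansion at the origin: this is what the second order
    test of a maximum uses, and unlike the existence of two derivatives near the
    origin it passes through compositions with little bookkeeping. *)
Definition jet2 g b c : Prop := forall e : R, 0 < e -> exists2 d : R, 0 < d &
  forall t, `|t| < d -> `|g t - g 0 - b * t - c * t ^+ 2 / 2| <= e * t ^+ 2.

Lemma jet2_derive g (g1 : R -> R) c :
  (\forall t \near (0 : R), is_derive (t : R) 1 g (g1 t)) ->
  is_derive (0 : R) 1 g1 c -> jet2 g (g1 0) c.
Proof.
move=> /nbhs_normP[d /= d0 gd] g1d e e0.
have [/derivable_nbhsP + g1v] := g1d.
rewrite g1v => E.
have : \forall t \near (0 : R), `|g1 t - g1 0 - c * t| <= e * `|t|.
  move/eqaddoP : E => /(_ e e0); apply: filterS => t /=.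
  rewrite !fctE /= addr0 [t *: 1]mulr1 opprD addrA.
  by rewrite [t *: c]mulrC.
move=> /nbhs_normP[d' /= d'0 g1b].
exists (Num.min d d'); first by rewrite lt_min d0.
move=> t td.
pose k (s : R) := g s - g 0 - g1 0 * s - c * s ^+ 2 / 2.
have kd (s : R) : `|s| <= `|t| -> is_derive s 1 k (g1 s - g1 0 - c * s).
  move=> st; have gs : is_derive s 1 g (g1 s).
    apply: gd; rewrite /ball_ /= sub0r normrN; apply: le_lt_trans st _.
    by move: td; rewrite lt_min => /andP[].
  rewrite /k; apply: is_derive_eq; rewrite /GRing.scale /=.
  by field.
have kb s : `|s| <= `|t| -> `|g1 s - g1 0 - c * s| <= e * `|t|.
  move=> st; apply: (@le_trans _ _ (e * `|s|)); last by rewrite ler_wpM2l // ltW.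
  apply: g1b; rewrite /ball_ /= sub0r normrN; apply: le_lt_trans st _.
  by move: td; rewrite lt_min => /andP[].
have k0 : k 0 = 0 by rewrite /k; ring.
have mid s : Num.min 0 t <= s <= Num.max 0 t -> `|s| <= `|t|.
  rewrite /Num.min /Num.max; case: ltP => t0 /andP[ta tb].
    by rewrite !ger0_norm // ltW.
  by rewrite !ler0_norm // lerN2.
have [s sb E'] := mvt_eqC (fun s sb => kd s (mid s sb)).
rewrite -/(k t); move: E'; rewrite k0 !subr0 => ->.
rewrite normrM -real_normK ?num_real // expr2 mulrA ler_wpM2r //.
exact: kb (mid s sb).
Qed.

Lemma jet2D g g' b b' c c' : jet2 g b c -> jet2 g' b' c' ->
  jet2 (fun t => g t + g' t) (b + b') (c + c').
Proof.
move=> H H' e e0; have e20 : 0 < e / 2 by rewrite divr_gt0.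
have [d d0 {}H] := H _ e20; have [d' d'0 {}H'] := H' _ e20.
exists (Num.min d d'); first by rewrite lt_min d0.
move=> t; rewrite lt_min => /andP[td td'].
rewrite (_ : _ - _ = (g t - g 0 - b * t - c * t ^+ 2 / 2) +
  (g' t - g' 0 - b' * t - c' * t ^+ 2 / 2)); last by field.
apply: le_trans (ler_normD _ _) _.
by rewrite [e]splitr mulrDl lerD // ?H ?H'.
Qed.

Lemma jet2Z k g b c : jet2 g b c -> jet2 (fun t => k * g t) (k * b) (k * c).
Proof.
move=> H e e0; have e'0 : 0 < e / (`|k| + 1) by rewrite divr_gt0 // ltr_wpDl.
have [d d0 {}H] := H _ e'0; exists d => // t td.
rewrite (_ : _ - _ = k * (g t - g 0 - b * t - c * t ^+ 2 / 2)); last by field.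
rewrite normrM; apply: le_trans (ler_wpM2l (normr_ge0 _) (H t td)) _.
rewrite mulrA ler_wpM2r ?sqr_ge0 // mulrCA -[leRHS]mulr1 ler_wpM2l ?(ltW e0) //.
by rewrite ler_pdivrMr ?ltr_wpDl // mul1r lerDl.
Qed.

Lemma jet2_poly a b c : jet2 (fun t => a + b * t + c * t ^+ 2 / 2) b c.
Proof.
move=> e e0; exists 1 => // t _.
rewrite (_ : _ - _ = 0) ?normr0; first by rewrite mulr_ge0 ?sqr_ge0 ?ltW.
by field.
Qed.

Lemma jet2_max g b c : jet2 g b c ->
  (exists2 d : R, 0 < d & forall t, `|t| < d -> g t <= g 0) ->
  b = 0 /\ c <= 0.
Proof.
move=> H [d d0 gm].
have b0 : b = 0.
  apply/eqP; rewrite -normr_eq0 eq_le normr_ge0 andbT.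
  have [d1 d10 H1] := H 1 ltr01.
  pose K := 1 + `|c| / 2.
  have K0 : 0 < K by rewrite ltr_wpDr // divr_ge0.
  have key t : `|t| < Num.min d d1 -> b * t <= K * t ^+ 2.
    rewrite lt_min => /andP[td td1]; have := H1 t td1; have := gm t td.
    rewrite ler_norml => g0 /andP[+ _].
    have : - (c * t ^+ 2) <= `|c| * t ^+ 2.
      by rewrite -mulNr ler_wpM2r ?sqr_ge0 // -normrN ler_norm.
    rewrite /K; lra.
  have m0 : 0 < Num.min d d1 by rewrite lt_min d0.
  apply/ler_addgt0Pr => e e0; rewrite add0r.
  pose t := Num.min (Num.min d d1 / 2) (e / K).
  have t0 : 0 < t by rewrite lt_min !divr_gt0.
  have tm : t < Num.min d d1.
    have : t <= Num.min d d1 / 2 by rewrite /t ge_min lexx.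
    move: m0; set m := Num.min d d1; lra.
  have te : K * t <= e.
    by rewrite mulrC -ler_pdivlMr // /t ge_min lexx orbT.
  have := key t; rewrite gtr0_norm // => /(_ tm).
  have := key (- t); rewrite normrN gtr0_norm // => /(_ tm).
  rewrite sqrrN expr2 mulrA mulrN -mulNr !ler_pM2r //.
  by move=> A B; rewrite ler_norml; apply/andP; split; lra.
split=> //; rewrite b0 in H.
apply/ler_addgt0Pr => e e0; rewrite add0r.
have e20 : 0 < e / 2 by rewrite divr_gt0.
have [d1 d10 {}H] := H _ e20.
have m0 : 0 < Num.min d d1 by rewrite lt_min d0.
pose t := Num.min d d1 / 2.
have t0 : 0 < t by rewrite divr_gt0.
have : `|t| < Num.min d d1 by rewrite gtr0_norm // /t; move: m0; set m := Num.min d d1; lra.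
rewrite lt_min => /andP[td td1].
have := H t td1; have := gm t td; rewrite ler_norml => g0 /andP[+ _] => A.
have tt : 0 < t ^+ 2 by rewrite exprn_gt0.
rewrite -(ler_pM2r tt); lra.
Qed.

End Jets.

Section SecondOrderChain.
Context {R : realType} {n : nat}.
Implicit Types (Om : set 'rV[R]_n) (u : 'rV[R]_n -> R).

(** The first order chain rule holds along the whole curve, so that the second
    derivative is obtained by applying it to each partial derivative in turn. *)
Lemma C2_chain Om u (c dc : R -> 'rV[R]_n) (ddc : 'rV[R]_n) :
  open Om -> C2_on Om u -> Om (c 0) ->
  (forall i (s : R), is_derive s 1 (fun s => c s 0 i) (dc s 0 i)) ->
  (forall i, is_derive (0 : R) 1 (fun s => dc s 0 i) (ddc 0 i)) ->
  jet2 (u \o c) (\sum_i pd i u (c 0) * dc 0 0 i)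
    (\sum_i \sum_j pd j (pd i u) (c 0) * dc 0 0 j * dc 0 0 i +
     \sum_i pd i u (c 0) * ddc 0 i).
Proof.
move=> oOm [u1 u2] Omc dcc ddcc.
apply: (@jet2_derive _ (u \o c) (fun s => \sum_i pd i u (c s) * dc s 0 i)).
  have cc : {for (0 : R), continuous c}.
    apply/differentiable_continuous/derivable1_diffP/derivable_mxP => i j.
    by rewrite ord1; have [] := dcc j 0.
  have : \forall s \near (0 : R), Om (c s) by apply: cc; exact: open_nbhs_nbhs.
  by apply: filterS => s Oms; apply: (C1_chain oOm u1).
have D i : is_derive (0 : R) 1 (fun s => pd i u (c s) * dc s 0 i)
   ((\sum_j pd j (pd i u) (c 0) * dc 0 0 j) * dc 0 0 i + pd i u (c 0) * ddc 0 i).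
  have A := C1_chain oOm (u2 i) Omc (fun i => dcc i 0).
  have B := ddcc i.
  apply: is_derive_eq; rewrite /GRing.scale /=; ring.
have := @is_derive_sum _ _ _ n (fun i s => pd i u (c s) * dc s 0 i) 0 1 _ D.
rewrite big_split /=; under [X in X + _]eq_bigr do rewrite mulr_suml.
by rewrite (_ : \sum_(i < n) _ = (fun s => \sum_(i < n) pd i u (c s) * dc s 0 i)) //;
  apply/funext => s; rewrite fct_sumE.
Qed.

End SecondOrderChain.

(** * Quadratic forms and the Euclidean norm *)

Section QuadraticForms.
Context {R : realType} {n : nat}.
Implicit Types (x y w : 'rV[R]_n) (P S : 'M[R]_n).

Definition dotv x y : R := \sum_i x 0 i * y 0 i.
Definition qf P x : R := \sum_i \sum_j P i j * x 0 i * x 0 j.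
Definition frob P S : R := \sum_i \sum_j P i j * S i j.

Lemma dotvC x y : dotv x y = dotv y x.
Proof. by apply: eq_bigr => i _; rewrite mulrC. Qed.

Lemma dotvDl x y z : dotv (x + y) z = dotv x z + dotv y z.
Proof. by rewrite -big_split; apply: eq_bigr => i _ /=; rewrite mxE mulrDl. Qed.

Lemma dotvZl (a : R) x y : dotv (a *: x) y = a * dotv x y.
Proof. by rewrite mulr_sumr; apply: eq_bigr => i _; rewrite mxE mulrA. Qed.

Lemma dotvNl x y : dotv (- x) y = - dotv x y.
Proof. by rewrite -scaleN1r dotvZl mulN1r. Qed.

Lemma dotvDr x y z : dotv x (y + z) = dotv x y + dotv x z.
Proof. by rewrite dotvC dotvDl !(dotvC _ x). Qed.

Lemma dotvZr (a : R) x y : dotv x (a *: y) = a * dotv x y.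
Proof. by rewrite dotvC dotvZl dotvC. Qed.

Lemma dotvNr x y : dotv x (- y) = - dotv x y.
Proof. by rewrite dotvC dotvNl dotvC. Qed.

Lemma dotv_ge0 x : 0 <= dotv x x.
Proof. by apply: sumr_ge0 => i _; rewrite -expr2 sqr_ge0. Qed.

Lemma dotv0l x : dotv 0 x = 0.
Proof. by rewrite /dotv big1 // => i _; rewrite mxE mul0r. Qed.

Lemma dotv_delta x k : dotv x (delta_mx 0 k) = x 0 k.
Proof.
rewrite /dotv (bigD1 k) //= big1 => [|i ik]; last by rewrite !mxE (negbTE ik) mulr0.
by rewrite !mxE !eqxx mulr1 addr0.
Qed.

Lemma qfE P x : qf P x = \sum_i x 0 i * (\sum_j P i j * x 0 j).
Proof.
apply: eq_bigr => i _; rewrite mulr_sumr; apply: eq_bigr => j _.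
by rewrite mulrA (mulrC (x 0 i)).
Qed.

Lemma qfD P x y : P^T = P ->
  qf P (x + y) = qf P x + 2 * (\sum_i x 0 i * (\sum_j P i j * y 0 j)) + qf P y.
Proof.
move=> sP.
have E : \sum_i x 0 i * (\sum_j P i j * y 0 j) = \sum_i y 0 i * (\sum_j P i j * x 0 j).
  under eq_bigr do rewrite mulr_sumr; under [RHS]eq_bigr do rewrite mulr_sumr.
  rewrite exchange_big; apply: eq_bigr => i _; apply: eq_bigr => j _ /=.
  by rewrite -{1}sP mxE mulrCA (mulrC (x 0 j)) mulrA -mulrA mulrCA mulrC -mulrA mulrC -mulrA mulrCA.
rewrite mulr_natl mulr2n {2}E !qfE -!big_split /=; apply: eq_bigr => i _.
rewrite !mxE; under eq_bigr do rewrite mxE mulrDr.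
rewrite big_split /=; ring.
Qed.

Lemma qfZ P (a : R) x : qf P (a *: x) = a ^+ 2 * qf P x.
Proof.
rewrite /qf mulr_sumr; apply: eq_bigr => i _; rewrite mulr_sumr.
by apply: eq_bigr => j _; rewrite !mxE; ring.
Qed.

Lemma sum_delta (F : 'I_n -> R) k : \sum_j F j * (delta_mx 0 k : 'rV[R]_n) 0 j = F k.
Proof.
rewrite (bigD1 k) //= big1 => [|i ik]; last by rewrite !mxE (negbTE ik) mulr0.
by rewrite !mxE !eqxx mulr1 addr0.
Qed.

Lemma qf_delta P k : qf P (delta_mx 0 k) = P k k.
Proof.
rewrite qfE; under eq_bigr do rewrite sum_delta mulrC.
exact: sum_delta.
Qed.

(** If [P k j] were nonzero, then the form would be negative at
    [delta_mx 0 j + t *: delta_mx 0 k] for a large [t] of suitable sign. *)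
Lemma psd_row0 P k : P^T = P -> (forall x, 0 <= qf P x) -> P k k = 0 ->
  forall j, P k j = 0.
Proof.
move=> sP pP kk j; apply/eqP/negP => /negP nz.
pose t := - (P j j + 1) / (2 * P k j).
have := pP (delta_mx 0 j + t *: delta_mx 0 k).
rewrite qfD // qfZ !qf_delta kk mulr0 addr0.
under eq_bigr => i _ do
  (under eq_bigr do rewrite mxE mulrCA; rewrite -mulr_sumr sum_delta mulrC).
rewrite sum_delta -(_ : P^T j k = P j k) ?sP // -{2}sP mxE.
rewrite (_ : 2 * (t * P k j) = - (P j j + 1)); last by rewrite /t; field.
lra.
Qed.

(** Completing squares one variable at a time writes a positive semidefinite
    matrix as a sum of rank one matrices. *)
Lemma psd_sum_rank1 P : P^T = P -> (forall x, 0 <= qf P x) ->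
  exists ws : seq 'rV[R]_n, forall i j, P i j = \sum_(w <- ws) w 0 i * w 0 j.
Proof.
move=> sP pP.
suff H : forall m P, P^T = P -> (forall x, 0 <= qf P x) ->
    (forall i j : 'I_n, (m <= i)%N -> P i j = 0) ->
  exists ws : seq 'rV[R]_n, forall i j, P i j = \sum_(w <- ws) w 0 i * w 0 j.
  by apply: (H n) => // i j; rewrite leqNgt ltn_ord.
elim => [|m IH] {sP pP} {}P sP pP Pm.
  by exists [::] => i j; rewrite big_nil Pm.
have [nm|mn] := leqP n m.
  by apply: (IH P) => // i j mi; have := leq_trans nm mi; rewrite leqNgt ltn_ord.
pose k := Ordinal mn.
have [kk|kk] := eqVneq (P k k) 0.
  apply: (IH P) => // i j; rewrite leq_eqVlt => /orP[/eqP mi|/Pm //].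
  by rewrite (_ : i = k) ?(psd_row0 sP pP kk) //; apply/val_inj.
have kk0 : 0 < P k k by rewrite lt_def kk -(qf_delta P k) pP.
pose r := row k P.
pose P' := \matrix_(i, j) (P i j - P k i * P k j / P k k).
have qf' x : qf P' x = qf P x - (\sum_j P k j * x 0 j) ^+ 2 / P k k.
  rewrite expr2 !mulr_suml /qf -sumrB; apply: eq_bigr => i _.
  rewrite mulr_sumr mulr_suml -sumrB; apply: eq_bigr => j _.
  by rewrite mxE; field.
have [||i j mi|ws wsE] := IH P'.
- by apply/matrixP => i j; rewrite !mxE -{1}sP mxE (mulrC (P k j)).
- move=> x; rewrite qf'.
  set l := \sum_j _.
  have := pP (x + (- l / P k k) *: delta_mx 0 k).
  rewrite qfD // qfZ qf_delta.
  under eq_bigr => i _ do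
    (under eq_bigr do rewrite mxE mulrCA; rewrite -mulr_sumr sum_delta).
  rewrite (_ : \sum_i _ = (- l / P k k) * l).
    by rewrite (_ : qf P x + _ + _ = qf P x - l ^+ 2 / P k k) //; field.
  rewrite [RHS]mulr_sumr; apply: eq_bigr => i _.
  by rewrite (_ : P i k = P k i); [ring|rewrite -{1}sP mxE].
- rewrite mxE; move: mi; rewrite leq_eqVlt => /orP[/eqP mi|mi].
    rewrite (_ : i = k); last exact/val_inj.
    by field.
  by rewrite Pm // -(sP) mxE Pm // !mul0r subr0.
exists ((Num.sqrt (P k k))^-1 *: r :: ws) => i j.
rewrite big_cons -wsE !mxE.
have := @sqr_sqrtr _ (P k k) (ltW kk0).
have : Num.sqrt (P k k) != 0 by rewrite gt_eqF // sqrtr_gt0.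
by set s := Num.sqrt _ => s0 <-; field.
Qed.

(** By [psd_sum_rank1] it suffices to treat [P] of rank one, and then the trace
    inequality is the hypothesis on [S]. *)
Lemma psd_frob_le P S (k : R) : P^T = P -> (forall x, 0 <= qf P x) ->
  (forall x, qf S x <= k * dotv x x) -> frob P S <= k * \tr P.
Proof.
move=> sP pP Sk; have [ws wsE] := psd_sum_rank1 sP pP.
have -> : frob P S = \sum_(w <- ws) qf S w.
  rewrite exchange_big /=; apply: eq_bigr => i _; rewrite exchange_big /=.
  apply: eq_bigr => j _; rewrite wsE mulr_suml; apply: eq_bigr => w _; ring.
have -> : \tr P = \sum_(w <- ws) dotv w w.
  by rewrite exchange_big; apply: eq_bigr => i _; rewrite wsE.
by rewrite mulr_sumr; apply: ler_sum => w _; exact: Sk.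
Qed.

Lemma frobDl P P' S : frob (P + P') S = frob P S + frob P' S.
Proof.
rewrite -big_split; apply: eq_bigr => i _; rewrite -big_split.
by apply: eq_bigr => j _; rewrite /= mxE mulrDl.
Qed.

Lemma frobDr P S S' : frob P (S + S') = frob P S + frob P S'.
Proof.
rewrite -big_split; apply: eq_bigr => i _; rewrite -big_split.
by apply: eq_bigr => j _; rewrite /= mxE mulrDr.
Qed.

Lemma frobNr P S : frob P (- S) = - frob P S.
Proof.
rewrite -sumrN; apply: eq_bigr => i _; rewrite -sumrN.
by apply: eq_bigr => j _; rewrite /= mxE mulrN.
Qed.

Lemma frobZl a P S : frob (a *: P) S = a * frob P S.
Proof.
rewrite /frob mulr_sumr; apply: eq_bigr => i _; rewrite mulr_sumr.
by apply: eq_bigr => j _; rewrite /= mxE mulrA.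
Qed.

Lemma frob_rank1 e S : frob (e^T *m e) S = qf S e.
Proof.
apply: eq_bigr => i _; apply: eq_bigr => j _.
by rewrite mxE big_ord1 mxE mulrC mulrA.
Qed.

Lemma qfDl P S x : qf (P + S) x = qf P x + qf S x.
Proof.
rewrite -big_split; apply: eq_bigr => i _; rewrite -big_split.
by apply: eq_bigr => j _; rewrite /= mxE !mulrDl.
Qed.

Lemma qfZl a P x : qf (a *: P) x = a * qf P x.
Proof.
rewrite /qf mulr_sumr; apply: eq_bigr => i _; rewrite mulr_sumr.
by apply: eq_bigr => j _; rewrite /= mxE !mulrA.
Qed.

Lemma qfNl P x : qf (- P) x = - qf P x.
Proof. by rewrite -scaleN1r qfZl mulN1r. Qed.

Lemma qf_rank1 e x : qf (e^T *m e) x = dotv e x ^+ 2.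
Proof.
rewrite expr2 mulr_suml; apply: eq_bigr => i _; rewrite mulr_sumr.
by apply: eq_bigr => j _; rewrite mxE big_ord1 mxE; ring.
Qed.

Lemma qf_scalar a x : qf a%:M x = a * dotv x x.
Proof.
rewrite qfE mulr_sumr; apply: eq_bigr => i _.
rewrite (bigD1 i) //= big1 => [|j ji].
  by rewrite mxE eqxx mulr1n addr0; ring.
by rewrite mxE eq_sym (negbTE ji) mulr0n mul0r.
Qed.

Lemma cauchy_schwarz x y : dotv x y ^+ 2 <= dotv x x * dotv y y.
Proof.
have [x0|x0] := eqVneq (dotv x x) 0.
  suff -> : x = 0 by rewrite !dotv0l expr0n mul0r.
  apply/rowP => i; rewrite mxE.
  apply/eqP; rewrite -sqrf_eq0 expr2; apply/eqP.
  by apply: (psumr_eq0P _ x0) => // j _; rewrite -expr2 sqr_ge0.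
have xp : 0 < dotv x x by rewrite lt_def x0 dotv_ge0.
have := dotv_ge0 (y - (dotv x y / dotv x x) *: x).
rewrite dotvDl !dotvDr !dotvNl !dotvNr dotvZl !dotvZr (dotvC y x) dotvZl.
rewrite -(pmulr_rge0 _ xp) => H; rewrite -subr_ge0; apply: le_trans H _.
by rewrite le_eqVlt; apply/orP; left; apply/eqP; field.
Qed.

Lemma enormE x : enorm x = Num.sqrt (dotv x x).
Proof. by rewrite /enorm; congr Num.sqrt; apply: eq_bigr => i _; rewrite expr2. Qed.

Lemma enorm_ge0 x : 0 <= enorm x.
Proof. exact: sqrtr_ge0. Qed.

Lemma enorm_sqr x : enorm x ^+ 2 = dotv x x.
Proof. by rewrite enormE sqr_sqrtr // dotv_ge0. Qed.

Lemma dotv_le x y : `|dotv x y| <= enorm x * enorm y.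
Proof.
rewrite -(ler_pXn2r (ltn0Sn 1)) ?nnegrE ?mulr_ge0 ?enorm_ge0 //.
by rewrite exprMn !enorm_sqr real_normK ?num_real // cauchy_schwarz.
Qed.

Lemma coord_le_enorm x i : `|x 0 i| <= enorm x.
Proof.
rewrite -(ler_pXn2r (ltn0Sn 1)) ?nnegrE ?enorm_ge0 // enorm_sqr.
rewrite real_normK ?num_real // expr2 /dotv (bigD1 i) //= lerDl.
by apply: sumr_ge0 => j _; rewrite -expr2 sqr_ge0.
Qed.

Lemma enormD x y : enorm (x + y) <= enorm x + enorm y.
Proof.
rewrite -(ler_pXn2r (ltn0Sn 1)) ?nnegrE ?addr_ge0 ?enorm_ge0 //.
rewrite sqrrD !enorm_sqr dotvDl !dotvDr (dotvC y x).
have := le_trans (ler_norm _) (dotv_le x y); rewrite -mulr_natr; lra.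
Qed.

Lemma enormZ a x : enorm (a *: x) = `|a| * enorm x.
Proof.
by rewrite !enormE dotvZl dotvZr mulrA -expr2 sqrtrM ?sqr_ge0 // sqrtr_sqr.
Qed.

Lemma enormN x : enorm (- x) = enorm x.
Proof. by rewrite -scaleN1r enormZ normrN1 mul1r. Qed.

Lemma enorm0 : enorm (0 : 'rV[R]_n) = 0.
Proof. by rewrite enormE dotv0l sqrtr0. Qed.

Lemma enorm_eq0 x : enorm x = 0 -> x = 0.
Proof.
move=> x0; apply/rowP => i; rewrite mxE; apply/eqP; rewrite -normr_le0 -x0.
exact: coord_le_enorm.
Qed.

Lemma norm_le_enorm x : `|x| <= enorm x.
Proof. by apply: norm_le_coord; [exact: enorm_ge0|exact: coord_le_enorm]. Qed.

Lemma enorm_le_sum x : enorm x <= \sum_i `|x 0 i|.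
Proof.
have s0 : 0 <= \sum_i `|x 0 i| by apply: sumr_ge0.
rewrite -(ler_pXn2r (ltn0Sn 1)) ?nnegrE ?enorm_ge0 // enorm_sqr expr2 mulr_suml.
apply: ler_sum => i _; apply: le_trans (ler_norm _) _; rewrite normrM.
by rewrite ler_wpM2l // (bigD1 i) //= lerDl sumr_ge0.
Qed.

Lemma enorm_le_norm x : enorm x <= n%:R * `|x|.
Proof.
apply: le_trans (enorm_le_sum x) _.
apply: (@le_trans _ _ (\sum_(i < n) `|x|)).
  by apply: ler_sum => i _; exact: coord_le_norm.
by rewrite sumr_const card_ord mulr_natl.
Qed.

End QuadraticForms.

(** * Optimality conditions after doubling the variables *)

Section MaximumPoint.
Context {R : realType} {n : nat}.
Implicit Types (X Y z w : 'rV[R]_n) (v : 'rV[R]_n -> R).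

Lemma jet2_ln (s a : R) : 0 < s ->
  jet2 (fun t => ln (s + a * t)) (a / s) (- (a / s) ^+ 2).
Proof.
move=> s0.
pose g1 (t : R) := a / (s + a * t).
have -> : a / s = g1 0 by rewrite /g1 mulr0 addr0.
have pos : \forall t \near (0 : R), 0 < s + a * t.
  have : (s + a * t) @[t --> (0 : R)] --> s + a * 0.
    by apply: cvgD; [exact: cvg_cst|apply: cvgM; [exact: cvg_cst|exact: cvg_id]].
  by rewrite mulr0 addr0 => /cvgr_gt; exact.
apply: jet2_derive.
  apply: filterS pos => t pt.
  have I : is_derive (t : R) 1 (fun t => s + a * t) a.
    by apply: is_derive_eq; rewrite /GRing.scale /=; ring. 
  have := @is_derive1_comp R (@ln R) (fun t => s + a * t) t _ _ (is_derive1_ln pt) I.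
  by rewrite mulrC.
have I : is_derive (0 : R) 1 (fun t => s + a * t) a.
  by apply: is_derive_eq; rewrite /GRing.scale /=; ring.
have nz : s + a * 0 != 0 by rewrite mulr0 addr0 gt_eqF.
have J := @is_deriveV R (fun t => s + a * t) 0 a 1 nz I.
apply: is_derive_eq; rewrite /g1 /GRing.scale /= mulr0 addr0.
by field; rewrite gt_eqF.
Qed.

Lemma jet2_sqrt_line (r : R) : 0 < r ->
  jet2 (fun t => Num.sqrt (r + 2 * t)) (Num.sqrt r)^-1 (- (r * Num.sqrt r)^-1).
Proof.
move=> r0.
pose g1 (t : R) := (Num.sqrt (r + 2 * t))^-1.
have -> : (Num.sqrt r)^-1 = g1 0 by rewrite /g1 mulr0 addr0.
have pos : \forall t \near (0 : R), 0 < r + 2 * t.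
  have : (r + 2 * t) @[t --> (0 : R)] --> r + 2 * 0.
    by apply: cvgD; [exact: cvg_cst|apply: cvgM; [exact: cvg_cst|exact: cvg_id]].
  by rewrite mulr0 addr0 => /cvgr_gt; exact.
have D (t : R) : 0 < r + 2 * t ->
    is_derive (t : R) 1 (fun t => Num.sqrt (r + 2 * t)) (g1 t).
  move=> pt.
  have I : is_derive (t : R) 1 (fun t => r + 2 * t) 2.
    by apply: is_derive_eq; rewrite /GRing.scale /=; ring.
  have := @is_derive1_comp R (@Num.sqrt R) (fun t => r + 2 * t) t _ _ (is_derive1_sqrt pt) I.
  suff -> : (2 * Num.sqrt (r + 2 * t))^-1 * 2 = g1 t by [].
  by rewrite /g1; field; rewrite gt_eqF // sqrtr_gt0.
apply: jet2_derive; first by apply: filterS pos => t; exact: D.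
have p0 : 0 < r + 2 * 0 by rewrite mulr0 addr0.
have nz : Num.sqrt (r + 2 * 0) != 0 by rewrite gt_eqF // sqrtr_gt0.
have J := @is_deriveV R (fun t => Num.sqrt (r + 2 * t)) 0 _ 1 nz (D 0 p0).
apply: is_derive_eq; rewrite /g1 /GRing.scale /= mulr0 addr0.
have q0 : 0 < Num.sqrt r by rewrite sqrtr_gt0.
have := sqr_sqrtr (ltW r0); move: q0; set q := Num.sqrt r => q0 <-.
by field; rewrite gt_eqF.
Qed.

(** The fourth root of [dotv X X] is concave in [dotv X X], hence lies below its
    tangent. *)
Lemma sqrt_enorm_le X w : 0 < enorm X -> Num.sqrt (enorm (X + w)) <=
  Num.sqrt (enorm X) +
  (2 * dotv X w + dotv w w) / (4 * enorm X * Num.sqrt (enorm X)).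
Proof.
move=> r0.
set m := Num.sqrt (enorm (X + w)); set p := Num.sqrt (enorm X).
have p0 : 0 < p by rewrite sqrtr_gt0.
have m0 : 0 <= m by rewrite sqrtr_ge0.
have mE : m ^+ 2 = enorm (X + w) by rewrite sqr_sqrtr // enorm_ge0.
have pE : p ^+ 2 = enorm X by rewrite sqr_sqrtr // enorm_ge0.
have -> : 2 * dotv X w + dotv w w = m ^+ 2 ^+ 2 - p ^+ 2 ^+ 2.
  by rewrite mE pE !enorm_sqr dotvDl !dotvDr (dotvC w X); ring.
rewrite -pE; rewrite -subr_ge0.
have -> : p + (m ^+ 2 ^+ 2 - p ^+ 2 ^+ 2) / (4 * p ^+ 2 * p) - m =
   (m - p) ^+ 2 * (m ^+ 2 + 2 * m * p + 3 * p ^+ 2) / (4 * p ^+ 3).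
  by field; rewrite gt_eqF.
have p0' := ltW p0; apply: divr_ge0; last by apply: mulr_ge0 => //; apply: exprn_ge0.
apply: mulr_ge0; first exact: sqr_ge0.
apply: addr_ge0; last by apply: mulr_ge0 => //; apply: exprn_ge0.
by apply: addr_ge0; [apply: exprn_ge0|do 2?apply: mulr_ge0].
Qed.

(** The function maximised: the difference of two values of [v], penalised by
    a concave function of the distance, by a term pinning both points to the
    origin, and by a logarithmic barrier along the hyperplane [X k = 0]. *)
Definition coupled v (k : 'I_n) (C M kap : R) X Y : R :=
  v X - v Y - C * Num.sqrt (enorm (X - Y)) - M * (dotv X X + dotv Y Y)
  + kap * (ln (X 0 k) + ln (Y 0 k)).

Variables (v : 'rV[R]_n -> R) (k : 'I_n) (C M kap d0 : R) (X Y pX pY : 'rV[R]_n)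
  (SX SY : 'M[R]_n).
Hypotheses (C0 : 0 <= C) (d0_gt0 : 0 < d0) (Xk : 0 < X 0 k) (Yk : 0 < Y 0 k) (XY : 0 < enorm (X - Y)).
Hypothesis jX : forall z, jet2 (fun t => v (X + t *: z)) (dotv pX z) (qf SX z).
Hypothesis jY : forall z, jet2 (fun t => v (Y + t *: z)) (dotv pY z) (qf SY z).
Hypothesis Pmax : forall X' Y', enorm (X' - X) < d0 -> enorm (Y' - Y) < d0 ->
  coupled v k C M kap X' Y' <= coupled v k C M kap X Y.

Let s := X 0 k.
Let s' := Y 0 k.
Let r := enorm (X - Y).
Let Th := C / (2 * r * Num.sqrt r).

(** Replacing the penalisation by an upper bound [q] that touches it at the
    origin preserves the maximum along the line. *)
Let max_test z z' (q : R -> R) (b c : R) : jet2 q b c -> q 0 = Num.sqrt r ->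
  (exists2 d : R, 0 < d & forall t, `|t| < d ->
     Num.sqrt (enorm (X - Y + t *: (z - z'))) <= q t) ->
  dotv pX z - dotv pY z' - C * b - M * (2 * dotv X z + 2 * dotv Y z')
    + kap * (z 0 k / s + z' 0 k / s') = 0 /\
  qf SX z - qf SY z' - C * c - M * (2 * dotv z z + 2 * dotv z' z')
    - kap * ((z 0 k / s) ^+ 2 + (z' 0 k / s') ^+ 2) <= 0.
Proof.
move=> jq q0 [d d_gt0 qd].
pose g t := v (X + t *: z) + (-1) * v (Y + t *: z') + (- C) * q t
  + (- M) * (dotv X X + dotv Y Y + (2 * dotv X z + 2 * dotv Y z') * t +
             (2 * dotv z z + 2 * dotv z' z') * t ^+ 2 / 2)
  + (kap * ln (s + z 0 k * t) + kap * ln (s' + z' 0 k * t)).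
have jg : jet2 g _ _ := jet2D (jet2D (jet2D (jet2D (jX z) (jet2Z (-1) (jY z')))
   (jet2Z (- C) jq)) (jet2Z (- M) (@jet2_poly _ _ _ _)))
   (jet2D (jet2Z kap (jet2_ln (z 0 k) Xk)) (jet2Z kap (jet2_ln (z' 0 k) Yk))).
have [|E I] := jet2_max jg; last first.
  split; first by rewrite -[RHS]E; ring.
  by apply: le_trans I; rewrite le_eqVlt; apply/orP; left; apply/eqP; ring.
have B0 : 0 < 1 + enorm z + enorm z'.
  by rewrite -addrA ltr_wpDr ?addr_ge0 ?enorm_ge0.
exists (Num.min d (d0 / (1 + enorm z + enorm z'))); first by rewrite lt_min d_gt0 divr_gt0.
move=> t; rewrite lt_min => /andP[td]; rewrite ltr_pdivlMr // => td0.
have zd : enorm (X + t *: z - X) < d0.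
  rewrite addrAC subrr add0r enormZ; apply: le_lt_trans td0; rewrite ler_wpM2l //.
  by have := enorm_ge0 z; have := enorm_ge0 z'; lra.
have z'd : enorm (Y + t *: z' - Y) < d0.
  rewrite addrAC subrr add0r enormZ; apply: le_lt_trans td0; rewrite ler_wpM2l //.
  by have := enorm_ge0 z; have := enorm_ge0 z'; lra.
have := Pmax zd z'd.
have -> : coupled v k C M kap X Y = g 0.
  rewrite /g /coupled q0 !scale0r !addr0 -/s -/s' -/r !mulr0 !addr0; ring.
apply: le_trans.
have Cq : C * Num.sqrt (enorm (X + t *: z - (Y + t *: z'))) <= C * q t.
  rewrite ler_wpM2l // (_ : _ - _ = X - Y + t *: (z - z')) ?qd //.
  by rewrite scalerBr opprD addrACA.
rewrite /coupled /g !dotvDl !dotvDr !dotvZl !dotvZr (dotvC z X) (dotvC z' Y).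
rewrite !mxE -/s -/s' (mulrC (z 0 k)) (mulrC (z' 0 k)).
move: Cq; set l1 := ln _; set l2 := ln _; set cc := C * _; set cq := C * q t.
move: (v (X + _)) (v (Y + _)) => vx vy Cq; rewrite -subr_ge0.
apply: (@le_trans _ _ (cq - cc)); first by rewrite subr_ge0.
by rewrite le_eqVlt; apply/orP; left; apply/eqP; rewrite /cq; field.
Qed.

Let r0 : r != 0. Proof. by rewrite gt_eqF. Qed.
Let w0 : Num.sqrt r != 0. Proof. by rewrite gt_eqF // sqrtr_gt0. Qed.

(* The concavity of the fourth root puts a parabola above the penalisation. *)
Let upper w t : Num.sqrt (enorm (X - Y + t *: w)) <= Num.sqrt r +
  dotv (X - Y) w / (2 * r * Num.sqrt r) * t + dotv w w / (2 * r * Num.sqrt r) * t ^+ 2 / 2.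
Proof.
apply: le_trans (sqrt_enorm_le _ XY) _.
rewrite dotvZl !dotvZr le_eqVlt; apply/orP; left; apply/eqP.
by rewrite -/r; field; rewrite r0 w0.
Qed.

Let tangent_test z z' :
  dotv pX z - dotv pY z' - Th * dotv (X - Y) (z - z') - M * (2 * dotv X z + 2 * dotv Y z')
    + kap * (z 0 k / s + z' 0 k / s') = 0 /\
  qf SX z - qf SY z' - Th * dotv (z - z') (z - z') - M * (2 * dotv z z + 2 * dotv z' z')
    - kap * ((z 0 k / s) ^+ 2 + (z' 0 k / s') ^+ 2) <= 0.
Proof.
have J := jet2_poly (Num.sqrt r) (dotv (X - Y) (z - z') / (2 * r * Num.sqrt r))
  (dotv (z - z') (z - z') / (2 * r * Num.sqrt r)).
have [||E I] := @max_test z z' _ _ _ J.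
- by rewrite mulr0 expr0n /= mulr0 mul0r !addr0.
- by exists 1 => // t _; exact: upper.
split; first by rewrite -[RHS]E /Th; field; rewrite r0 w0 !gt_eqF.
apply: le_trans I; rewrite le_eqVlt; apply/orP; left; apply/eqP.
by rewrite /Th; field; rewrite r0 w0 !gt_eqF.
Qed.

Let qf0 (S : 'M[R]_n) : qf S 0 = 0.
Proof. by rewrite -(scale0r 0) qfZ expr0n mul0r. Qed.

Let dotv0r z : dotv z 0 = 0. Proof. by rewrite dotvC dotv0l. Qed.

Let Xk0 : s != 0. Proof. by rewrite gt_eqF. Qed.
Let Yk0 : s' != 0. Proof. by rewrite gt_eqF. Qed.

Lemma max_gradX : pX = Th *: (X - Y) + (2 * M) *: X - (kap / s) *: delta_mx 0 k.
Proof.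
apply/rowP => i; have [+ _] := tangent_test (delta_mx 0 i) 0.
rewrite !dotv0r !subr0 !dotv_delta !mxE eqxx /= => E.
rewrite -[LHS]subr0 -E (eq_sym i k).
by case: eqP => _; rewrite ?mulr1n ?mulr0n; field; rewrite Xk0 Yk0.
Qed.

Lemma max_gradY : pY = Th *: (X - Y) - (2 * M) *: Y + (kap / s') *: delta_mx 0 k.
Proof.
apply/rowP => i; have [+ _] := tangent_test 0 (delta_mx 0 i).
rewrite !dotv0r !sub0r dotvNr !dotv_delta !mxE eqxx /= => E.
rewrite -[LHS]addr0 -E (eq_sym i k).
by case: eqP => _; rewrite ?mulr1n ?mulr0n; field; rewrite Xk0 Yk0.
Qed.

Lemma max_hessX z : qf SX z - kap / s ^+ 2 * z 0 k ^+ 2 <= (Th + 2 * M) * dotv z z.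
Proof.
have [_] := tangent_test z 0; rewrite qf0 !dotv0r !subr0 mxE mul0r => I.
rewrite -subr_le0; apply: le_trans I; rewrite le_eqVlt; apply/orP; left; apply/eqP.
by field; rewrite Xk0.
Qed.

Lemma max_hessY z : - qf SY z - kap / s' ^+ 2 * z 0 k ^+ 2 <= (Th + 2 * M) * dotv z z.
Proof.
have [_] := tangent_test 0 z; rewrite qf0 !dotv0r !sub0r !dotvNr !dotvNl mxE mul0r => I.
rewrite -subr_le0; apply: le_trans I; rewrite le_eqVlt; apply/orP; left; apply/eqP.
by field; rewrite Yk0.
Qed.

Lemma max_hessB z : qf SX z - kap / s ^+ 2 * z 0 k ^+ 2 -
  (qf SY z + kap / s' ^+ 2 * z 0 k ^+ 2) <= 4 * M * dotv z z.
Proof.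
have [_] := tangent_test z z; rewrite subrr !dotv0r => I.
rewrite -subr_le0; apply: le_trans I; rewrite le_eqVlt; apply/orP; left; apply/eqP.
by field; rewrite Yk0 Xk0.
Qed.

(** Moving the two points symmetrically along the line that joins them probes
    the concavity of the penalisation. *)
Lemma max_hess_line e : e = r^-1 *: (X - Y) ->
  qf SX e - kap / s ^+ 2 * e 0 k ^+ 2 - (qf SY e + kap / s' ^+ 2 * e 0 k ^+ 2)
  <= 4 * M - 2 * Th.
Proof.
move=> eE; have ee : dotv e e = 1.
  by rewrite eE dotvZl dotvZr -enorm_sqr -/r; field.
have [||_] := @max_test e (- e) _ _ _ (jet2_sqrt_line XY).
- by rewrite mulr0 addr0.
- exists (r / 2) => [|t]; first by rewrite divr_gt0.
  rewrite ltr_norml => /andP[t1 _].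
  rewrite opprK (_ : X - Y + _ = (1 + 2 * t / r) *: (X - Y)).
    rewrite enormZ -/r ger0_norm; last first.
      by rewrite -(pmulr_lge0 _ XY) -/r mulrDl divfK //; lra.
    by rewrite mulrDl divfK // mul1r.
  rewrite eE -scalerDl scalerA [RHS]scalerDl scale1r; congr (_ + _ *: _).
  by field.
rewrite !dotvNr !dotvNl !opprK ee -(scaleN1r e) qfZ !mxE => I.
rewrite -subr_le0; apply: le_trans I; rewrite le_eqVlt; apply/orP; left; apply/eqP.
by rewrite /Th -/r; field; rewrite Yk0 Xk0 r0 w0.
Qed.

End MaximumPoint.

(** * The coupling estimate for an operator with Bessel drift *)

Section EuclideanContinuity.
Context {R : realType} {n : nat}.

Lemma dotvv_continuous : continuous (fun X : 'rV[R]_n => dotv X X).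
Proof.
apply: continuous_sum => i X.
exact: (cvgM (@coord_continuous _ _ _ _ _ X) (@coord_continuous _ _ _ _ _ X)).
Qed.

Lemma enorm_continuous : continuous (@enorm R n).
Proof.
have -> : @enorm R n = Num.sqrt \o (fun X : 'rV[R]_n => dotv X X).
  by apply/funext => X; rewrite enormE.
move=> X; apply: continuous_comp; [exact: dotvv_continuous|exact: sqrt_continuous].
Qed.

End EuclideanContinuity.

Section MoreForms.
Context {R : realType} {n : nat}.
Implicit Types (P S : 'M[R]_n).

Lemma frobC P S : frob P S = frob S P.
Proof. by apply: eq_bigr => i _; apply: eq_bigr => j _; rewrite mulrC. Qed.

Lemma tr_qf P : \tr P = \sum_i qf P (delta_mx 0 i).
Proof. by apply: eq_bigr => i _; rewrite qf_delta. Qed.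

Lemma qfBl P S x : qf (P - S) x = qf P x - qf S x.
Proof. by rewrite qfDl qfNl. Qed.

(** The drift [h / s] of a Bessel process pushes two points towards each
    other, up to the oscillation of [h]. *)
Lemma bessel_drift_le (h1 h2 s1 s2 e : R) : 0 < s1 -> 0 < s2 -> 0 <= h1 ->
  0 <= h2 -> `|h1 - h2| <= e -> (h1 / s1 - h2 / s2) * (s1 - s2) <= e.
Proof.
wlog: s1 s2 h1 h2 / s2 <= s1 => [W|s21] s10 s20 h10 h20 he.
  have [|/ltW] := leP s2 s1; first by move=> ?; exact: W.
  move=> s12; rewrite -mulrNN !opprB; apply: W => //; by rewrite distrC.
have -> : (h1 / s1 - h2 / s2) * (s1 - s2) =
  (h1 - h2) * ((s1 - s2) / s1) - h2 * ((s1 - s2) ^+ 2 / (s1 * s2)).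
  by field; rewrite !gt_eqF.
apply: (@le_trans _ _ (e * ((s1 - s2) / s1))).
  rewrite lerBlDr ler_wpDr //; last first.
    by rewrite ler_wpM2r ?divr_ge0 ?subr_ge0 ?(ltW s10) // (le_trans (ler_norm _)).
  by rewrite mulr_ge0 // divr_ge0 ?sqr_ge0 ?mulr_ge0 ?ltW.
rewrite -[leRHS]mulr1 ler_wpM2l ?(le_trans (normr_ge0 _) he) //.
by rewrite ler_pdivrMr // mul1r gerBl ltW.
Qed.

End MoreForms.

(** A second order operator on a half ball, uniformly elliptic with nearly
    constant leading coefficients, whose normal drift is singular like [h / s]
    in the distance [s] to the flat boundary. *)
Section HalfBall.
Context {R : realType} {n : nat}.
Variables (k : 'I_n) (rho lam eps K Kf Ku : R) (A0 : 'M[R]_n).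
Variables (Ah : 'rV[R]_n -> 'M[R]_n) (Bh : 'rV[R]_n -> 'rV[R]_n).
Variables (h v : 'rV[R]_n -> R).
Implicit Types X Y z : 'rV[R]_n.

Let D X := 0 < X 0 k /\ enorm X <= rho.

Hypotheses (rho0 : 0 < rho) (rho1 : rho <= 1) (lam0 : 0 < lam) (eps0 : 0 <= eps).
Hypotheses (K0 : 0 <= K) (Kf0 : 0 <= Kf).
Hypothesis small : (4 * n%:R + 1) * eps + 4 * K * (n.+1%:R * rho) <= lam.
Hypothesis A0_sym : A0^T = A0.
Hypothesis A0_ell : forall z, (lam + eps) * dotv z z <= qf A0 z.
Hypothesis A0_tr : \tr A0 <= K.
Hypothesis Ah_sym : forall X, D X -> (Ah X)^T = Ah X.
Hypothesis Ah_osc : forall X z, D X -> `|qf (Ah X) z - qf A0 z| <= eps * dotv z z.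
Hypothesis Bh_tan : forall X i, D X -> i != k -> `|Bh X 0 i| <= K.
Hypothesis Bh_nor : forall X, D X -> `|X 0 k * Bh X 0 k - h X| <= K * X 0 k ^+ 2.
Hypothesis h_ge0 : forall X, D X -> 0 <= h X.
Hypothesis h_le : forall X, D X -> h X <= K.
Hypothesis h_osc : forall X Y, D X -> D Y -> `|h X - h Y| <= eps.
(* This makes the logarithm of the distance an almost supersolution. *)
Hypothesis barrier : forall X, D X -> Ah X k k <= X 0 k * Bh X 0 k + K * X 0 k ^+ 2.
Hypothesis v_cont : forall X, D X -> {for X, continuous v}.
Hypothesis v_osc : forall X Y, D X -> D Y -> v X - v Y <= Ku.
Hypothesis v_sol : forall X, D X -> exists (p : 'rV[R]_n) (S : 'M[R]_n),
  (forall z, jet2 (fun t => v (X + t *: z)) (dotv p z) (qf S z)) /\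
  `|frob (Ah X) S + dotv (Bh X) p| <= Kf.

Let P X := Ah X - A0 + eps%:M.

Let P_sym X : D X -> (P X)^T = P X.
Proof. by move=> DX; rewrite /P raddfD /= raddfB /= tr_scalar_mx A0_sym Ah_sym. Qed.

Let P_qf X z : D X -> 0 <= qf (P X) z <= 2 * eps * dotv z z.
Proof.
move=> /(Ah_osc z); rewrite /P qfDl qfBl qf_scalar ler_norml => /andP[H1 H2].
by apply/andP; split; lra.
Qed.

Let P_tr X : D X -> \tr (P X) <= 2 * n%:R * eps.
Proof.
move=> DX; rewrite tr_qf; apply: (@le_trans _ _ (\sum_(i < n) 2 * eps)).
  apply: ler_sum => i _; have /andP[_] := P_qf (delta_mx 0 i) DX.
  by rewrite dotv_delta mxE !eqxx mulr1.
by rewrite sumr_const card_ord -[X in X <= _]mulr_natr mulrAC.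
Qed.

Let E : 'M[R]_n := (delta_mx 0 k : 'rV[R]_n)^T *m delta_mx 0 k.

Let qf_E z : qf E z = z 0 k ^+ 2.
Proof. by rewrite qf_rank1 dotvC dotv_delta. Qed.

Let frob_E (S : 'M[R]_n) : frob S E = S k k.
Proof. by rewrite frobC frob_rank1 qf_delta. Qed.

Let drift_pair X Y : D X -> D Y ->
  dotv (Bh X - Bh Y) (X - Y) <= eps + 4 * K * (n.+1%:R * rho).
Proof.
move=> DX DY; have [[Xk Xr] [Yk Yr]] := (DX, DY).
have co Z i : D Z -> `|Z 0 i| <= rho.
  by move=> [_]; apply: le_trans; exact: coord_le_enorm.
have coB i : `|X 0 i - Y 0 i| <= 2 * rho.
  by apply: le_trans (ler_normB _ _) _; have := co X i DX; have := co Y i DY; lra.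
rewrite /dotv (bigD1 k) //=.
have tang : \sum_(i | i != k) (Bh X - Bh Y) 0 i * (X - Y) 0 i <= 4 * K * (n%:R * rho).
  apply: (@le_trans _ _ (\sum_(i : 'I_n | i != k) 4 * K * rho)).
    apply: ler_sum => i ik; rewrite !mxE; apply: le_trans (ler_norm _) _.
    rewrite normrM (_ : 4 * K * rho = (2 * K) * (2 * rho)); last by ring.
    rewrite ler_pM // ?coB //; apply: le_trans (ler_normB _ _) _.
    by have := Bh_tan DX ik; have := Bh_tan DY ik; lra.
  apply: (@le_trans _ _ (\sum_(i < n) 4 * K * rho)).
    rewrite [leRHS](bigD1 k) //= ler_wpDl // mulr_ge0 ?mulr_ge0 //; exact: ltW.
  by rewrite sumr_const card_ord -[X in X <= _]mulr_natl mulrCA.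
have nor : (Bh X - Bh Y) 0 k * (X - Y) 0 k <= eps + 4 * K * rho.
  rewrite !mxE; set b := Bh X 0 k; set b' := Bh Y 0 k; set s := X 0 k; set s' := Y 0 k.
  have := bessel_drift_le Xk Yk (h_ge0 DX) (h_ge0 DY) (h_osc DX DY).
  rewrite -/s -/s'.
  have e1 : `|b - h X / s| <= K * rho.
    rewrite -(ler_pM2l Xk) -{1}(gtr0_norm Xk) -normrM -/s.
    rewrite (_ : s * (b - h X / s) = s * b - h X); last by field; rewrite gt_eqF.
    apply: le_trans (Bh_nor DX) _; rewrite -/s expr2 mulrCA ler_wpM2l ?(ltW Xk) //.
    by rewrite ler_wpM2l // (le_trans (ler_norm _)) ?co.
  have e2 : `|b' - h Y / s'| <= K * rho.
    rewrite -(ler_pM2l Yk) -{1}(gtr0_norm Yk) -normrM -/s'.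
    rewrite (_ : s' * (b' - h Y / s') = s' * b' - h Y); last by field; rewrite gt_eqF.
    apply: le_trans (Bh_nor DY) _; rewrite -/s' expr2 mulrCA ler_wpM2l ?(ltW Yk) //.
    by rewrite ler_wpM2l // (le_trans (ler_norm _)) ?co.
  have e3 : ((b - h X / s) - (b' - h Y / s')) * (s - s') <= 4 * K * rho.
    apply: le_trans (ler_norm _) _; rewrite normrM.
    rewrite (_ : 4 * K * rho = (2 * (K * rho)) * 2); last by ring.
    rewrite ler_pM //.
      by apply: le_trans (ler_normB _ _) _; lra.
    by apply: le_trans (coB k) _; move: rho1; lra.
  by move: e3; lra.
by rewrite (_ : 4 * K * (n.+1%:R * rho) = 4 * K * rho + 4 * K * (n%:R * rho)); [lra|rewrite -[n.+1%:R]natr1; ring].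
Qed.

Let drift_pos X : D X -> dotv (Bh X) X <= K * (n%:R + 2).
Proof.
move=> DX; have [Xk Xr] := DX.
have co i : `|X 0 i| <= 1.
  by apply: le_trans (coord_le_enorm _ _) (le_trans Xr rho1).
rewrite /dotv (bigD1 k) //=.
have tang : \sum_(i | i != k) Bh X 0 i * X 0 i <= K * n%:R.
  apply: (@le_trans _ _ (\sum_(i : 'I_n | i != k) K)).
    apply: ler_sum => i ik; apply: le_trans (ler_norm _) _.
    by rewrite normrM -[K]mulr1 ler_pM // Bh_tan.
  apply: (@le_trans _ _ (\sum_(i < n) K)).
    by rewrite [leRHS](bigD1 k) //= ler_wpDl.
  by rewrite sumr_const card_ord -[X in X <= _]mulr_natr.
have : K * X 0 k ^+ 2 <= K.
  rewrite -[leRHS]mulr1 ler_wpM2l // expr_le1 ?(ltW Xk) //.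
  by apply: le_trans (ler_norm _) (co k).
have := Bh_nor DX; rewrite ler_norml => /andP[_]; have := h_le DX.
by rewrite mulrC; lra.
Qed.

(** Subtracting the equations at the two points bounds the slope [Th] of the
    penalisation. In the direction [e] of [X - Y] the concavity of the square
    root contributes [- 2 * lam * Th]; every other term with a factor [Th] comes
    from the oscillation of the coefficients or from the drift, and [small]
    absorbs it. *)
Let no_coupled_max (M kap Th : R) X Y (pX pY : 'rV[R]_n) (SX SY : 'M[R]_n)
    (s := X 0 k) (s' := Y 0 k) :
  0 <= M -> 0 < kap -> kap <= 1 -> 0 <= Th -> D X -> D Y -> 0 < enorm (X - Y) ->
  pX = Th *: (X - Y) + (2 * M) *: X - (kap / s) *: delta_mx 0 k ->
  pY = Th *: (X - Y) - (2 * M) *: Y + (kap / s') *: delta_mx 0 k ->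
  (forall z, qf SX z - kap / s ^+ 2 * z 0 k ^+ 2 <= (Th + 2 * M) * dotv z z) ->
  (forall z, - qf SY z - kap / s' ^+ 2 * z 0 k ^+ 2 <= (Th + 2 * M) * dotv z z) ->
  (forall z, qf SX z - kap / s ^+ 2 * z 0 k ^+ 2 -
     (qf SY z + kap / s' ^+ 2 * z 0 k ^+ 2) <= 4 * M * dotv z z) ->
  (forall e, e = (enorm (X - Y))^-1 *: (X - Y) ->
     qf SX e - kap / s ^+ 2 * e 0 k ^+ 2 - (qf SY e + kap / s' ^+ 2 * e 0 k ^+ 2)
     <= 4 * M - 2 * Th) ->
  `|frob (Ah X) SX + dotv (Bh X) pX| <= Kf ->
  `|frob (Ah Y) SY + dotv (Bh Y) pY| <= Kf ->
  lam * Th <= 2 * Kf + 2 * K + M * (4 * K + 4 * lam + 8 * n%:R * eps + 4 * K * (n%:R + 2)).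
Proof.
move=> M0 kap0 kap1 Th0 DX DY XY pXE pYE hX hY hB hL eqX eqY.
have [[Xk Xr] [Yk Yr]] := (DX, DY).
(* The Hessians corrected by the second derivatives of the barrier. *)
pose TX := SX - (kap / s ^+ 2) *: E.
pose TY := SY + (kap / s' ^+ 2) *: E.
(* [G] is common to both points; the remainders [P X] and [P Y] are positive
   semidefinite with small trace. *)
pose G := A0 - eps%:M.
pose e := (enorm (X - Y))^-1 *: (X - Y).
have ee : dotv e e = 1.
  by rewrite /e dotvZl dotvZr -enorm_sqr; field; rewrite gt_eqF.
have f1 : frob (Ah X) SX = frob G TX + frob (P X) TX + kap / s ^+ 2 * Ah X k k.
  rewrite -frobDl (_ : G + P X = Ah X); last by apply/matrixP => i j; rewrite !mxE; ring.
  by rewrite /TX frobDr frobNr (frobC _ (_ *: E)) frobZl (frobC E) frob_E; ring.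
have f2 : frob (Ah Y) SY = frob G TY + frob (P Y) TY - kap / s' ^+ 2 * Ah Y k k.
  rewrite -frobDl (_ : G + P Y = Ah Y); last by apply/matrixP => i j; rewrite !mxE; ring.
  by rewrite /TY frobDr (frobC _ (_ *: E)) frobZl (frobC E) frob_E; ring.
have g1 : frob (P X) TX <= (Th + 2 * M) * (2 * n%:R * eps).
  apply: le_trans (psd_frob_le (P_sym DX) _ _) _.
  - by move=> z; have /andP[] := P_qf z DX.
  - by move=> z; rewrite /TX qfBl qfZl qf_E; exact: hX.
  - by rewrite ler_wpM2l ?P_tr // addr_ge0 // mulr_ge0.
have g2 : - frob (P Y) TY <= (Th + 2 * M) * (2 * n%:R * eps).
  rewrite -frobNr; apply: le_trans (psd_frob_le (P_sym DY) _ _) _.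
  - by move=> z; have /andP[] := P_qf z DY.
  - by move=> z; rewrite /TY qfNl qfDl qfZl qf_E opprD; exact: hY.
  - by rewrite ler_wpM2l ?P_tr // addr_ge0 // mulr_ge0.
have g3 : frob G TX - frob G TY <= 4 * M * K + lam * (4 * M - 2 * Th).
  rewrite -frobNr -frobDr.
  pose G' := G - lam *: (e^T *m e).
  have -> : G = G' + lam *: (e^T *m e) by rewrite /G' subrK.
  have qfZ' z : qf (TX - TY) z = qf SX z - kap / s ^+ 2 * z 0 k ^+ 2 -
     (qf SY z + kap / s' ^+ 2 * z 0 k ^+ 2).
    by rewrite qfBl /TX /TY qfBl qfDl !qfZl !qf_E.
  rewrite frobDl frobZl frob_rank1 lerD //; last first.
    by rewrite ler_wpM2l ?(ltW lam0) // qfZ' hL.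
  apply: le_trans (psd_frob_le _ _ _) _.
  - rewrite /G' /G !raddfB /= linearZ /= trmx_mul trmxK.
    by rewrite A0_sym tr_scalar_mx.
  - move=> z; rewrite /G' /G qfBl qfBl qf_scalar qfZl qf_rank1.
    have := A0_ell z; have := cauchy_schwarz e z; rewrite ee mul1r.
    by rewrite -(ler_pM2l lam0); lra.
  - by move=> z; rewrite qfZ'; exact: hB.
  - rewrite ler_wpM2l ?mulr_ge0 //; apply: le_trans A0_tr.
    rewrite /G' /G !tr_qf; apply: ler_sum => i _.
    rewrite !qfBl qf_scalar qfZl qf_rank1 dotv_delta mxE !eqxx mulr1.
    have : 0 <= lam * dotv e (delta_mx 0 i) ^+ 2 by rewrite mulr_ge0 ?sqr_ge0 // ltW.
    move: eps0; lra.
(* First and second order terms of the barrier balance by [barrier]. *)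
have bar Z : D Z -> kap / Z 0 k ^+ 2 * Ah Z k k - kap / Z 0 k * Bh Z 0 k <= K.
  move=> DZ; have [Zk _] := DZ.
  rewrite (_ : _ - _ = kap * ((Ah Z k k - Z 0 k * Bh Z 0 k) / Z 0 k ^+ 2)); last first.
    by field; rewrite gt_eqF.
  have : (Ah Z k k - Z 0 k * Bh Z 0 k) / Z 0 k ^+ 2 <= K.
    rewrite ler_pdivrMr ?exprn_gt0 //; have := barrier DZ; lra.
  move=> H; apply: (@le_trans _ _ (kap * K)); first by rewrite ler_wpM2l ?(ltW kap0).
  by rewrite -[leRHS]mul1r ler_wpM2r.
have bX := bar X DX; have bY := bar Y DY; rewrite -/s in bX; rewrite -/s' in bY.
have dp := drift_pair DX DY.
have dX := drift_pos DX; have dY := drift_pos DY.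
have eX : dotv (Bh X) pX = Th * dotv (Bh X) (X - Y) + 2 * M * dotv (Bh X) X
    - kap / s * Bh X 0 k.
  by rewrite pXE !(dotvDr, dotvNr, dotvZr) dotv_delta; ring.
have eY : dotv (Bh Y) pY = Th * dotv (Bh Y) (X - Y) - 2 * M * dotv (Bh Y) Y
    + kap / s' * Bh Y 0 k.
  by rewrite pYE !(dotvDr, dotvNr, dotvZr) dotv_delta; ring.
have dE : dotv (Bh X - Bh Y) (X - Y) = dotv (Bh X) (X - Y) - dotv (Bh Y) (X - Y).
  by rewrite dotvDl dotvNl.
move: eqX eqY; rewrite !ler_norml => /andP[eqX _] /andP[_ eqY].
rewrite f1 eX in eqX; rewrite f2 eY in eqY.
rewrite dE in dp.
have dp' := ler_wpM2l Th0 dp.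
have M20 : 0 <= 2 * M by rewrite mulr_ge0.
have dX' := ler_wpM2l M20 dX; have dY' := ler_wpM2l M20 dY.
have sm := ler_wpM2l Th0 small.
lra.
Qed.

Let coupled_cont C M kap X Y : D X -> D Y ->
  {for (X, Y), continuous (fun Z : 'rV[R]_n * 'rV[R]_n => coupled v k C M kap Z.1 Z.2)}.
Proof.
move=> DX DY.
have c1 : (fun Z : 'rV[R]_n * 'rV[R]_n => Z.1) Z @[Z --> (X, Y)] --> X by exact: cvg_fst.
have c2 : (fun Z : 'rV[R]_n * 'rV[R]_n => Z.2) Z @[Z --> (X, Y)] --> Y by exact: cvg_snd.
have v1 : v Z.1 @[Z --> (X, Y)] --> v X := cvg_comp _ _ c1 (v_cont DX).
have v2 : v Z.2 @[Z --> (X, Y)] --> v Y := cvg_comp _ _ c2 (v_cont DY).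
have cB : Z.1 - Z.2 @[Z --> (X, Y)] --> X - Y by exact: cvgB.
have e1 : enorm (Z.1 - Z.2) @[Z --> (X, Y)] --> enorm (X - Y) :=
  cvg_comp _ _ cB (@enorm_continuous R n (X - Y)).
have w1 : Num.sqrt (enorm (Z.1 - Z.2)) @[Z --> (X, Y)] --> Num.sqrt (enorm (X - Y)) :=
  cvg_comp _ _ e1 (@sqrt_continuous R _).
have q1 : dotv Z.1 Z.1 @[Z --> (X, Y)] --> dotv X X :=
  cvg_comp _ _ c1 (@dotvv_continuous R n X).
have q2 : dotv Z.2 Z.2 @[Z --> (X, Y)] --> dotv Y Y :=
  cvg_comp _ _ c2 (@dotvv_continuous R n Y).
have x1 : (fun Z : 'rV[R]_n * 'rV[R]_n => Z.1 0 k) Z @[Z --> (X, Y)] --> X 0 k :=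
  cvg_comp _ _ c1 (@coord_continuous _ _ _ 0 k X).
have x2 : (fun Z : 'rV[R]_n * 'rV[R]_n => Z.2 0 k) Z @[Z --> (X, Y)] --> Y 0 k :=
  cvg_comp _ _ c2 (@coord_continuous _ _ _ 0 k Y).
have l1 : (fun Z : 'rV[R]_n * 'rV[R]_n => ln (Z.1 0 k)) Z @[Z --> (X, Y)] --> ln (X 0 k) :=
  cvg_comp _ _ x1 (continuous_ln (proj1 DX)).
have l2 : (fun Z : 'rV[R]_n * 'rV[R]_n => ln (Z.2 0 k)) Z @[Z --> (X, Y)] --> ln (Y 0 k) :=
  cvg_comp _ _ x2 (continuous_ln (proj1 DY)).
exact: (cvgD (cvgB (cvgB (cvgB v1 v2) (cvgM (cvg_cst C) w1))
  (cvgM (cvg_cst M) (cvgD q1 q2))) (cvgM (cvg_cst kap) (cvgD l1 l2))).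
Qed.

(** If the bound fails at some pair of points, then [coupled] is positive there
    for a small weight [kap] of the barrier. The barrier and the term in [M]
    confine the set where [coupled] is positive to a compact subset of the
    product of the open half balls, off the diagonal; there the maximum is attained
    and [no_coupled_max] bounds [C], against the choice of [C]. *)
Lemma halfball_holder M C : Ku <= M * rho ^+ 2 -> 0 <= M ->
  8 * (2 * Kf + 2 * K + M * (4 * K + 4 * lam + 8 * n%:R * eps + 4 * K * (n%:R + 2)))
    < lam * C ->
  forall X Y, D X -> D Y ->
  v X - v Y <= C * Num.sqrt (enorm (X - Y)) + M * (dotv X X + dotv Y Y).
Proof.
move=> MK M0 CM X0 Y0 DX0 DY0; rewrite leNgt; apply/negP => gap.
have C0 : 0 <= C.
  rewrite -(pmulr_rge0 _ lam0); apply/ltW/(le_lt_trans _ CM).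
  by rewrite !(mulr_ge0, addr_ge0) // ltW.
have lnle X : D X -> ln (X 0 k) <= 0.
  move=> [Xk Xr]; rewrite ln_le0 //; apply: le_trans (le_trans (ler_norm _) _) rho1.
  exact: le_trans (coord_le_enorm _ _) Xr.
pose g := v X0 - v Y0 - C * Num.sqrt (enorm (X0 - Y0)) - M * (dotv X0 X0 + dotv Y0 Y0).
have g0 : 0 < g by rewrite /g -addrA -opprD subr_gt0.
pose L := - (ln (X0 0 k) + ln (Y0 0 k)).
have L0 : 0 <= L by rewrite oppr_ge0 -[leRHS](addr0 0) lerD ?lnle.
(* The barrier takes away at most half of the gap at the given points. *)
pose kap := Num.min 1 (g / (2 * (L + 1))).
have L1 : 0 < 2 * (L + 1) by rewrite mulr_gt0 // ltr_wpDl.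
have kap0 : 0 < kap by rewrite lt_min ltr01 divr_gt0.
have kap1 : kap <= 1 by rewrite ge_min lexx.
pose Psi := coupled v k C M kap.
have Psi0 : 0 < Psi X0 Y0.
  rewrite /Psi /coupled -/g -[_ + ln _]opprK -/L mulrN subr_gt0.
  have : kap * (2 * (L + 1)) <= g by rewrite -ler_pdivlMr // ge_min lexx orbT.
  have := mulr_ge0 (ltW kap0) L0; lra.
(* Below the height [del] the barrier alone outweighs the oscillation of [v]. *)
pose del := expR (- (Ku + 1) / kap).
have pos X Y : D X -> D Y -> 0 < Psi X Y -> del < X 0 k /\ del < Y 0 k.
  move=> DX DY; rewrite /Psi /coupled.
  have := v_osc DX DY; have := lnle X DX; have := lnle Y DY.
  have := mulr_ge0 C0 (sqrtr_ge0 (enorm (X - Y))).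
  have := mulr_ge0 M0 (addr_ge0 (dotv_ge0 X) (dotv_ge0 Y)).
  move=> a1 a2 a3 a4 a5 a6.
  have a3' := ler_wpM2l (ltW kap0) a3; have a4' := ler_wpM2l (ltW kap0) a4.
  split; rewrite -ltr_ln ?posrE ?expR_gt0 //; [|by case: DX| |by case: DY];
    by rewrite expRK ltr_pdivrMr // mulrC; move: a3' a4' a6; rewrite !mulr0; lra.
pose KK := [set X : 'rV[R]_n | del <= X 0 k /\ enorm X <= rho].
have del0 : 0 < del by exact: expR_gt0.
have KD X : KK X -> D X by move=> [Xd Xr]; split => //; exact: lt_le_trans Xd.
have cK : compact KK.
  apply: bounded_closed_compact.
    exists rho; split; first exact: num_real.
    by move=> x rx X [_ Xr]; apply: ltW; apply: le_lt_trans rx; apply: le_trans (norm_le_enorm _) Xr.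
  apply: closedI.
    apply: (@preimage_closed _ _ (fun X : 'rV[R]_n => X 0 k) [set y | del <= y]).
      by move=> X _; exact: coord_continuous.
    exact: closed_ge.
  apply: (@preimage_closed _ _ (@enorm R n) [set y | y <= rho]).
      by move=> X _; exact: enorm_continuous.
  exact: closed_le.
have [d1 d2] := pos _ _ DX0 DY0 Psi0.
have KK0 : (KK `*` KK) (X0, Y0).
  exact: (conj (conj (ltW d1) (proj2 DX0)) (conj (ltW d2) (proj2 DY0))).
have [|||[X Y]] := @compact_EVT_max _ R (fun Z => Psi Z.1 Z.2) (KK `*` KK).
- by exists (X0, Y0).
- exact: compact_setX.
- apply: continuous_in_subspaceT => -[X Y]; rewrite inE => -[/KD DX /KD DY].
  exact: coupled_cont.
rewrite inE => -[/= KX KY] mx.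
have DX := KD _ KX; have DY := KD _ KY.
have PXY : 0 < Psi X Y.
  by apply: lt_le_trans Psi0 _; apply: (mx (X0, Y0)); rewrite inE.
have [Xd Yd] := pos _ _ DX DY PXY.
have bnd Z Z' : D Z -> D Z' -> 0 < Psi Z Z' -> M * (dotv Z Z + dotv Z' Z') < Ku.
  move=> DZ DZ'; rewrite /Psi /coupled.
  have := v_osc DZ DZ'; have := lnle Z DZ; have := lnle Z' DZ'.
  have := mulr_ge0 C0 (sqrtr_ge0 (enorm (Z - Z'))).
  move=> a1 a2 a3 a4.
  have a3' := ler_wpM2l (ltW kap0) a3; have a2' := ler_wpM2l (ltW kap0) a2.
  by move: a3' a2'; rewrite !mulr0; lra.
(* On the sphere of radius [rho] the term in [M] outweighs the oscillation. *)
have Xr : enorm X < rho.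
  rewrite ltNge; apply/negP => rX; have := bnd _ _ DX DY PXY.
  rewrite ltNge => /negP; apply; apply: le_trans MK _; rewrite ler_wpM2l //.
  rewrite ler_wpDr ?dotv_ge0 // -enorm_sqr lerXn2r ?nnegrE ?enorm_ge0 ?(ltW rho0) //.
have Yr : enorm Y < rho.
  rewrite ltNge; apply/negP => rY; have := bnd _ _ DX DY PXY.
  rewrite ltNge => /negP; apply; apply: le_trans MK _; rewrite ler_wpM2l //.
  rewrite ler_wpDl ?dotv_ge0 // -enorm_sqr lerXn2r ?nnegrE ?enorm_ge0 ?(ltW rho0) //.
(* On the diagonal [coupled] is not positive. *)
have XY : 0 < enorm (X - Y).
  rewrite lt_def enorm_ge0 andbT; apply/eqP => /enorm_eq0/subr0_eq XYE.
  move: PXY; rewrite /Psi /coupled XYE !subrr enorm0 sqrtr0 mulr0 !sub0r ?subr0 ?sub0r.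
  have := mulr_ge0 M0 (addr_ge0 (dotv_ge0 Y) (dotv_ge0 Y)).
  have := lnle Y DY; move=> a1 a2.
  by have := ler_wpM2l (ltW kap0) a1; rewrite mulr0; lra.
have [pX [SX [jX eX]]] := v_sol DX; have [pY [SY [jY eY]]] := v_sol DY.
have [[Xk _] [Yk _]] := (DX, DY).
pose d0 := Num.min (Num.min (X 0 k - del) (Y 0 k - del)) (Num.min (rho - enorm X) (rho - enorm Y)).
have d00 : 0 < d0 by rewrite !lt_min !subr_gt0 Xd Yd Xr Yr.
have near_in (Z Z' : 'rV[R]_n) : enorm (Z' - Z) < Z 0 k - del -> enorm (Z' - Z) < rho - enorm Z -> KK Z'.
  move=> c1 c2; split.
    have := coord_le_enorm (Z' - Z) k; rewrite !mxE ler_norml => /andP[+ _]; lra.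
  by have := enormD (Z' - Z) Z; rewrite subrK; lra.
have Pmax X' Y' : enorm (X' - X) < d0 -> enorm (Y' - Y) < d0 -> Psi X' Y' <= Psi X Y.
  rewrite /d0 !lt_min => /andP[/andP[h1 _] /andP[h2 _]] /andP[/andP[_ h3] /andP[_ h4]].
  by apply: (mx (X', Y')); rewrite inE; split; [exact: near_in h1 h2|exact: near_in h3 h4].
pose Th := C / (2 * enorm (X - Y) * Num.sqrt (enorm (X - Y))).
have w0 : 0 < Num.sqrt (enorm (X - Y)) by rewrite sqrtr_gt0.
have := no_coupled_max M0 kap0 kap1 _ DX DY XY
  (max_gradX C0 d00 Xk Yk XY jX jY Pmax) (max_gradY C0 d00 Xk Yk XY jX jY Pmax)
  (max_hessX C0 d00 Xk Yk XY jX jY Pmax) (max_hessY C0 d00 Xk Yk XY jX jY Pmax)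
  (max_hessB C0 d00 Xk Yk XY jX jY Pmax) (max_hess_line C0 d00 Xk Yk XY jX jY Pmax) eX eY.
rewrite -/Th => /(_ (divr_ge0 C0 (ltW (mulr_gt0 (mulr_gt0 (ltr0Sn _ 1) XY) w0)))) H.
have r2 : enorm (X - Y) <= 2.
  apply: le_trans (enormD _ _) _; rewrite enormN; move: Xr Yr rho1; lra.
have w2 : Num.sqrt (enorm (X - Y)) <= 2.
  rewrite -(ler_pXn2r (ltn0Sn 1)) ?nnegrE ?sqrtr_ge0 // sqr_sqrtr ?enorm_ge0 //.
  apply: le_trans r2 _; rewrite expr2; lra.
have : C / 8 <= Th.
  rewrite /Th ler_wpM2l // lef_pV2 ?posrE ?mulr_gt0 //.
  rewrite (_ : 8 = 2 * 2 * 2); last by ring.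
  by rewrite ler_pM // ?mulr_ge0 ?enorm_ge0 // ler_wpM2l.
move=> /(ler_wpM2l (ltW lam0)) H2.
move: CM; rewrite -(ltr_pM2l (_ : 0 < 8^-1)) ?invr_gt0 // mulKf ?pnatr_eq0 //.
move: H H2; set Z := 2 * Kf + _ + _; lra.
Qed.

End HalfBall.

(** * Flattening the boundary *)

Lemma is_derive_bigsum {R : realType} n (f : 'I_n -> R -> R) (t : R) (d : 'I_n -> R) :
  (forall i, is_derive t 1 (f i) (d i)) ->
  is_derive t 1 (fun s => \sum_i f i s) (\sum_i d i).
Proof.
move=> D; have := @is_derive_sum _ _ _ n f t 1 _ D.
rewrite (_ : \sum_(i < n) _ = (fun s => \sum_i f i s)) //.
by apply/funext => s; rewrite fct_sumE.
Qed.

(** In the ball of radius [r] about the boundary point [p] the domain lies above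
    the graph of [Gam], a function that does not depend on the [k]-th
    coordinate; [sg] is the sign of the upward direction. *)
Record flat_chart {R : realType} {n : nat} (Om : set 'rV[R]_n) (p : 'rV[R]_n)
    (k : 'I_n) (sg r rho Kc : R) (Gam : 'rV[R]_n -> R) : Prop := FlatChart {
  fc_sg : sg * sg = 1;
  fc_K : 1 <= Kc;
  fc_rho0 : 0 < rho;
  fc_rho1 : rho <= 1;
  fc_rho_r : (2 * n%:R + 1) * Kc * rho < r;
  fc_C2 : C2_on setT Gam;
  fc_indep : forall X t, Gam (X + t *: delta_mx 0 k) = Gam X;
  fc_0 : Gam 0 = 0;
  fc_d1 : forall X i, enorm X < r -> `|pd i Gam X| <= Kc;
  fc_d2 : forall X i j, enorm X < r -> `|pd j (pd i Gam) X| <= Kc;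
  fc_Om : forall y, enorm y < r -> (Om (p + y) <-> Gam y < sg * y 0 k) }.

Section Flattening.
Context {R : realType} {n : nat}.
Variables (Om : set 'rV[R]_n) (p : 'rV[R]_n) (k : 'I_n) (sg r rho Kc : R).
Variable Gam : 'rV[R]_n -> R.
Implicit Types (X Y Z z y : 'rV[R]_n).

Local Notation e_ := (fun i => delta_mx 0 i : 'rV[R]_n).

Hypothesis FC : flat_chart Om p k sg r rho Kc Gam.

Let sg2 := fc_sg FC.
Let Kc1 := fc_K FC.
Let rho0 := fc_rho0 FC.
Let rho1 := fc_rho1 FC.
Let rho_r := fc_rho_r FC.
Let Gam_C2 := fc_C2 FC.
Let Gam_k := fc_indep FC.
Let Gam_0 := fc_0 FC.
Let Gam_1 := fc_d1 FC.
Let Om_chart := fc_Om FC.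

Definition half_ball X : Prop := 0 < X 0 k /\ enorm X < rho.

(** The part of the domain above the graph of [Gam] is straightened, and the
    height [t] above the graph is replaced by its square root. *)
Definition flat X : 'rV[R]_n :=
  p + \row_i (if i == k then sg * (Gam X + X 0 k ^+ 2) else X 0 i).

Definition dflat X z : 'rV[R]_n :=
  \row_i (if i == k then sg * (\sum_j pd j Gam X * z 0 j + 2 * X 0 k * z 0 k)
          else z 0 i).

Definition ddflat X z : 'rV[R]_n :=
  \row_i (if i == k then sg * (\sum_i \sum_j pd j (pd i Gam) X * z 0 j * z 0 i
            + 2 * z 0 k ^+ 2) else 0).

(** Normal to the graph, pointing into the domain, and scaled so that its
    [k]-th component has modulus one. *)
Definition Nor X : 'rV[R]_n := \row_i ((i == k)%:R * sg - pd i Gam X).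

(** [setk X s] is the point at [s] on the normal line through [X]. *)
Definition setk X (s : R) := X + (s - X 0 k) *: delta_mx 0 k : 'rV[R]_n.

Lemma setk_k X s : setk X s 0 k = s.
Proof. by rewrite !mxE !eqxx mulr1 addrC subrK. Qed.

Lemma setk_neq X s i : i != k -> setk X s 0 i = X 0 i.
Proof. by move=> ik; rewrite !mxE eqxx (negbTE ik) mulr0 addr0. Qed.

Lemma setk_id X : setk X (X 0 k) = X.
Proof. by rewrite /setk subrr scale0r addr0. Qed.

Lemma enorm_setk X s : `|s| <= `|X 0 k| -> enorm (setk X s) <= enorm X.
Proof.
move=> sX; rewrite -(ler_pXn2r (ltn0Sn 1)) ?nnegrE ?enorm_ge0 // !enorm_sqr.
rewrite /dotv (bigD1 k) //= [leRHS](bigD1 k) //= setk_k lerD //.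
  by rewrite -!expr2 -(real_normK (num_real s)) -(real_normK (num_real (X 0 k))) lerXn2r ?nnegrE.
by apply: ler_sum => i ik; rewrite setk_neq.
Qed.

Lemma half_ball_setk X s : half_ball X -> 0 < s <= X 0 k -> half_ball (setk X s).
Proof.
move=> [X0 Xr] /andP[s0 sX]; split; first by rewrite setk_k.
by apply: le_lt_trans Xr; apply: enorm_setk; rewrite !gtr0_norm.
Qed.

Lemma rho_le_r : rho < r.
Proof.
apply: le_lt_trans rho_r; rewrite -[leLHS]mul1r ler_wpM2r ?(ltW rho0) //.
rewrite -[leLHS]mulr1 ler_pM // lerDr mulr_ge0 //.
Qed.

Lemma half_ball_r X : half_ball X -> enorm X < r.
Proof. by move=> [_]; move/lt_trans; apply; exact: rho_le_r. Qed.

Let pd_shift (f : 'rV[R]_n -> R) (w : 'rV[R]_n) : (forall X, f (X + w) = f X) ->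
  forall i X, pd i f (X + w) = pd i f X.
Proof.
move=> fw i X; rewrite /pd /derive.
have -> : (fun h : R => h^-1 *: (f (h *: delta_mx 0 i + (X + w)) - f (X + w))) =
          (fun h : R => h^-1 *: (f (h *: delta_mx 0 i + X) - f X)).
  by apply/funext => h; rewrite addrA !fw.
by [].
Qed.

Let pdk0 (f : 'rV[R]_n -> R) : (forall X t, f (X + t *: delta_mx 0 k) = f X) ->
  forall X, pd k f X = 0.
Proof.
move=> fk X; rewrite /pd /derive.
have -> : (fun h : R => h^-1 *: (f (h *: delta_mx 0 k + X) - f X)) = cst 0.
  by apply/funext => h; rewrite (addrC (h *: _)) fk subrr scaler0.
exact: lim_cst.
Qed.

Lemma dGam_k i X t : pd i Gam (X + t *: delta_mx 0 k) = pd i Gam X.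
Proof. by apply: pd_shift => Y; exact: Gam_k. Qed.

Lemma ddGam_k i j X t : pd j (pd i Gam) (X + t *: delta_mx 0 k) = pd j (pd i Gam) X.
Proof. by apply: pd_shift => Y; exact: dGam_k. Qed.

Lemma dkGam X : pd k Gam X = 0.
Proof. by apply: pdk0; exact: Gam_k. Qed.

Lemma dkdGam i X : pd k (pd i Gam) X = 0.
Proof. by apply: pdk0; exact: dGam_k. Qed.

Lemma ddkGam j X : pd j (pd k Gam) X = 0.
Proof.
rewrite (_ : pd k Gam = cst 0); last by apply/funext => Y; exact: dkGam.
by rewrite /pd derive_cst.
Qed.

Lemma Nor_setk X s : Nor (setk X s) = Nor X.
Proof. by apply/rowP => i; rewrite !mxE dGam_k. Qed.

Lemma Nor_k X : Nor X 0 k = sg.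
Proof. by rewrite mxE eqxx mul1r dkGam subr0. Qed.

Lemma sg_norm : `|sg| = 1.
Proof.
apply/eqP; rewrite -(eqrXn2 (ltn0Sn 1)) ?normr_ge0 // expr1n real_normK ?num_real //.
by rewrite expr2 sg2.
Qed.

Lemma is_derive_coord (X z : 'rV[R]_n) i (t : R) :
  is_derive t 1 (fun s : R => (X + s *: z) 0 i) (z 0 i).
Proof.
have -> : (fun s : R => (X + s *: z) 0 i) = (fun s => X 0 i + z 0 i * s).
  by apply/funext => s; rewrite !mxE mulrC.
by apply: is_derive_eq; rewrite /GRing.scale /=; ring.
Qed.

Lemma line_chain (f : 'rV[R]_n -> R) (X z : 'rV[R]_n) (t : R) : C1_on setT f ->
  is_derive t 1 (fun s : R => f (X + s *: z)) (\sum_j pd j f (X + t *: z) * z 0 j).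
Proof.
move=> f1.
exact: (@C1_chain R n setT f (fun s => X + s *: z) (fun=> z) t openT f1 I
  (fun i => is_derive_coord X z i t)).
Qed.

Lemma flat_line X z (t : R) i :
  is_derive t 1 (fun s : R => flat (X + s *: z) 0 i) (dflat (X + t *: z) z 0 i).
Proof.
rewrite mxE; case: (eqVneq i k) => [->|ik].
  have -> : (fun s : R => flat (X + s *: z) 0 k) =
      (fun s => p 0 k + sg * (Gam (X + s *: z) + (X + s *: z) 0 k ^+ 2)).
    by apply/funext => s; rewrite /flat mxE [X in _ + X = _]mxE eqxx.
  have D1 := line_chain X z t Gam_C2.1; have D2 := is_derive_coord X z k t.
  by apply: is_derive_eq; rewrite /GRing.scale /=; ring.
have -> : (fun s : R => flat (X + s *: z) 0 i) = (fun s => p 0 i + (X + s *: z) 0 i).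
  by apply/funext => s; rewrite /flat mxE [X in _ + X = _]mxE (negbTE ik).
have D2 := is_derive_coord X z i t.
by apply: is_derive_eq; ring.
Qed.

Lemma dflat_line X z i :
  is_derive (0 : R) 1 (fun s : R => dflat (X + s *: z) z 0 i) (ddflat X z 0 i).
Proof.
rewrite mxE; case: (eqVneq i k) => [->|ik].
  have -> : (fun s : R => dflat (X + s *: z) z 0 k) =
      (fun s => sg * (\sum_j pd j Gam (X + s *: z) * z 0 j + 2 * (X + s *: z) 0 k * z 0 k)).
    by apply/funext => s; rewrite /dflat mxE eqxx.
  have D1 j : is_derive (0 : R) 1 (fun s : R => pd j Gam (X + s *: z) * z 0 j)
      ((\sum_i pd i (pd j Gam) X * z 0 i) * z 0 j).
    have := line_chain X z 0 (Gam_C2.2 j); rewrite scale0r addr0 => D.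
    by apply: is_derive_eq; rewrite /GRing.scale /=; ring.
  have D2 := is_derive_coord X z k 0.
  have D3 : is_derive (0 : R) 1 (fun s : R => \sum_j pd j Gam (X + s *: z) * z 0 j)
     (\sum_j (\sum_i pd i (pd j Gam) X * z 0 i) * z 0 j).
    exact: is_derive_bigsum D1.
  apply: is_derive_eq; rewrite /GRing.scale /=.
  under [in RHS]eq_bigr do rewrite -mulr_suml.
  by ring.
have -> : (fun s : R => dflat (X + s *: z) z 0 i) = cst (z 0 i).
  by apply/funext => s; rewrite /dflat mxE (negbTE ik).
exact: is_derive_cst.
Qed.

Lemma Gam_le X : enorm X < r -> `|Gam X| <= n%:R * Kc * enorm X.
Proof.
move=> Xr.
have ball t : 0 <= t <= 1 -> enorm (0 + t *: X) < r.
  move=> /andP[t0 t1]; rewrite add0r enormZ ger0_norm //.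
  by apply: le_lt_trans Xr; rewrite -[leRHS]mul1r ler_wpM2r ?enorm_ge0.
have := @mvt_bound R _ _ 0 1 (n%:R * Kc * enorm X) ler01
  (fun t _ => line_chain 0 X t Gam_C2.1) _.
rewrite scale1r scale0r !addr0 add0r Gam_0 !subr0 mulr1; apply => t tb.
apply: le_trans (ler_norm_sum _ _ _) _.
apply: (@le_trans _ _ (\sum_(j < n) Kc * enorm X)).
  by apply: ler_sum => j _; rewrite normrM ler_pM ?Gam_1 ?coord_le_enorm // ball.
by rewrite sumr_const card_ord -[X in X <= _]mulr_natl mulrA.
Qed.

Lemma flat_sub_p X : flat X - p = \row_i (if i == k then sg * (Gam X + X 0 k ^+ 2) else X 0 i).
Proof. by rewrite /flat addrC addKr. Qed.

Lemma flat_in_ball X : 0 <= X 0 k -> enorm X < rho -> enorm (flat X - p) < r.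
Proof.
move=> X0 Xrho; apply: le_lt_trans rho_r.
have Xr : enorm X < r by apply: lt_trans Xrho rho_le_r.
apply: le_trans (enorm_le_sum _) _.
have Kc0 : 0 <= Kc by apply: le_trans Kc1.
have xi (i : 'I_n) : `|X 0 i| <= rho by apply: le_trans (coord_le_enorm _ _) (ltW Xrho).
apply: (@le_trans _ _ (\sum_(i < n) (rho + (i == k)%:R * (n%:R * Kc * rho + rho)))).
  apply: ler_sum => i _; rewrite flat_sub_p mxE; case: (eqVneq i k) => [E|_]; last first.
    by rewrite mul0r addr0.
  rewrite mul1r normrM sg_norm mul1r; apply: le_trans (ler_normD _ _) _.
  rewrite addrC ler_wpDl ?(ltW rho0) //.
  rewrite addrC; apply: lerD.
    apply: le_trans (Gam_le Xr) _; rewrite ler_wpM2l ?mulr_ge0 //; exact: ltW.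
  rewrite normrX expr2 -[leRHS]mul1r ler_pM //.
  exact: le_trans (xi k) rho1.
rewrite big_split /= sumr_const card_ord (bigD1 k) //= eqxx mul1r big1 ?addr0; last first.
  by move=> i ik; rewrite (negbTE ik) mul0r.
rewrite -[X in X + _]mulr_natl.
have n0 : 0 <= n%:R :> R by [].
have h1 : n%:R * rho <= n%:R * Kc * rho.
  by rewrite ler_wpM2r ?(ltW rho0) // -[leLHS]mulr1 ler_wpM2l.
have h2 : rho <= Kc * rho by rewrite -[leLHS]mul1r ler_wpM2r ?(ltW rho0).
lra.
Qed.

Lemma Gam_flat X : Gam (flat X - p) = Gam X.
Proof.
rewrite flat_sub_p -[RHS](Gam_k X (sg * (Gam X + X 0 k ^+ 2) - X 0 k)); congr Gam.
apply/rowP => i; rewrite !mxE eqxx /=; case: eqP => [->|_].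
  rewrite mulr1; ring.
by rewrite mulr0n mulr0 addr0.
Qed.

Lemma flat_Om X : half_ball X -> Om (flat X).
Proof.
move=> [X0 Xr]; rewrite -(subrK p (flat X)) addrC.
apply/Om_chart; first by apply: flat_in_ball => //; exact: ltW.
by rewrite Gam_flat flat_sub_p mxE eqxx mulrA sg2 mul1r ltrDl exprn_gt0.
Qed.

Lemma flat_notin X : X 0 k = 0 -> enorm X < rho -> ~ Om (flat X).
Proof.
move=> X0 Xr; rewrite -(subrK p (flat X)) addrC.
move/Om_chart; rewrite flat_in_ball ?X0 // => /(_ isT).
by rewrite Gam_flat flat_sub_p mxE eqxx mulrA sg2 mul1r X0 expr0n addr0 ltxx.
Qed.

Lemma flat_continuous : continuous flat.
Proof.
move=> X; apply/(@cvgrPdist_le _ _ _ (nbhs X)) => eps eps0.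
have H i : \forall Y \near X, `|flat X 0 i - flat Y 0 i| <= eps.
  rewrite /flat; case: (eqVneq i k) => [->|ik].
    have cG : {for X, continuous Gam} by have [[+ _] _] := Gam_C2; exact.
    have ck : {for X, continuous (fun Y : 'rV[R]_n => Y 0 k)} by exact: coord_continuous.
    have : {for X, continuous (fun Y : 'rV[R]_n => sg * (Gam Y + Y 0 k * Y 0 k))}.
      exact: (cvgM (cvg_cst sg) (cvgD cG (cvgM ck ck))).
    move=> /cvgrPdist_le /(_ _ eps0); apply: filterS => Y.
    by rewrite !mxE eqxx opprD addrACA subrr add0r !expr2.
  have : {for X, continuous (fun Y : 'rV[R]_n => Y 0 i)} by exact: coord_continuous.
  move=> /cvgrPdist_le /(_ _ eps0).
  by apply: filterS => Y; rewrite !mxE (negbTE ik) opprD addrACA subrr add0r.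
have := filter_forall (nbhs_filter X) H; apply: filterS => Y HY.
by apply: norm_le_coord => [|i]; [exact: ltW|rewrite !mxE; have := HY i; rewrite !mxE].
Qed.

Lemma setk_continuous X : continuous (setk X).
Proof.
move=> s; have H : (s' - X 0 k) @[s' --> s] --> s - X 0 k.
  exact: (cvgB cvg_id (cvg_cst _)).
exact: (cvgD (cvg_cst X) (cvgZr_tmp (a := delta_mx 0 k) H)).
Qed.

(** The flat boundary is approached from inside along the normal line, and its
    image is not in the domain. *)
Lemma flat_bdry X : half_ball X -> bdry Om (flat (setk X 0)).
Proof.
move=> HX; have [X0 Xr] := HX; split; last first.
  apply: flat_notin; first by rewrite setk_k.
  by apply: le_lt_trans Xr; apply: enorm_setk; rewrite normr0.
move=> B HB.
have c : flat (setk X s) @[s --> (0 : R)] --> flat (setk X 0).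
  exact: (cvg_comp _ _ (@setk_continuous X 0) (@flat_continuous (setk X 0))).
have [d /= d0 dB] := (nbhs_normP _ _).1 (c B HB).
pose s := Num.min (d / 2) (X 0 k).
have s0 : 0 < s by rewrite lt_min X0 divr_gt0.
exists (flat (setk X s)); split.
  by apply: flat_Om; apply: half_ball_setk; rewrite // s0 ge_min lexx orbT.
apply: dB; rewrite /ball_ /= sub0r normrN gtr0_norm //.
by rewrite (@le_lt_trans _ _ (d / 2)) // ?ge_min ?lexx //; lra.
Qed.

End Flattening.

(** * Lipschitz classes in the flat coordinates *)

(** Functions bounded on [D] whose increments between related points are
    controlled by a weight [dl]; the same constant serves both purposes, so
    that these classes are stable under sums and products. *)
Section WeightedLipschitz.
Context {R : realType} {n : nat}.
Variables (D : 'rV[R]_n -> Prop) (pr : 'rV[R]_n -> 'rV[R]_n -> Prop).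
Variable (dl : 'rV[R]_n -> 'rV[R]_n -> R).
Implicit Types (f g : 'rV[R]_n -> R) (c : R).

Definition wlip c f : Prop := [/\ 0 <= c, forall X, D X -> `|f X| <= c &
  forall X Y, D X -> D Y -> pr X Y -> `|f X - f Y| <= c * dl X Y].

Hypothesis dl0 : forall X Y, D X -> D Y -> pr X Y -> 0 <= dl X Y.

Lemma wlip_le c c' f : c <= c' -> wlip c f -> wlip c' f.
Proof.
move=> cc [c0 b l]; split; first exact: le_trans cc.
- by move=> X DX; apply: le_trans (b X DX) cc.
- move=> X Y DX DY p; apply: le_trans (l X Y DX DY p) _.
  by rewrite ler_wpM2r // dl0.
Qed.

Lemma wlipD c c' f g : wlip c f -> wlip c' g -> wlip (c + c') (fun X => f X + g X).
Proof.
move=> [c0 b l] [c'0 b' l']; split; first exact: addr_ge0.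
- by move=> X DX; apply: le_trans (ler_normD _ _) _; rewrite lerD ?b ?b'.
- move=> X Y DX DY p; rewrite opprD addrACA.
  by apply: le_trans (ler_normD _ _) _; rewrite mulrDl lerD ?l ?l'.
Qed.

Lemma wlipN c f : wlip c f -> wlip c (fun X => - f X).
Proof.
move=> [c0 b l]; split => //; first by move=> X DX; rewrite normrN b.
by move=> X Y DX DY p; rewrite -opprD normrN l.
Qed.

Lemma wlipB c c' f g : wlip c f -> wlip c' g -> wlip (c + c') (fun X => f X - g X).
Proof. by move=> fc /wlipN gc; apply: wlipD. Qed.

Lemma wlipM c c' f g : wlip c f -> wlip c' g ->
  wlip (2 * c * c') (fun X => f X * g X).
Proof.
move=> [c0 b l] [c'0 b' l']; split; first by rewrite !mulr_ge0.
- move=> X DX; rewrite normrM; apply: (@le_trans _ _ (c * c')).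
    by rewrite ler_pM ?b ?b'.
  by have := mulr_ge0 c0 c'0; lra.
- move=> X Y DX DY p; rewrite (_ : _ - _ = (f X - f Y) * g X + f Y * (g X - g Y)); last by ring.
  apply: le_trans (ler_normD _ _) _; rewrite !normrM.
  have h1 : `|f X - f Y| * `|g X| <= c * dl X Y * c' by rewrite ler_pM ?l ?b'.
  have h2 : `|f Y| * `|g X - g Y| <= c * (c' * dl X Y) by rewrite ler_pM ?l' ?b.
  lra.
Qed.

Lemma wlipZ c k f : `|k| <= 1 -> wlip c f -> wlip c (fun X => k * f X).
Proof.
move=> k1 [c0 b l]; split => //.
  by move=> X DX; rewrite normrM -[leRHS]mul1r ler_pM ?b.
move=> X Y DX DY p; rewrite -mulrBr normrM -[leRHS]mul1r ler_pM ?l //.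
Qed.

Lemma wlip_sum c (f : 'I_n -> 'rV[R]_n -> R) : (forall i, wlip c (f i)) ->
  0 <= c -> wlip (n%:R * c) (fun X => \sum_i f i X).
Proof.
move=> fc c0; split; first by rewrite mulr_ge0.
  move=> X DX; apply: le_trans (ler_norm_sum _ _ _) _.
  apply: (@le_trans _ _ (\sum_(i < n) c)).
    by apply: ler_sum => i _; have [_ b _] := fc i; exact: b.
  by rewrite sumr_const card_ord -[X in X <= _]mulr_natl.
move=> X Y DX DY p; rewrite -sumrB; apply: le_trans (ler_norm_sum _ _ _) _.
apply: (@le_trans _ _ (\sum_(i < n) c * dl X Y)).
  by apply: ler_sum => i _; have [_ _ l] := fc i; exact: l.
by rewrite sumr_const card_ord -[X in X <= _]mulr_natl mulrA.
Qed.

End WeightedLipschitz.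

Section Coefficients.
Context {R : realType} {n : nat}.
Variables (Om : set 'rV[R]_n) (p : 'rV[R]_n) (k : 'I_n) (sg r rho Kc : R).
Variable Gam : 'rV[R]_n -> R.
Hypothesis FC : flat_chart Om p k sg r rho Kc Gam.
Hypothesis oOm : open Om.
Implicit Types (X Y Z z y : 'rV[R]_n).

Let D := half_ball k rho.
Let T := flat p k sg Gam.
Let N := Nor k sg Gam.

(** Along normal lines increments are compared with those of the height, the
    square of the flat coordinate [s]. A bound on derivatives in the original
    coordinates gives this directly, and the operator in flat coordinates, whose
    coefficients are divided by [s] and [s ^+ 2], requires it. *)
Definition vert X Y := exists2 s : R, 0 < s <= X 0 k & Y = setk k X s.
Definition vlip := wlip D vert (fun X Y => X 0 k ^+ 2 - Y 0 k ^+ 2).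
Definition hlip := wlip D (fun _ _ => True) (fun X Y => enorm (X - Y)).

Lemma vert_ge0 X Y : D X -> D Y -> vert X Y -> 0 <= X 0 k ^+ 2 - Y 0 k ^+ 2.
Proof.
move=> [X0 _] _ [s /andP[s0 sX] ->]; rewrite setk_k subr_ge0.
by rewrite lerXn2r ?nnegrE ?(ltW s0) ?(ltW X0).
Qed.

Lemma vlip_lim c f l X : vlip c f -> D X ->
  f (setk k X s) @[s --> 0^'+] --> l -> `|f X - l| <= c * X 0 k ^+ 2.
Proof.
move=> [c0 _ fl] DX fX; apply/ler_addgt0Pr => e e0.
have [X0 _] := DX.
have H : \forall s \near 0^'+, `|f (setk k X s) - l| <= e /\ 0 < s <= X 0 k.
  near=> s; split.
    by near: s; move/cvgrPdist_le : fX => /(_ _ e0); apply: filterS => s; rewrite distrC.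
  apply/andP; split; [near: s; exact: nbhs_right_gt|near: s; exact: nbhs_right_le].
have [s [se sX]] := filter_ex (FF := at_right_proper_filter (0 : R)) H.
rewrite -(subrK (f (setk k X s)) (f X)) -addrA.
apply: le_trans (ler_normD _ _) _; rewrite lerD //.
apply: le_trans (fl _ _ DX (half_ball_setk DX sX) _) _; first by exists s.
by rewrite ler_wpM2l // setk_k lerBlDr lerDl sqr_ge0.
Unshelve. all: by end_near.
Qed.

Lemma half_ball_open X : D X -> forall z, \forall t \near (0 : R), D (X + t *: z).
Proof.
move=> [X0 Xr] z; near=> t.
have tz : enorm (t *: z) < Num.min (X 0 k) (rho - enorm X).
  rewrite enormZ; apply: (@le_lt_trans _ _ (`|t| * (1 + enorm z))).
    by rewrite ler_wpM2l // lerDr.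
  rewrite -ltr_pdivlMr; last by rewrite ltr_pwDl ?enorm_ge0.
  near: t; apply: (@nbhs0_lt R R).
  by rewrite divr_gt0 ?lt_min ?X0 ?subr_gt0 // ltr_pwDl ?enorm_ge0.
move: tz; rewrite lt_min => /andP[t1 t2]; split.
  have := coord_le_enorm (t *: z) k; rewrite ler_norml => /andP[+ _].
  by rewrite [in X in _ -> X]mxE; lra.
by have := enormD X (t *: z); lra.
Unshelve. all: by end_near.
Qed.

Lemma half_ball_convex X Y (t : R) : D X -> D Y -> 0 <= t <= 1 -> D (X + t *: (Y - X)).
Proof.
move=> [X0 Xr] [Y0 Yr] /andP[t0 t1].
have -> : X + t *: (Y - X) = (1 - t) *: X + t *: Y.
  by rewrite scalerBr scalerBl scale1r addrA addrAC.
have [->|tp] := eqVneq t 0; first by rewrite subr0 scale1r scale0r addr0.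
have {}tp : 0 < t by rewrite lt_def tp.
have t1' : 0 <= 1 - t by rewrite subr_ge0.
split.
  by rewrite !mxE ltr_wpDl ?mulr_gt0 // mulr_ge0 // ltW.
apply: le_lt_trans (enormD _ _) _; rewrite !enormZ !ger0_norm //.
apply: (@lt_le_trans _ _ ((1 - t) * rho + t * rho)); last by rewrite -mulrDl subrK mul1r.
by rewrite ler_ltD // ?ltr_pM2l // ler_wpM2l // ltW.
Qed.

Lemma Kc_ge0 : 0 <= Kc.
Proof. by apply: le_trans (fc_K FC). Qed.

Let k_lt1 X : D X -> 0 <= X 0 k <= 1.
Proof.
move=> [X0 Xr]; rewrite ltW //=; apply: le_trans (ler_norm _) _.
by apply: le_trans (coord_le_enorm _ _) (le_trans (ltW Xr) (fc_rho1 FC)).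
Qed.

Lemma dflat_le X z i : D X -> `|dflat k sg Gam X z 0 i| <= (3 + n%:R * Kc) * enorm z.
Proof.
move=> DX; have K0 := Kc_ge0; have zc := coord_le_enorm z.
have nK : 0 <= n%:R * Kc * enorm z by rewrite !mulr_ge0 ?enorm_ge0.
have z0 := enorm_ge0 z.
rewrite mxE; case: eqP => [_|_]; last by apply: le_trans (zc i) _; lra.
rewrite normrM (sg_norm FC) mul1r; apply: le_trans (ler_normD _ _) _.
have h1 : `|\sum_j pd j Gam X * z 0 j| <= n%:R * Kc * enorm z.
  apply: le_trans (ler_norm_sum _ _ _) _.
  apply: (@le_trans _ _ (\sum_(j < n) Kc * enorm z)).
    apply: ler_sum => j _; rewrite normrM ler_pM //.
    exact: (fc_d1 FC) (half_ball_r FC DX).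
  by rewrite sumr_const card_ord -[X in X <= _]mulr_natl mulrA.
have h2 : `|2 * X 0 k * z 0 k| <= 2 * enorm z.
  rewrite normrM ler_pM // normrM ger0_norm // -[leRHS]mulr1 ler_wpM2l //.
  by have /andP[a b] := k_lt1 DX; rewrite ger0_norm.
lra.
Qed.

(** A common bound for the coefficients, the graph and their derivatives in the
    flat coordinates. *)
Definition c_basic : R := n.+1%:R * Kc * (3 + n%:R * Kc).

Let nK0 : 0 <= n%:R * Kc. Proof. by rewrite mulr_ge0 // Kc_ge0. Qed.

Lemma c_basic_ge : [/\ 0 <= c_basic, 2 * Kc <= c_basic, 1 + Kc <= c_basic, n%:R * Kc <= c_basic &
  n%:R * (Kc * (3 + n%:R * Kc)) <= c_basic].
Proof.
have K0 := Kc_ge0; have K1 := fc_K FC; have nKK : 0 <= n%:R * Kc * (n%:R * Kc) by rewrite mulr_ge0.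
have nKK' : 0 <= Kc * (n%:R * Kc) by rewrite mulr_ge0.
have KK := nK0; rewrite /c_basic -[n.+1%:R]natr1; split; lra.
Qed.

Lemma flat_hlip f : C1_on Om f -> (forall y, Om y -> `|f y| <= Kc) ->
  (forall i y, Om y -> `|pd i f y| <= Kc) -> hlip c_basic (fun X => f (T X)).
Proof.
move=> f1 fb fdb; have [c0 c2 _ _ cc] := c_basic_ge; have K0 := Kc_ge0.
split => //.
  move=> X DX; apply: le_trans (fb _ (flat_Om FC DX)) _; move: c2 K0; lra.
move=> X Y DX DY _; rewrite distrC.
have D' (t : R) : 0 <= t <= 1 -> is_derive t 1 (fun s : R => f (T (X + s *: (Y - X))))
    (\sum_i pd i f (T (X + t *: (Y - X))) * dflat k sg Gam (X + t *: (Y - X)) (Y - X) 0 i).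
  move=> t01; apply: (C1_chain oOm f1 (c := fun s => T (X + s *: (Y - X)))
    (dc := fun t => dflat k sg Gam (X + t *: (Y - X)) (Y - X))).
    by apply: (flat_Om FC); exact: half_ball_convex.
  by move=> i; exact: (flat_line FC).
have := mvt_bound ler01 D' (B := c_basic * enorm (X - Y)) _.
rewrite scale1r (addrC X (Y - X)) subrK scale0r addr0 subr0 mulr1; apply => t t01.
have DXt := half_ball_convex DX DY t01.
apply: le_trans (ler_norm_sum _ _ _) _.
apply: (@le_trans _ _ (\sum_(i < n) Kc * ((3 + n%:R * Kc) * enorm (X - Y)))).
  apply: ler_sum => i _; rewrite normrM ler_pM //; first exact: (fdb _ _ (flat_Om FC DXt)).
  by rewrite -(enormN (X - Y)) opprB; exact: dflat_le.
rewrite sumr_const card_ord -[X in X <= _]mulr_natl !mulrA ler_wpM2r ?enorm_ge0 //.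
by rewrite -mulrA.
Qed.

Lemma dflat_ek X i : dflat k sg Gam X (delta_mx 0 k) 0 i =
  (i == k)%:R * (2 * sg * X 0 k).
Proof.
rewrite mxE sum_delta (dkGam FC) !mxE !eqxx /=; case: eqP => _.
  by rewrite mulr1n; ring.
by rewrite mulr0n mul0r.
Qed.

Lemma flat_deriv_k f X (t : R) : C1_on Om f -> D (X + t *: delta_mx 0 k) ->
  is_derive t 1 (fun s : R => f (T (X + s *: delta_mx 0 k)))
    (2 * sg * (X 0 k + t) * pd k f (T (X + t *: delta_mx 0 k))).
Proof.
move=> f1 DX; have := C1_chain oOm f1 (c := fun s => T (X + s *: delta_mx 0 k))
    (dc := fun t => dflat k sg Gam (X + t *: delta_mx 0 k) (delta_mx 0 k)) (flat_Om FC DX)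
    (fun i => @flat_line _ _ _ p _ _ _ _ _ _ FC X (delta_mx 0 k) t i).
rewrite (bigD1 k) //= big1 => [|i ik]; last by rewrite dflat_ek (negbTE ik) mul0r mulr0.
rewrite dflat_ek eqxx mul1r addr0 => H; apply: is_derive_eq H _.
by rewrite !mxE !eqxx /= mulr1; ring.
Qed.

(** The normal derivative of [flat] is [2 * s] times a constant vector, which is
    the derivative of the height [s ^+ 2]. *)
Lemma flat_vlip_gen f c : 0 <= c -> C1_on Om f -> (forall y, Om y -> `|f y| <= c) ->
  (forall y, Om y -> `|pd k f y| <= c) -> vlip (2 * c) (fun X => f (T X)).
Proof.
move=> c0 f1 fb fdb; split; first exact: mulr_ge0.
  move=> X DX; apply: le_trans (fb _ (flat_Om FC DX)) _; lra.
move=> X _ DX _ [s /andP[s0 sX] ->]; rewrite setk_k.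
have [X0 Xr] := DX.
have D' (t : R) : s <= t <= X 0 k -> is_derive t 1 (fun t : R => f (T (setk k X t)))
    (2 * sg * t * pd k f (T (setk k X t))).
  move=> /andP[t1 t2]; have DXt : D (setk k X t).
    by apply: half_ball_setk => //; rewrite t2 (lt_le_trans s0).
  pose Y := setk k X 0.
  have YE u : setk k X u = Y + u *: delta_mx 0 k.
    by apply/rowP => i; rewrite !mxE eqxx /=; case: eqP => [->|_]; rewrite ?mulr1n ?mulr0n; ring.
  rewrite (_ : (fun t => _) = (fun t => f (T (Y + t *: delta_mx 0 k)))); last first.
    by apply/funext => u; rewrite YE.
  rewrite YE; have := @flat_deriv_k f Y t f1; rewrite -YE => /(_ DXt).
  by rewrite /Y setk_k add0r.
have [t /andP[t1 t2] E] := mvt_eq sX D'.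
rewrite setk_id in E; rewrite E.
have DXt : D (setk k X t).
  by apply: half_ball_setk => //; rewrite t2 (lt_le_trans s0).
have t0 : 0 < t := lt_le_trans s0 t1.
rewrite normrM (ger0_norm (_ : 0 <= X 0 k - s)) ?subr_ge0 //.
rewrite !normrM (sg_norm FC) mulr1 (ger0_norm (ltW t0)) (ger0_norm (ler0n _ 2)).
rewrite subr_sqr (mulrC (X 0 k - s)) mulrA ler_wpM2r ?subr_ge0 //.
have h2 : t <= X 0 k + s by rewrite (le_trans t2) // lerDl ltW.
have := ler_pM (ltW t0) (normr_ge0 _) h2 (fdb _ (flat_Om FC DXt)).
by rewrite -/T; lra.
Qed.

Lemma flat_vlip f : C1_on Om f -> (forall y, Om y -> `|f y| <= Kc) ->
  (forall y, Om y -> `|pd k f y| <= Kc) -> vlip c_basic (fun X => f (T X)).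
Proof.
move=> f1 fb fdb; have [_ c2 _ _ _] := c_basic_ge.
have V := flat_vlip_gen Kc_ge0 f1 fb fdb.
by apply: (wlip_le _ c2 V) => X Y; exact: vert_ge0.
Qed.

Lemma Nor_hlip i : hlip c_basic (fun X => N X 0 i).
Proof.
have [c0 c2 c1 cn _] := c_basic_ge; have K0 := Kc_ge0.
have Dr X : D X -> enorm X < r by exact: (half_ball_r FC).
split => //.
  move=> X DX; apply: le_trans c1; rewrite mxE; apply: le_trans (ler_normB _ _) _.
  rewrite lerD ?(fc_d1 FC) ?Dr // normrM (sg_norm FC) mulr1.
  by case: eqP => _; rewrite ?normr1 ?normr0.
move=> X Y DX DY _; rewrite !mxE (_ : _ - _ = pd i Gam Y - pd i Gam X); last by ring.
have D' (t : R) : 0 <= t <= 1 -> is_derive t 1 (fun s : R => pd i Gam (X + s *: (Y - X)))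
    (\sum_j pd j (pd i Gam) (X + t *: (Y - X)) * (Y - X) 0 j).
  by move=> t01; apply: line_chain; have [_] := fc_C2 FC; exact.
have := mvt_bound ler01 D' (B := c_basic * enorm (X - Y)) _.
rewrite scale1r (addrC X (Y - X)) subrK scale0r addr0 subr0 mulr1 distrC; apply => t t01.
have DXt := half_ball_convex DX DY t01.
apply: le_trans (ler_norm_sum _ _ _) _.
apply: (@le_trans _ _ (\sum_(j < n) Kc * enorm (X - Y))).
  apply: ler_sum => j _; rewrite normrM ler_pM //.
    by apply: (fc_d2 FC); exact: Dr.
  by rewrite -(enormN (X - Y)) opprB coord_le_enorm.
by rewrite sumr_const card_ord -[X in X <= _]mulr_natl mulrA ler_wpM2r ?enorm_ge0.
Qed.

Lemma Nor_vlip i : vlip c_basic (fun X => N X 0 i).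
Proof.
have [c0 b _] := Nor_hlip i; split => // X _ DX _ [s sX ->].
rewrite /N (Nor_setk FC) subrr normr0 mulr_ge0 //.
by apply: vert_ge0 => //; [exact: half_ball_setk sX|exists s].
Qed.

Lemma dGam_vlip i : vlip c_basic (fun X => pd i Gam X).
Proof.
have [c0 c2 _ _ _] := c_basic_ge; have K0 := Kc_ge0.
split => //.
  move=> X DX; apply: le_trans (fc_d1 FC _ (half_ball_r FC DX)) _; lra.
move=> X _ DX _ [s sX ->]; rewrite (dGam_k FC) subrr normr0 mulr_ge0 //.
by apply: vert_ge0 => //; [exact: half_ball_setk sX|exists s].
Qed.

Lemma ddGam_vlip i j : vlip c_basic (fun X => pd j (pd i Gam) X).
Proof.
have [c0 c2 _ _ _] := c_basic_ge; have K0 := Kc_ge0.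
split => //.
  move=> X DX; apply: le_trans (fc_d2 FC _ _ (half_ball_r FC DX)) _; lra.
move=> X _ DX _ [s sX ->]; rewrite (ddGam_k FC) subrr normr0 mulr_ge0 //.
by apply: vert_ge0 => //; [exact: half_ball_setk sX|exists s].
Qed.

(** A function tending to zero at the flat boundary whose tangential
    derivative is Lipschitz in the normal direction has a tangential derivative
    tending to zero as well: otherwise the latter would keep a sign on a
    segment and along the normal lines issued from it. *)
Lemma tangential_deriv_small (G dG : 'rV[R]_n -> R) (z : 'rV[R]_n) c X :
  (forall X, D X -> is_derive (0 : R) 1 (fun t : R => G (X + t *: z)) (dG X)) ->
  z 0 k = 0 -> vlip c dG ->
  (forall X, D X -> dG (X + t *: z) @[t --> (0 : R)] --> dG X) ->
  (forall X, D X -> G (setk k X s) @[s --> 0^'+] --> (0 : R)) ->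
  D X -> `|dG X| <= c * X 0 k ^+ 2.
Proof.
move=> Gd zk [c0 _ dGl] dGc Gv DX; rewrite leNgt; apply/negP => big.
pose sgn := Num.sg (dG X).
have sgE : sgn * dG X = `|dG X| by rewrite /sgn normrEsg.
pose eta := (`|dG X| - c * X 0 k ^+ 2) / 2.
have eta0 : 0 < eta by rewrite divr_gt0 // subr_gt0.
have sgn1 : `|sgn| <= 1 by rewrite /sgn normr_sg; case: eqP.
have [X0 Xr] := DX.
have : \forall t \near (0 : R), D (X + t *: z) /\ `|dG X - dG (X + t *: z)| <= eta.
  near=> t; split; near: t; first exact: half_ball_open.
  by have /cvgrPdist_le /(_ _ eta0) := dGc X DX.
move=> /nbhs_normP[d /= d0 dH].
pose tau := d / 2.
have tau0 : 0 < tau by rewrite divr_gt0.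
have Ht t : 0 <= t <= tau -> D (X + t *: z) /\ `|dG X - dG (X + t *: z)| <= eta.
  move=> /andP[t0 t1]; apply: dH; rewrite /ball_ /= sub0r normrN ger0_norm //.
  by apply: le_lt_trans t1 _; rewrite /tau; lra.
have tk t : (X + t *: z) 0 k = X 0 k by rewrite !mxE zk mulr0 addr0.
have sk t s : setk k (X + t *: z) s = setk k X s + t *: z.
  by rewrite /setk tk addrAC.
have low t s : 0 <= t <= tau -> 0 < s <= X 0 k -> eta <= sgn * dG (setk k X s + t *: z).
  move=> tt ss; have [DXt dGt] := Ht t tt.
  have sst : 0 < s <= (X + t *: z) 0 k by rewrite tk.
  have := dGl _ _ DXt (half_ball_setk DXt sst) (ex_intro2 _ _ s sst erefl).
  rewrite setk_k sk tk => h1.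
  have h2 : `|sgn * (dG X - dG (setk k X s + t *: z))| <= eta + c * X 0 k ^+ 2.
    rewrite normrM -[leRHS]mul1r ler_pM //.
    rewrite -(subrKA (dG (X + t *: z))); apply: le_trans (ler_normD _ _) _.
    rewrite lerD //; apply: le_trans h1 _; rewrite ler_wpM2l //.
    by rewrite lerBlDr lerDl sqr_ge0.
  have := le_trans (ler_norm _) h2; rewrite mulrBr sgE /eta; lra.
have key s : 0 < s <= X 0 k -> eta * tau <=
    sgn * (G (setk k (X + tau *: z) s) - G (setk k X s)).
  move=> ss.
  have [||t tt E] := @mvt_eq R (fun t => G (setk k X s + t *: z))
     (fun t => dG (setk k X s + t *: z)) 0 tau.
  - exact: ltW.
  - move=> t tt; have [DXt _] := Ht t tt.
    have sst : 0 < s <= (X + t *: z) 0 k by rewrite tk.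
    have := Gd _ (half_ball_setk DXt sst); rewrite sk => H.
    have H2 : is_derive (t : R) 1 (fun u : R => u - t) 1.
      by apply: is_derive_eq; rewrite subr0.
    have H' : is_derive (t - t) 1 (fun u : R => G (setk k X s + t *: z + u *: z))
       (dG (setk k X s + t *: z)) by rewrite subrr.
    have := @is_derive1_comp R _ _ t _ _ H' H2.
    rewrite mulr1 (_ : _ \o _ = (fun t0 => G (setk k X s + t0 *: z))) //.
    by apply/funext => u /=; rewrite -addrA -scalerDl (addrCA t) subrr addr0.
  move: E; rewrite scale0r addr0 subr0 -sk => ->.
  by have := ler_wpM2r (ltW tau0) (low t s tt ss); rewrite -mulrA.
have DXt := (Ht tau _).1.
have cc : sgn * (G (setk k (X + tau *: z) s) - G (setk k X s)) @[s --> 0^'+] --> sgn * (0 - 0).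
  apply: (cvgM (cvg_cst sgn)); apply: cvgB; last exact: Gv.
  by apply: Gv; apply: DXt; rewrite lexx ltW.
have : eta * tau <= sgn * (0 - 0).
  apply: (@cvgr_to_ge _ _ (at_right_proper_filter (0 : R)) _ _ _ _ cc).
  near=> s; apply: key; apply/andP; split; [near: s; exact: nbhs_right_gt|near: s; exact: nbhs_right_le].
by rewrite subrr mulr0 leNgt mulr_gt0.
Unshelve. all: by end_near.
Qed.

End Coefficients.

(** * Normal components of the coefficients *)

Section OperatorCoefficients.
Context {R : realType} {n : nat}.
Variables (Om : set 'rV[R]_n) (p : 'rV[R]_n) (k : 'I_n) (sg r rho Kc : R).
Variable Gam : 'rV[R]_n -> R.
Hypothesis FC : flat_chart Om p k sg r rho Kc Gam.
Hypothesis oOm : open Om.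
Variables (a : 'rV[R]_n -> 'M[R]_n) (b : 'rV[R]_n -> 'rV[R]_n).
Implicit Types (X Y Z z y : 'rV[R]_n).

Let D := half_ball k rho.
Let T := flat p k sg Gam.
Let N := Nor k sg Gam.
Let cb := @c_basic R n Kc.

Hypothesis a_C2 : forall i j, C2_on Om (fun x => a x i j).
Hypothesis b_C1 : forall i, C1_on Om (fun x => b x 0 i).
Hypothesis a_le : forall i j y, Om y -> `|a y i j| <= Kc.
Hypothesis da_le : forall l i j y, Om y -> `|pd l (fun x => a x i j) y| <= Kc.
Hypothesis dda_le : forall m l i j y, Om y -> `|pd m (pd l (fun x => a x i j)) y| <= Kc.
Hypothesis b_le : forall i y, Om y -> `|b y 0 i| <= Kc.
Hypothesis db_le : forall l i y, Om y -> `|pd l (fun x => b x 0 i) y| <= Kc.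

Definition aT i j X : R := a (T X) i j.
Definition daT l i j X : R := pd l (fun x => a x i j) (T X).
Definition bT i X : R := b (T X) 0 i.
(** Both vanish at the boundary because the boundary is characteristic. *)
Definition conor j X : R := \sum_i aT i j X * N X 0 i.
Definition ann X : R := \sum_j conor j X * N X 0 j.
(** [dann] is the derivative of [ann] in the height, and [bN - divN] the normal
    component of the drift of the operator in divergence form. *)
Definition dann X : R := sg * (\sum_i \sum_j daT k i j X * N X 0 i * N X 0 j).
Definition divN X : R := \sum_i \sum_j daT j i j X * N X 0 i.
Definition bN X : R := \sum_i bT i X * N X 0 i.
Definition aHess X : R := \sum_i \sum_j aT i j X * pd j (pd i Gam) X.
(** What distinguishes the contribution [- aHess] of the graph to the normal
    drift from the expression [dann - divN] in first derivatives of [a]. *)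
Definition defect X : R := divN X - dann X - aHess X.
(** The derivative of [conor j] along the tangential coordinate [l]. *)
Definition dconor l j X : R := \sum_i ((daT l i j X + sg * pd l Gam X * daT k i j X) * N X 0 i
  - aT i j X * pd l (pd i Gam) X).

Definition c_conor : R := n%:R * (2 * cb * cb).
Definition c_dann : R := n%:R * (n%:R * (2 * (2 * cb * cb) * cb)).
Definition c_divN : R := n%:R * (n%:R * (2 * cb * cb)).
Definition c_dconor : R := n%:R * (2 * (cb + 2 * cb * cb) * cb + 2 * cb * cb).

Let cb0 : 0 <= cb. Proof. by have [] := c_basic_ge FC. Qed.

Let m0 (x y : R) : 0 <= x -> 0 <= y -> 0 <= x * y. Proof. exact: mulr_ge0. Qed.
Let two0 : 0 <= 2 :> R. Proof. by []. Qed.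
Let n0 : 0 <= n%:R :> R. Proof. by []. Qed.
Let cc0 : 0 <= 2 * cb * cb. Proof. exact: m0 (m0 two0 cb0) cb0. Qed.
Let ccc0 : 0 <= 2 * (2 * cb * cb) * cb. Proof. exact: m0 (m0 two0 cc0) cb0. Qed.
Let dc0 : 0 <= 2 * (cb + 2 * cb * cb) * cb + 2 * cb * cb.
Proof. exact: addr_ge0 (m0 (m0 two0 (addr_ge0 cb0 cc0)) cb0) cc0. Qed.

Section Classes.
Variables (pr : 'rV[R]_n -> 'rV[R]_n -> Prop) (dl : 'rV[R]_n -> 'rV[R]_n -> R).
Let L := wlip D pr dl.
Hypothesis La : forall i j, L cb (aT i j).
Hypothesis Lda : forall l i j, L cb (daT l i j).
Hypothesis Lb : forall i, L cb (bT i).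
Hypothesis LN : forall i, L cb (fun X => N X 0 i).
Let sg1 : `|sg| <= 1. Proof. by rewrite (sg_norm FC). Qed.

Lemma wlip_conor j : L c_conor (conor j).
Proof.
apply: wlip_sum => [i|]; last exact: cc0.
by apply: wlipM; [exact: La|exact: LN].
Qed.

Lemma wlip_dann : L c_dann dann.
Proof.
apply: wlipZ; first exact: sg1.
apply: wlip_sum => [i|]; last exact: m0 n0 ccc0.
apply: wlip_sum => [j|]; last exact: ccc0.
by apply: wlipM; [apply: wlipM; [exact: Lda|exact: LN]|exact: LN].
Qed.

Lemma wlip_divN : L c_divN divN.
Proof.
apply: wlip_sum => [i|]; last exact: m0 n0 cc0.
apply: wlip_sum => [j|]; last exact: cc0.
by apply: wlipM; [exact: Lda|exact: LN].
Qed.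

Lemma wlip_bN : L c_conor bN.
Proof.
apply: wlip_sum => [i|]; last exact: cc0.
by apply: wlipM; [exact: Lb|exact: LN].
Qed.

Hypothesis LG : forall i, L cb (fun X => pd i Gam X).
Hypothesis LGG : forall i j, L cb (fun X => pd j (pd i Gam) X).

Lemma wlip_dconor l j : L c_dconor (dconor l j).
Proof.
apply: wlip_sum => [i|]; last exact: dc0.
apply: wlipB; last by apply: wlipM; [exact: La|exact: LGG].
apply: wlipM; last exact: LN.
apply: wlipD; first exact: Lda.
by apply: wlipM; [apply: wlipZ; [exact: sg1|exact: LG]|exact: Lda].
Qed.

End Classes.

Lemma aT_hlip i j : hlip k rho cb (aT i j).
Proof. exact: (flat_hlip FC oOm (a_C2 i j).1 (a_le i j) (fun l => da_le l i j)). Qed.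

Lemma aT_vlip i j : vlip k rho cb (aT i j).
Proof. exact: (flat_vlip FC oOm (a_C2 i j).1 (a_le i j) (da_le k i j)). Qed.

Lemma daT_hlip l i j : hlip k rho cb (daT l i j).
Proof. exact: (flat_hlip FC oOm ((a_C2 i j).2 l) (da_le l i j) (fun m => dda_le m l i j)). Qed.

Lemma daT_vlip l i j : vlip k rho cb (daT l i j).
Proof. exact: (flat_vlip FC oOm ((a_C2 i j).2 l) (da_le l i j) (dda_le k l i j)). Qed.

Lemma bT_hlip i : hlip k rho cb (bT i).
Proof. exact: (flat_hlip FC oOm (b_C1 i) (b_le i) (fun l => db_le l i)). Qed.

Lemma bT_vlip i : vlip k rho cb (bT i).
Proof. exact: (flat_vlip FC oOm (b_C1 i) (b_le i) (db_le k i)). Qed.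

Lemma conor_vlip j : vlip k rho c_conor (conor j).
Proof. by apply: wlip_conor => *; [exact: aT_vlip|exact: (Nor_vlip FC)]. Qed.

Lemma dann_hlip : hlip k rho c_dann dann.
Proof. by apply: wlip_dann => *; [exact: daT_hlip|exact: (Nor_hlip FC)]. Qed.

Lemma dann_vlip : vlip k rho c_dann dann.
Proof. by apply: wlip_dann => *; [exact: daT_vlip|exact: (Nor_vlip FC)]. Qed.

Lemma divN_hlip : hlip k rho c_divN divN.
Proof. by apply: wlip_divN => *; [exact: daT_hlip|exact: (Nor_hlip FC)]. Qed.

Lemma divN_vlip : vlip k rho c_divN divN.
Proof. by apply: wlip_divN => *; [exact: daT_vlip|exact: (Nor_vlip FC)]. Qed.

Lemma bN_hlip : hlip k rho c_conor bN.
Proof. by apply: wlip_bN => *; [exact: bT_hlip|exact: (Nor_hlip FC)]. Qed.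

Lemma bN_vlip : vlip k rho c_conor bN.
Proof. by apply: wlip_bN => *; [exact: bT_vlip|exact: (Nor_vlip FC)]. Qed.

Lemma dconor_vlip l j : vlip k rho c_dconor (dconor l j).
Proof.
apply: wlip_dconor => *; [exact: aT_vlip|exact: daT_vlip|exact: (Nor_vlip FC)
  |exact: (dGam_vlip FC)|exact: (ddGam_vlip FC)].
Qed.

Lemma dflat_el X l i : l != k -> dflat k sg Gam X (delta_mx 0 l) 0 i =
  if i == k then sg * pd l Gam X else (i == l)%:R.
Proof.
move=> lk; rewrite !mxE eqxx /=; case: eqP => [_|//].
by rewrite sum_delta eq_sym (negbTE lk) mulr0 addr0.
Qed.

Lemma sum_dflat_el (F : 'I_n -> R) X l : l != k ->
  \sum_i F i * dflat k sg Gam X (delta_mx 0 l) 0 i = F l + sg * pd l Gam X * F k.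
Proof.
move=> lk; rewrite (bigD1 k) //= (bigD1 l) //= big1 => [|i /andP[ik il]].
  by rewrite !dflat_el // !eqxx (negbTE lk) mulr1 addr0 addrC mulrC.
by rewrite dflat_el // (negbTE ik) (negbTE il) mulr0.
Qed.

Lemma flat_deriv_el f X l : l != k -> C1_on Om f -> D X ->
  is_derive (0 : R) 1 (fun s : R => f (T (X + s *: delta_mx 0 l)))
    (pd l f (T X) + sg * pd l Gam X * pd k f (T X)).
Proof.
move=> lk f1 DX.
have H : is_derive (0 : R) 1 (fun s : R => f (T (X + s *: delta_mx 0 l)))
    (\sum_i pd i f (T X) * dflat k sg Gam X (delta_mx 0 l) 0 i).
  have := C1_chain oOm f1 (c := fun s => T (X + s *: delta_mx 0 l)) (t := 0)
    (dc := fun t => dflat k sg Gam (X + t *: delta_mx 0 l) (delta_mx 0 l)).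
  rewrite scale0r addr0; apply; first exact: (flat_Om FC DX).
  move=> i; have := @flat_line _ _ _ p _ _ _ _ _ _ FC X (delta_mx 0 l) 0 i.
  by rewrite scale0r addr0.
by apply: (is_derive_eq H); rewrite sum_dflat_el.
Qed.

Lemma conor_deriv l j X : l != k -> D X ->
  is_derive (0 : R) 1 (fun t : R => conor j (X + t *: delta_mx 0 l)) (dconor l j X).
Proof.
move=> lk DX; apply: is_derive_bigsum => i.
have D1 := flat_deriv_el lk (proj1 (a_C2 i j)) DX.
have D2 : is_derive (0 : R) 1 (fun t : R => N (X + t *: delta_mx 0 l) 0 i) (- pd l (pd i Gam) X).
  rewrite (_ : (fun t => _) = fun t => (i == k)%:R * sg - pd i Gam (X + t *: delta_mx 0 l)); last first.
    by apply/funext => t; rewrite mxE.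
  have := line_chain X (delta_mx 0 l) 0 ((fc_C2 FC).2 i).
  rewrite scale0r addr0 sum_delta => D3; apply: is_derive_eq; ring.
rewrite /aT; apply: is_derive_eq; rewrite !scale0r !addr0.
by rewrite /GRing.scale /= /daT -/T -/N; ring.
Qed.

Lemma line_cvg X z : X + t *: z @[t --> (0 : R)] --> X.
Proof.
have H : X + t *: z @[t --> (0 : R)] --> X + 0 *: z.
  exact: (cvgD (cvg_cst X) (cvgZr_tmp (a := z) (@cvg_id _ (nbhs (0 : R))))).
by move: H; rewrite scale0r addr0.
Qed.

Lemma dconor_line l j X z : D X -> dconor l j (X + t *: z) @[t --> (0 : R)] --> dconor l j X.
Proof.
move=> DX.
have cl := @line_cvg X z.
have cT : T (X + t *: z) @[t --> (0 : R)] --> T X := cvg_comp _ _ cl (@flat_continuous _ _ _ p _ _ _ _ _ _ FC X).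
have OT : Om (T X) := flat_Om FC DX.
have cG i : pd i Gam (X + t *: z) @[t --> (0 : R)] --> pd i Gam X.
  exact: (cvg_comp _ _ cl (((fc_C2 FC).2 i).1 X I)).
have cGG i m : pd m (pd i Gam) (X + t *: z) @[t --> (0 : R)] --> pd m (pd i Gam) X.
  exact: (cvg_comp _ _ cl (((fc_C2 FC).2 i).2 m X I).2).
have cN i : N (X + t *: z) 0 i @[t --> (0 : R)] --> N X 0 i.
  rewrite (_ : (fun t => _) = fun t => (i == k)%:R * sg - pd i Gam (X + t *: z)); last first.
    by apply/funext => t; rewrite mxE.
  by rewrite mxE; exact: (cvgB (cvg_cst _) (cG i)).
have ca i : aT i j (X + t *: z) @[t --> (0 : R)] --> aT i j X.
  exact: (cvg_comp _ _ cT ((a_C2 i j).1.1 _ OT)).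
have cda m i : daT m i j (X + t *: z) @[t --> (0 : R)] --> daT m i j X.
  exact: (cvg_comp _ _ cT ((a_C2 i j).1.2 m _ OT).2).
apply: cvg_sum => i.
exact: (cvgB (cvgM (cvgD (cda l i) (cvgM (cvgM (cvg_cst sg) (cG l)) (cda k i))) (cN i))
  (cvgM (ca i) (cGG i l))).
Qed.

(** The tangential divergence of the conormal vector contains the derivatives of
    [a] in [divN - dann] and those of the normal in [aHess]. *)
Lemma sum_dconor X : D X -> \sum_(l | l != k) dconor l l X = defect X.
Proof.
move=> DX; have OT := flat_Om FC DX.
have pull (F : 'I_n -> R) : \sum_(l | l != k) F l = \sum_l F l - F k.
  by rewrite [in RHS](bigD1 k) //= addrC addrK.
rewrite pull /defect /divN /dann /aHess /dconor.
rewrite exchange_big /= mulr_sumr -!sumrB; apply: eq_bigr => i _.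
rewrite mulr_sumr -!sumrB /=.
rewrite (_ : \sum_j (_ - _ - _) = \sum_j (daT j i j X * N X 0 i - sg * (daT k i j X * N X 0 i * N X 0 j) -
   aT i j X * pd j (pd i Gam) X)) //.
transitivity (\sum_j (((daT j i j X + sg * pd j Gam X * daT k i j X) * N X 0 i
    - aT i j X * pd j (pd i Gam) X) - (j == k)%:R * (daT k i k X * N X 0 i))).
  rewrite [RHS]sumrB; congr (_ - _).
  rewrite [RHS](bigD1 k) //= eqxx mul1r big1 ?addr0; last first.
    by move=> j jk; rewrite (negbTE jk) mul0r.
  by rewrite (dkGam FC) (dkdGam FC) !mulr0 mul0r addr0 subr0.
apply: eq_bigr => j _; rewrite [N X 0 j]mxE.
have ss := fc_sg FC; case: eqP => [->|_]; last by rewrite mulr0n !mul0r; ring.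
rewrite mulr1n !mul1r (dkGam FC) (dkdGam FC) subr0.
rewrite (_ : sg * (_ * sg) = daT k i k X * N X 0 i * (sg * sg)); last by ring.
by rewrite ss; ring.
Qed.

Hypothesis conor_lim : forall X j, D X -> conor j (setk k X s) @[s --> 0^'+] --> (0 : R).

(** The conormal is Lipschitz in the height and tends to zero. *)
Lemma conor_small X j : D X -> `|conor j X| <= c_conor * X 0 k ^+ 2.
Proof. by move=> DX; have := vlip_lim (conor_vlip j) DX (conor_lim j DX); rewrite subr0. Qed.

Lemma dconor_small X l j : D X -> l != k -> `|dconor l j X| <= c_dconor * X 0 k ^+ 2.
Proof.
move=> DX lk; apply: (tangential_deriv_small (G := conor j) (z := delta_mx 0 l) _ _ (dconor_vlip l j) _ _ DX).
- by move=> Y DY; exact: conor_deriv.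
- by rewrite mxE eqxx /= eq_sym (negbTE lk).
- by move=> Y DY; exact: dconor_line.
- by move=> Y DY; exact: conor_lim.
Qed.

(** The conormal vanishes at the boundary, hence so do its tangential
    derivatives; this removes the curvature of the boundary from the drift. *)
Lemma defect_small X : D X -> `|defect X| <= n%:R * c_dconor * X 0 k ^+ 2.
Proof.
move=> DX; rewrite -sum_dconor //; apply: le_trans (ler_norm_sum _ _ _) _.
have c0 : 0 <= c_dconor * X 0 k ^+ 2.
  by apply: mulr_ge0; [exact: m0 n0 dc0|exact: sqr_ge0].
apply: (@le_trans _ _ (\sum_(l < n) c_dconor * X 0 k ^+ 2)).
  rewrite [leRHS](bigD1 k) //= ler_wpDl //.
  by apply: ler_sum => l lk; exact: dconor_small.
by rewrite sumr_const card_ord -[X in X <= _]mulr_natl mulrA.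
Qed.

Lemma setk_affine X s : setk k X s = setk k X 0 + s *: delta_mx 0 k.
Proof.
apply/rowP => i; have -> : (setk k X 0 + s *: delta_mx 0 k) 0 i = setk k X 0 0 i + s * (i == k)%:R.
  by rewrite mxE; congr (_ + _); rewrite !mxE eqxx.
case: (eqVneq i k) => [->|ik]; first by rewrite !setk_k mulr1 add0r.
by rewrite !setk_neq // mulr0 addr0.
Qed.

Lemma ann_deriv X (t : R) : D X -> 0 < t <= X 0 k ->
  is_derive t 1 (fun t : R => ann (setk k X t)) (2 * t * dann (setk k X t)).
Proof.
move=> DX tX; have DXt : D (setk k X t) by exact: half_ball_setk.
have E : (fun t : R => ann (setk k X t)) =
   (fun t => \sum_j \sum_i (N X 0 i * N X 0 j) * aT i j (setk k X 0 + t *: delta_mx 0 k)).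
  apply/funext => u; apply: eq_bigr => j _; rewrite mulr_suml; apply: eq_bigr => i _.
  by rewrite /N (Nor_setk FC) -setk_affine; ring.
rewrite E.
have Da i j : is_derive t 1 (fun t : R => (N X 0 i * N X 0 j) * aT i j (setk k X 0 + t *: delta_mx 0 k))
   ((N X 0 i * N X 0 j) * (2 * sg * t * daT k i j (setk k X t))).
  have := @flat_deriv_k _ _ _ p _ _ _ _ _ _ FC oOm (fun x => a x i j) (setk k X 0) t (a_C2 i j).1.
  rewrite -setk_affine => /(_ DXt); rewrite setk_k add0r => H.
  have := @is_deriveZ R R R _ (N X 0 i * N X 0 j) t 1 _ H.
  by rewrite /GRing.scale /=.
have := is_derive_bigsum (fun j => is_derive_bigsum (fun i => Da i j)).
move=> H; apply: (is_derive_eq H).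
rewrite /dann mulrCA mulrA mulr_sumr exchange_big /=; apply: eq_bigr => i _.
rewrite mulr_sumr; apply: eq_bigr => j _.
by rewrite /N !(Nor_setk FC); ring.
Qed.

Lemma ann_lim X : D X -> ann (setk k X s) @[s --> 0^'+] --> (0 : R).
Proof.
move=> DX; have H : (\sum_j conor j (setk k X s) * N X 0 j) @[s --> 0^'+] --> \sum_(j < n) 0 * N X 0 j.
  by apply: cvg_sum => j; exact: (cvgM (conor_lim j DX) (cvg_cst _)).
move: H; rewrite big1 => [H|j _]; last by rewrite mul0r.
rewrite (_ : (fun s => _) = fun s => \sum_j conor j (setk k X s) * N X 0 j) //.
by apply/funext => s; apply: eq_bigr => j _; rewrite /N (Nor_setk FC).
Qed.

(** The derivative of [ann] along the normal line is [2 * s * dann], and [dann]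
    is Lipschitz in the height. *)
Lemma ann_small X : D X -> `|ann X - X 0 k ^+ 2 * dann X| <= 2 * c_dann * X 0 k ^+ 4.
Proof.
move=> DX; have [X0 Xr] := DX; have [c0 _ dl] := dann_vlip.
pose F s := ann (setk k X s) - s ^+ 2 * dann X.
have FX : F (X 0 k) = ann X - X 0 k ^+ 2 * dann X by rewrite /F setk_id.
rewrite -FX.
have Fd t : 0 < t <= X 0 k -> is_derive (t : R) 1 F (2 * t * (dann (setk k X t) - dann X)).
  move=> tX; have Dt := ann_deriv DX tX.
  by apply: is_derive_eq; rewrite /GRing.scale /=; ring.
have step s : 0 < s <= X 0 k -> `|F (X 0 k) - F s| <= 2 * c_dann * X 0 k ^+ 4.
  move=> /andP[s0 sX].
  have Fd' t : s <= t <= X 0 k -> is_derive (t : R) 1 F (2 * t * (dann (setk k X t) - dann X)).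
    by move=> /andP[st tX]; apply: Fd; rewrite tX (lt_le_trans s0 st).
  apply: le_trans (@mvt_bound R F _ s (X 0 k) (2 * X 0 k * (c_dann * X 0 k ^+ 2)) sX Fd' _) _.
    move=> t /andP[st tX]; have t0 := lt_le_trans s0 st.
    have tX' : 0 < t <= X 0 k by rewrite t0.
    rewrite !normrM (ger0_norm (ltW t0)) (ger0_norm (ler0n _ 2)) ler_pM ?mulr_ge0 ?(ltW t0) //.
      by rewrite ler_pM2l.
    rewrite distrC; apply: le_trans (dl _ _ DX (half_ball_setk DX tX') (ex_intro2 _ _ t tX' erefl)) _.
    by rewrite ler_wpM2l // setk_k lerBlDr lerDl sqr_ge0.
  rewrite (_ : 2 * c_dann * X 0 k ^+ 4 = 2 * X 0 k * (c_dann * X 0 k ^+ 2) * X 0 k); last by ring.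
  have b0 : 0 <= 2 * X 0 k * (c_dann * X 0 k ^+ 2).
    by apply: mulr_ge0; [exact: m0 two0 (ltW X0)|exact: m0 c0 (sqr_ge0 _)].
  by rewrite ler_wpM2l // lerBlDr lerDl ltW.
have Fl : F s @[s --> 0^'+] --> 0 - 0 * 0 * dann X.
  have c1 : s @[s --> (0 : R)^'+] --> (0 : R) by apply: cvg_at_right_filter; exact: cvg_id.
  rewrite /F; under eq_fun do rewrite expr2.
  exact: (cvgB (ann_lim DX) (cvgM (cvgM c1 c1) (cvg_cst _))).
have H2 : `|F (X 0 k) - F s| @[s --> 0^'+] --> `|F (X 0 k) - (0 - 0 * 0 * dann X)|.
  exact: (cvg_norm (cvgB (cvg_cst _) Fl)).
have := @cvgr_to_le _ _ (at_right_proper_filter (0 : R)) _ _ _ (2 * c_dann * X 0 k ^+ 4) H2.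
rewrite mul0r mul0r !subr0; apply.
near=> s; apply: step; apply/andP; split; [near: s; exact: nbhs_right_gt|near: s; exact: nbhs_right_le].
Unshelve. all: by end_near.
Qed.

End OperatorCoefficients.

(** * The operator in the flat coordinates *)

Section MatrixForms.
Context {R : realType} {n : nat}.
Implicit Types (x y : 'rV[R]_n) (P S M : 'M[R]_n).

Lemma dotv_mx x y : dotv x y = (x *m y^T) 0 0.
Proof. by rewrite mxE; apply: eq_bigr => i _; rewrite mxE. Qed.

Lemma qf_mx P x : qf P x = (x *m P *m x^T) 0 0.
Proof.
rewrite qfE -mulmxA mxE; apply: eq_bigr => i _; congr (_ * _).
by rewrite mxE; apply: eq_bigr => j _; rewrite mxE.
Qed.

Lemma frob_tr P S : frob P S = \tr (P *m S^T).
Proof. by apply: eq_bigr => i _; rewrite mxE; apply: eq_bigr => j _; rewrite mxE. Qed.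

Lemma qf_conj M P x : qf (M^T *m P *m M) x = qf P (x *m M^T).
Proof. by rewrite !qf_mx trmx_mul trmxK !mulmxA. Qed.

Lemma frob_conj P M S : frob P (M^T *m S *m M) = frob (M *m P *m M^T) S.
Proof.
by rewrite !frob_tr !trmx_mul trmxK !mulmxA [LHS]mxtrace_mulC !mulmxA.
Qed.

Lemma dotv_mulmx x y M : dotv x (y *m M) = dotv (x *m M^T) y.
Proof. by rewrite !dotv_mx trmx_mul mulmxA. Qed.

Lemma qf_entry_le P (e : R) x : (forall i j, `|P i j| <= e) -> 0 <= e ->
  `|qf P x| <= n%:R ^+ 2 * e * dotv x x.
Proof.
move=> Pe e0; apply: le_trans (ler_norm_sum _ _ _) _.
apply: (@le_trans _ _ (\sum_(i < n) \sum_(j < n) e * dotv x x)).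
  apply: ler_sum => i _; apply: le_trans (ler_norm_sum _ _ _) _.
  apply: ler_sum => j _; rewrite -mulrA normrM ler_pM // normrM -enorm_sqr expr2.
  by rewrite ler_pM // coord_le_enorm.
have E (c : R) : \sum_(i < n) c = n%:R * c by rewrite sumr_const card_ord -[LHS]mulr_natl.
by rewrite !E expr2 !mulrA.
Qed.

End MatrixForms.

Section FlatEquation.
Context {R : realType} {n : nat}.
Variables (Om : set 'rV[R]_n) (p : 'rV[R]_n) (k : 'I_n) (sg r rho Kc : R).
Variable Gam : 'rV[R]_n -> R.
Hypothesis FC : flat_chart Om p k sg r rho Kc Gam.
Hypothesis oOm : open Om.
Variables (a : 'rV[R]_n -> 'M[R]_n) (b : 'rV[R]_n -> 'rV[R]_n).
Implicit Types (X Y Z z y : 'rV[R]_n).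
Hypothesis a_sym : forall y i j, Om y -> a y i j = a y j i.

Let D := half_ball k rho.
Let T := flat p k sg Gam.
Let N := Nor k sg Gam.
Local Notation aT := (aT p k sg Gam a).
Local Notation bT := (bT p k sg Gam b).
Local Notation conor := (conor p k sg Gam a).
Local Notation ann := (ann p k sg Gam a).
Local Notation bN := (bN p k sg Gam b).
Local Notation aHess := (aHess p k sg Gam a).

Definition Dflat X : 'M[R]_n := \matrix_(l, i)
  (if l == k then sg * (pd i Gam X + 2 * X 0 k * (i == k)%:R) else (l == i)%:R).

(** The coefficients in the flat coordinates. As the height is the square of the
    flat normal coordinate, each normal index brings a factor [(2 * s)^-1]. *)
Definition Ahat X : 'M[R]_n := \matrix_(i, j)
  (if i == k then if j == k then ann X / (4 * X 0 k ^+ 2) else conor j X / (2 * X 0 k)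
   else if j == k then conor i X / (2 * X 0 k) else aT i j X).

Definition Bhat X : 'rV[R]_n := \row_i
  (if i == k then (bN X - aHess X - ann X / (2 * X 0 k ^+ 2)) / (2 * X 0 k) else bT i X).

Lemma dflat_mul X z : dflat k sg Gam X z = z *m (Dflat X)^T.
Proof.
apply/rowP => l; rewrite !mxE; under [RHS]eq_bigr do rewrite !mxE.
case: eqP => [_|_].
  rewrite (_ : 2 * X 0 k * z 0 k = \sum_i 2 * X 0 k * (i == k)%:R * z 0 i); last first.
    rewrite (bigD1 k) //= eqxx mulr1 big1 ?addr0 // => i ik.
    by rewrite (negbTE ik) mulr0 mul0r.
  by rewrite -big_split /= mulr_sumr; apply: eq_bigr => i _; ring.
rewrite (bigD1 l) //= eqxx mulr1 big1 ?addr0 // => i il.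
by rewrite eq_sym (negbTE il) mulr0.
Qed.

Let sum_N (F : 'I_n -> R) X : \sum_i F i * N X 0 i = sg * F k - \sum_i F i * pd i Gam X.
Proof.
rewrite (_ : sg * F k = \sum_i F i * ((i == k)%:R * sg)); last first.
  rewrite (bigD1 k) //= eqxx mul1r big1 ?addr0 1?mulrC // => i ik.
  by rewrite (negbTE ik) mul0r mulr0.
by rewrite -sumrB; apply: eq_bigr => i _; rewrite mxE mulrBr.
Qed.

Let sum_k (F : 'I_n -> R) X : \sum_i F i * (sg * (pd i Gam X + 2 * X 0 k * (i == k)%:R)) =
  sg * (\sum_i F i * pd i Gam X) + 2 * X 0 k * sg * F k.
Proof.
rewrite (_ : 2 * X 0 k * sg * F k = \sum_i 2 * X 0 k * sg * F i * (i == k)%:R); last first.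
  rewrite (bigD1 k) //= eqxx mulr1 big1 ?addr0 // => i ik.
  by rewrite (negbTE ik) mulr0.
by rewrite mulr_sumr -big_split /=; apply: eq_bigr => i _; ring.
Qed.

Let sum_Gam_eq (F G : 'I_n -> R) X : (forall i, i != k -> F i = G i) ->
  \sum_i F i * pd i Gam X = \sum_i G i * pd i Gam X.
Proof.
move=> FG; apply: eq_bigr => i _; have [->|ik] := eqVneq i k; last by rewrite FG.
by rewrite (dkGam FC) !mulr0.
Qed.

Lemma Ahat_D X : D X -> Ahat X *m (Dflat X)^T =
  \matrix_(i, l) (if i == k then conor l X / (2 * X 0 k) else aT i l X).
Proof.
move=> DX; have [X0 _] := DX; have x0 : X 0 k != 0 by rewrite gt_eqF.
have OT := flat_Om FC DX; have ss := fc_sg FC.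
apply/matrixP => i l; rewrite [LHS]mxE [RHS]mxE.
under eq_bigr do rewrite [_^T _ _]mxE [Dflat _ _ _]mxE.
have [->|lk] := eqVneq l k; last first.
  rewrite (bigD1 l) //= eqxx mulr1 big1 ?addr0 => [|j jl]; last first.
    by rewrite eq_sym (negbTE jl) mulr0.
  by rewrite mxE (negbTE lk).
rewrite sum_k; have [->|ik] := eqVneq i k.
  rewrite (@sum_Gam_eq _ (fun j => (2 * X 0 k)^-1 * conor j X)) => [|j jk]; last first.
    by rewrite mxE eqxx (negbTE jk) mulrC.
  under eq_bigr do rewrite -mulrA; rewrite -mulr_sumr.
  have := sum_N (fun j => conor j X) X; rewrite -/(ann X) mxE !eqxx => E.
  have -> : \sum_i conor i X * pd i Gam X = sg * conor k X - ann X by rewrite E; ring.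
  transitivity (sg * sg * conor k X / (2 * X 0 k)); first by field.
  by rewrite ss mul1r.
rewrite (@sum_Gam_eq _ (fun j => aT i j X)) => [|j jk]; last first.
  by rewrite mxE (negbTE ik) (negbTE jk).
rewrite mxE (negbTE ik) eqxx.
have := sum_N (fun j => aT i j X) X.
have -> : \sum_j aT i j X * N X 0 j = conor i X.
  by apply: eq_bigr => j _; rewrite /aT a_sym.
move=> E; have -> : \sum_j aT i j X * pd j Gam X = sg * aT i k X - conor i X by rewrite E; ring.
transitivity (sg * sg * aT i k X); first by field.
by rewrite ss mul1r.
Qed.

(** [Ahat] is the leading part transported by the Jacobian [Dflat]. *)
Lemma D_Ahat_D X : D X -> Dflat X *m Ahat X *m (Dflat X)^T = a (T X).
Proof.
move=> DX; have [X0 _] := DX; have x0 : X 0 k != 0 by rewrite gt_eqF.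
have ss := fc_sg FC.
rewrite -mulmxA Ahat_D //; apply/matrixP => m l; rewrite [LHS]mxE.
have [->|mk] := eqVneq m k; last first.
  rewrite (bigD1 m) //= !mxE (negbTE mk) eqxx mul1r big1 ?addr0 // => j jm.
  by rewrite !mxE (negbTE mk) eq_sym (negbTE jm) mul0r.
under eq_bigr do rewrite [Dflat _ _ _]mxE eqxx mulrC.
rewrite sum_k (@sum_Gam_eq _ (fun j => aT j l X)) => [|j jk]; last first.
  by rewrite mxE (negbTE jk).
rewrite mxE eqxx; have E := sum_N (fun j => aT j l X) X.
have -> : \sum_j aT j l X * pd j Gam X = sg * aT k l X - conor l X.
  by rewrite /conor E; ring.
transitivity (sg * sg * aT k l X); first by field.
by rewrite ss mul1r.
Qed.

(** [Bhat] is the first order part transported by the Jacobian, corrected by the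
    second derivatives of [flat], which only has a curved [k]-th component. *)
Lemma Bhat_D X : D X -> Bhat X *m (Dflat X)^T =
  b (T X) - (sg * (aHess X + ann X / (2 * X 0 k ^+ 2))) *: delta_mx 0 k.
Proof.
move=> DX; have [X0 _] := DX; have x0 : X 0 k != 0 by rewrite gt_eqF.
have ss := fc_sg FC.
apply/rowP => l; rewrite [LHS]mxE.
under eq_bigr do rewrite [_^T _ _]mxE [Dflat _ _ _]mxE.
rewrite [RHS]mxE [(- _ : 'rV[R]_n) _ _]mxE [(_ *: _ : 'rV[R]_n) _ _]mxE [delta_mx _ _ _ _]mxE eqxx /=.
have [->|lk] := eqVneq l k; last first.
  rewrite (bigD1 l) //= eqxx mulr1 big1 ?addr0 => [|j jl]; last first.
    by rewrite eq_sym (negbTE jl) mulr0.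
  by rewrite mxE (negbTE lk) mulr0 subr0.
rewrite sum_k (@sum_Gam_eq _ (fun j => bT j X)) => [|j jk]; last first.
  by rewrite mxE (negbTE jk).
rewrite mxE eqxx; have E := sum_N (fun j => bT j X) X.
have -> : \sum_j bT j X * pd j Gam X = sg * bT k X - bN X by rewrite /bN E; ring.
transitivity (sg * sg * bT k X - sg * (aHess X + ann X / (2 * X 0 k ^+ 2))); first by field.
by rewrite ss mul1r mulr1.
Qed.

Lemma frob_Ahat_ddGam X :
  frob (Ahat X) (\matrix_(i, j) pd j (pd i Gam) X) = aHess X.
Proof.
apply: eq_bigr => i _; apply: eq_bigr => j _; rewrite [_ i j]mxE [in X in _ * X]mxE.
have [->|ik] := eqVneq i k; first by rewrite (ddkGam FC) !mulr0.
have [->|jk] := eqVneq j k; first by rewrite (dkdGam FC) !mulr0.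
by [].
Qed.

Variable u : 'rV[R]_n -> R.
Hypothesis u_C2 : C2_on Om u.

(** The gradient and the Hessian of the solution in the flat coordinates, given
    through expansions along lines, satisfy the transported equation. *)
Lemma flat_equation X : D X -> exists (q : 'rV[R]_n) (S : 'M[R]_n),
  (forall z, jet2 (fun t => u (T (X + t *: z))) (dotv q z) (qf S z)) /\
  frob (Ahat X) S + dotv (Bhat X) q =
  \sum_i \sum_j a (T X) i j * pd j (pd i u) (T X) + \sum_i b (T X) 0 i * pd i u (T X).
Proof.
move=> DX; have [X0 _] := DX; have x0 : X 0 k != 0 by rewrite gt_eqF.
pose g : 'rV[R]_n := \row_i pd i u (T X).
pose U : 'M[R]_n := \matrix_(i, j) pd j (pd i u) (T X).
pose HG : 'M[R]_n := \matrix_(i, j) pd j (pd i Gam) X.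
pose E : 'M[R]_n := (delta_mx 0 k : 'rV[R]_n)^T *m delta_mx 0 k.
pose S := (Dflat X)^T *m U *m Dflat X + (sg * pd k u (T X)) *: (HG + 2 *: E).
exists (g *m Dflat X), S; split.
  move=> z.
  have J := @C2_chain R n Om u (fun t => T (X + t *: z)) (fun t => dflat k sg Gam (X + t *: z) z)
    (ddflat k sg Gam X z) oOm u_C2.
  move: J; rewrite scale0r addr0.
  move=> /(_ (flat_Om FC DX) (fun i s => flat_line FC X z s i) (fun i => dflat_line FC X z i)).
  have -> : dotv (g *m Dflat X) z = \sum_i pd i u (T X) * dflat k sg Gam X z 0 i.
    rewrite dflat_mul dotvC dotv_mulmx dotvC.
    by apply: eq_bigr => i _; rewrite mxE.
  suff -> : qf S z = \sum_i \sum_j pd j (pd i u) (T X) * dflat k sg Gam X z 0 j *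
       dflat k sg Gam X z 0 i + \sum_i pd i u (T X) * ddflat k sg Gam X z 0 i by [].
  rewrite /S qfDl qf_conj -dflat_mul; congr (_ + _).
    apply: eq_bigr => i _; apply: eq_bigr => j _; rewrite mxE; ring.
  rewrite [RHS](bigD1 k) //= big1 ?addr0 => [|i ik]; last by rewrite mxE (negbTE ik) mulr0.
  rewrite qfZl qfDl qfZl qf_rank1 dotvC dotv_delta [ddflat _ _ _ _ _ _ _]mxE eqxx.
  rewrite (mulrC sg) -mulrA; congr (_ * (_ * (_ + _))).
  by apply: eq_bigr => i _; apply: eq_bigr => j _; rewrite mxE; ring.
rewrite /S frobDr frob_conj D_Ahat_D // dotv_mulmx Bhat_D //.
rewrite (frobC _ (_ *: _)) frobZl (frobC (HG + _)) frobDr frob_Ahat_ddGam.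
rewrite (frobC _ (_ *: _)) frobZl frob_rank1 qf_delta mxE !eqxx.
rewrite dotvDl dotvNl dotvZl (dotvC (delta_mx _ _)) dotv_delta [g _ _]mxE.
have -> : frob (a (T X)) U = \sum_i \sum_j a (T X) i j * pd j (pd i u) (T X).
  by apply: eq_bigr => i _; apply: eq_bigr => j _; rewrite mxE.
have -> : dotv (b (T X)) g = \sum_i b (T X) 0 i * pd i u (T X).
  by apply: eq_bigr => i _; rewrite mxE.
by field.
Qed.

End FlatEquation.

(** * The estimate near a boundary point *)

Record regular_coefs {R : realType} {n : nat} (Om : set 'rV[R]_n) (Kc : R)
    (a : 'rV[R]_n -> 'M[R]_n) (b : 'rV[R]_n -> 'rV[R]_n) : Prop := RegularCoefs {
  rc_a : forall i j, C2_on Om (fun x => a x i j);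
  rc_b : forall i, C1_on Om (fun x => b x 0 i);
  rc_a0 : forall i j y, Om y -> `|a y i j| <= Kc;
  rc_a1 : forall l i j y, Om y -> `|pd l (fun x => a x i j) y| <= Kc;
  rc_a2 : forall m l i j y, Om y -> `|pd m (pd l (fun x => a x i j)) y| <= Kc;
  rc_b0 : forall i y, Om y -> `|b y 0 i| <= Kc;
  rc_b1 : forall l i y, Om y -> `|pd l (fun x => b x 0 i) y| <= Kc;
  rc_sym : forall y i j, Om y -> a y i j = a y j i }.

(** The factor [n.+1] also covers the sums over indices in traces and in the
    defect. *)
Definition c_total {R : realType} (n : nat) (Kc : R) : R :=
  n.+1%:R * (@c_basic R n Kc + @c_conor R n Kc + @c_dann R n Kc + @c_divN R n Kc
    + @c_dconor R n Kc).

Section LocalEstimate.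
Context {R : realType} {n : nat}.
Variables (Om : set 'rV[R]_n) (p : 'rV[R]_n) (k : 'I_n) (sg r rho Kc : R).
Variable Gam : 'rV[R]_n -> R.
Hypothesis FC : flat_chart Om p k sg r rho Kc Gam.
Hypothesis oOm : open Om.
Variables (a : 'rV[R]_n -> 'M[R]_n) (b : 'rV[R]_n -> 'rV[R]_n).
Hypothesis RC : regular_coefs Om Kc a b.
Implicit Types (X Y Z z y : 'rV[R]_n).

Let D := half_ball k rho.
Let T := flat p k sg Gam.
Let cb := @c_basic R n Kc.
Let cc := @c_conor R n Kc.
Let cd := @c_dann R n Kc.
Let cv := @c_divN R n Kc.
Let ce := @c_dconor R n Kc.
Let K := @c_total R n Kc.

Variables (c1 lam1 rho' lam eps Ku Kf : R) (u : 'rV[R]_n -> R).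
Hypotheses (lam0 : 0 < lam) (eps0 : 0 <= eps) (rho'0 : 0 < rho') (rho'_lt : rho' < rho).
Hypotheses (lam_c1 : 12 * lam <= c1) (lam_lam1 : 3 * lam <= lam1).
Hypothesis eps_osc : n%:R ^+ 2 * (4 * K * rho') <= eps.
Hypothesis small : (4 * n%:R + 1) * eps + 4 * K * (n.+1%:R * rho') <= lam.
Hypothesis conor_lim : forall X j, D X ->
  conor p k sg Gam a j (setk k X s) @[s --> 0^'+] --> (0 : R).
Hypothesis dann_lim : forall X, D X -> exists2 q : R, c1 <= q &
  dann p k sg Gam a (setk k X s) @[s --> 0^'+] --> q.
Hypothesis drift_lim : forall X, D X -> exists2 q : R, 0 <= q &
  (bN p k sg Gam b (setk k X s) - divN p k sg Gam a (setk k X s)) @[s --> 0^'+] --> q.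
Hypothesis block_ell : forall X z, D X -> enorm X <= rho' -> z 0 k = 0 ->
  lam1 * dotv z z <= qf (a (T X)) z.
Hypothesis u_C2 : C2_on Om u.
Hypothesis u_osc : forall x y, Om x -> Om y -> u x - u y <= Ku.
Hypothesis u_eq : forall x, Om x ->
  `|\sum_i \sum_j a x i j * pd j (pd i u) x + \sum_i b x 0 i * pd i u x| <= Kf.

(* The numerator of the singular normal drift; [dann X / 4] is the limit of the
   leading normal coefficient. *)
Let hh X := (bN p k sg Gam b X - divN p k sg Gam a X + dann p k sg Gam a X / 2) / 2.
Let D' X := 0 < X 0 k /\ enorm X <= rho'.

Let D'D X : D' X -> D X.
Proof. by move=> [X0 Xr]; split => //; exact: le_lt_trans Xr rho'_lt. Qed.

Let Lb := bN_vlip FC oOm (rc_b RC) (rc_b0 RC) (rc_b1 RC).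
Let Ld := divN_vlip FC oOm (rc_a RC) (rc_a1 RC) (rc_a2 RC).
Let Lq := dann_vlip FC oOm (rc_a RC) (rc_a1 RC) (rc_a2 RC).
Let Le := dconor_vlip FC oOm (rc_a RC) (rc_a0 RC) (rc_a1 RC) (rc_a2 RC).
Let Hb := bN_hlip FC oOm (rc_b RC) (rc_b0 RC) (rc_b1 RC).
Let Hd := divN_hlip FC oOm (rc_a RC) (rc_a1 RC) (rc_a2 RC).
Let Hq := dann_hlip FC oOm (rc_a RC) (rc_a1 RC) (rc_a2 RC).
Let Ha := aT_hlip FC oOm (rc_a RC) (rc_a0 RC) (rc_a1 RC).
Let HB := bT_hlip FC oOm (rc_b RC) (rc_b0 RC) (rc_b1 RC).

Let consts : [/\ 0 <= cb, 0 <= cc, 0 <= cd, 0 <= cv & 0 <= ce].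
Proof.
by split; [case: (c_basic_ge FC)|case: Lb|case: Lq|case: Ld|case: (Le k k)].
Qed.

Let K_ge : [/\ cb + cc + cd + cv + ce <= K, n%:R * (cb + cd) <= K, n%:R * ce + cc + cd + cv <= K,
  n%:R * cc + cd <= K & 0 <= K].
Proof.
have [b0 c0 d0 v0 e0] := consts; have nn : 0 <= n%:R :> R by [].
have := mulr_ge0 nn b0; have := mulr_ge0 nn c0; have := mulr_ge0 nn d0.
have := mulr_ge0 nn v0; have := mulr_ge0 nn e0 => x1 x2 x3 x4 x5.
rewrite /K /c_total -/cb -/cc -/cd -/cv -/ce -[n.+1%:R]natr1.
by split; lra.
Qed.

Let s_facts X : D' X -> [/\ 0 < X 0 k, X 0 k <= rho', X 0 k <= 1 & X 0 k ^+ 2 <= rho'].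
Proof.
move=> [X0 Xr]; have X1 : X 0 k <= rho' by apply: le_trans (ler_norm _) (le_trans (coord_le_enorm _ _) Xr).
have X2 : X 0 k <= 1 by apply: le_trans X1 (le_trans (ltW rho'_lt) (fc_rho1 FC)).
split => //; rewrite expr2 -[leRHS]mul1r; apply: ler_pM => //; exact: ltW.
Qed.

Let dist X Y : D' X -> D' Y -> enorm (X - Y) <= 2 * rho'.
Proof.
move=> [_ Xr] [_ Yr]; apply: le_trans (enormD _ _) _; rewrite enormN.
by move: Xr Yr; lra.
Qed.

Let conor_b X j : D' X -> `|conor p k sg Gam a j X / (2 * X 0 k)| <= cc * X 0 k / 2.
Proof.
move=> DX; have [X0 _ _ _] := s_facts DX.
have H := conor_small FC oOm (rc_a RC) (rc_a0 RC) (rc_a1 RC) conor_lim j (D'D DX).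
rewrite normrM normfV (gtr0_norm (_ : 0 < 2 * X 0 k)) ?mulr_gt0 //.
rewrite ler_pdivrMr ?mulr_gt0 //; move: H; rewrite -/cc; lra.
Qed.

Let ann_b X : D' X ->
  `|ann p k sg Gam a X / (4 * X 0 k ^+ 2) - dann p k sg Gam a X / 4| <= cd * X 0 k ^+ 2 / 2.
Proof.
move=> DX; have [X0 _ _ _] := s_facts DX.
have H := ann_small FC oOm (rc_a RC) (rc_a1 RC) (rc_a2 RC) conor_lim (D'D DX).
have s0 : 0 < 4 * X 0 k ^+ 2 by rewrite mulr_gt0 // exprn_gt0.
rewrite (_ : _ - _ = (ann p k sg Gam a X - X 0 k ^+ 2 * dann p k sg Gam a X) / (4 * X 0 k ^+ 2)).
  rewrite normrM normfV (gtr0_norm s0) ler_pdivrMr //.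
  by rewrite (_ : cd * X 0 k ^+ 2 / 2 * _ = 2 * cd * X 0 k ^+ 4) //; field.
by field; rewrite gt_eqF.
Qed.

Let defect_b X : D' X -> `|defect p k sg Gam a X| <= n%:R * ce * X 0 k ^+ 2.
Proof. by move=> DX; exact: (defect_small FC oOm (rc_a RC) (rc_a0 RC) (rc_a1 RC) (rc_a2 RC) conor_lim (D'D DX)). Qed.

Let dann_ge X : D' X -> c1 - cd * X 0 k ^+ 2 <= dann p k sg Gam a X.
Proof.
move=> DX; have [q qc ql] := dann_lim (D'D DX).
have := vlip_lim Lq (D'D DX) ql; rewrite -/cd ler_norml => /andP[+ _]; lra.
Qed.

Let drift_ge X : D' X -> - ((cc + cv) * X 0 k ^+ 2) <= bN p k sg Gam b X - divN p k sg Gam a X.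
Proof.
move=> DX; have [q qc ql] := drift_lim (D'D DX).
have := vlip_lim (wlipB Lb Ld) (D'D DX) ql; rewrite -/cc -/cv ler_norml => /andP[+ _].
lra.
Qed.

Let Krho : K * rho' <= lam.
Proof.
have [_ _ _ _ K0] := K_ge; have Kr := mulr_ge0 K0 (ltW rho'0).
have h4 : 1 <= 4 * n.+1%:R :> R by rewrite -natrM ler1n.
have e1 : 0 <= (4 * n%:R + 1) * eps by rewrite mulr_ge0 // addr_ge0 // mulr_ge0.
have e2 := ler_wpM2l Kr h4; move: small e1 e2; lra.
Qed.

Let hyp_sym X : D' X -> (Ahat p k sg Gam a X)^T = Ahat p k sg Gam a X.
Proof.
move=> DX; apply/matrixP => i j; rewrite !mxE.
case: (eqVneq i k) => [_|_]; case: (eqVneq j k) => [_|_] //.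
by rewrite /aT (rc_sym RC) //; exact: (flat_Om FC (D'D DX)).
Qed.

Let entry_osc X Y i j : D' X -> D' Y ->
  `|Ahat p k sg Gam a X i j - Ahat p k sg Gam a Y i j| <= 4 * K * rho'.
Proof.
move=> DX DY; have [K1 _ _ _ K0] := K_ge; have [b0 c0 d0 v0 e0] := consts.
have [X0 Xr X1 X2] := s_facts DX; have [Y0 Yr Y1 Y2] := s_facts DY.
have r0 := ltW rho'0; have dXY := dist DX DY.
have Kc' c : 0 <= c -> c <= cb + cc + cd + cv + ce -> c * rho' <= K * rho'.
  by move=> c00 cK; rewrite ler_wpM2r // (le_trans cK).
have kb : cb * rho' <= K * rho' by apply: Kc' => //; lra.
have kc : cc * rho' <= K * rho' by apply: Kc' => //; lra.
have kd : cd * rho' <= K * rho' by apply: Kc' => //; lra.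
have Kr0 : 0 <= K * rho' by apply: mulr_ge0.
have cX l : `|conor p k sg Gam a l X / (2 * X 0 k)| <= K * rho'.
  apply: le_trans (conor_b l DX) _; have := ler_wpM2l c0 Xr; lra.
have cY l : `|conor p k sg Gam a l Y / (2 * Y 0 k)| <= K * rho'.
  apply: le_trans (conor_b l DY) _; have := ler_wpM2l c0 Yr; lra.
rewrite !mxE; case: (eqVneq i k) => [_|ik]; case: (eqVneq j k) => [_|jk].
- have hX := ann_b DX; have hY := ann_b DY.
  have [_ _ dl] := Hq; have := dl X Y (D'D DX) (D'D DY) I; rewrite -/cd => hd.
  have e1 := ler_wpM2l d0 X2; have e2 := ler_wpM2l d0 Y2; have e3 := ler_wpM2l d0 dXY.
  move: hX hY hd; rewrite !ler_norml => /andP[x1 x2] /andP[y1 y2] /andP[z1 z2].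
  apply/andP; split; lra.
- apply: le_trans (ler_normB _ _) _; have := cX j; have := cY j; lra.
- apply: le_trans (ler_normB _ _) _; have := cX i; have := cY i; lra.
- have [_ _ al] := Ha i j; apply: le_trans (al X Y (D'D DX) (D'D DY) I) _.
  rewrite -/cb; have := ler_wpM2l b0 dXY; lra.
Qed.

Let hyp_osc X Y z : D' X -> D' Y ->
  `|qf (Ahat p k sg Gam a X) z - qf (Ahat p k sg Gam a Y) z| <= eps * dotv z z.
Proof.
move=> DX DY; rewrite -qfBl; have [_ _ _ _ K0] := K_ge.
apply: le_trans (@qf_entry_le R n _ (4 * K * rho') z _ _) _.
- by move=> i j; rewrite mxE [(- _ : 'M[R]_n) _ _]mxE; exact: entry_osc.
- by apply: mulr_ge0; [apply: mulr_ge0|exact: ltW].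
- by rewrite ler_wpM2r ?dotv_ge0.
Qed.

Let hyp_tr X : D' X -> \tr (Ahat p k sg Gam a X) <= K.
Proof.
move=> DX; have [_ K2 _ _ _] := K_ge; apply: le_trans K2.
have [b0 c0 d0 v0 e0] := consts; have [X0 Xr X1 X2] := s_facts DX.
apply: (@le_trans _ _ (\sum_(i < n) (cb + cd))); last first.
  by rewrite sumr_const card_ord -[X in X <= _]mulr_natl.
apply: ler_sum => i _; rewrite mxE; case: eqP => _.
  have := ann_b DX; rewrite ler_norml => /andP[_ h].
  have [_ dB _] := Lq; have := le_trans (ler_norm _) (dB X (D'D DX)); rewrite -/cd => h2.
  have h3 : cd * X 0 k ^+ 2 <= cd.
    by rewrite -[leRHS]mulr1 ler_wpM2l // exprn_ile1 // ltW.
  lra.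
have [_ aB _] := Ha i i; apply: le_trans (ler_norm _) (le_trans (aB X (D'D DX)) _).
by rewrite lerDl.
Qed.

Let hyp_tan X i : D' X -> i != k -> `|Bhat p k sg Gam a b X 0 i| <= K.
Proof.
move=> DX ik; rewrite mxE (negbTE ik); have [_ bB _] := HB i.
have [K1 _ _ _ _] := K_ge; have [b0 c0 d0 v0 e0] := consts.
by apply: le_trans (bB X (D'D DX)) _; rewrite -/cb; lra.
Qed.

Let Bk X : D' X -> X 0 k * Bhat p k sg Gam a b X 0 k =
  (bN p k sg Gam b X - divN p k sg Gam a X + dann p k sg Gam a X + defect p k sg Gam a X) / 2
  - ann p k sg Gam a X / (4 * X 0 k ^+ 2).
Proof.
move=> DX; have [X0 _ _ _] := s_facts DX.
by rewrite mxE eqxx /defect; field; rewrite gt_eqF.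
Qed.

Let hyp_nor X : D' X -> `|X 0 k * Bhat p k sg Gam a b X 0 k - hh X| <= K * X 0 k ^+ 2.
Proof.
move=> DX; rewrite Bk //; have := defect_b DX; have := ann_b DX.
have [_ _ K3 _ _] := K_ge; have [b0 c0 d0 v0 e0] := consts.
have s0 := sqr_ge0 (X 0 k); have := ler_wpM2r s0 K3.
have := mulr_ge0 c0 s0; have := mulr_ge0 v0 s0; have := mulr_ge0 d0 s0.
have := mulr_ge0 (mulr_ge0 (ler0n R n) e0) s0.
rewrite /hh !ler_norml => k1 k2 k3 k4 k5 /andP[x1 x2] /andP[y1 y2].
by apply/andP; split; lra.
Qed.

(* The boundary value of [bN - divN] is nonnegative, so that the normal drift is
   that of a Bessel process of dimension at least two. *)
Let hyp_barrier X : D' X -> Ahat p k sg Gam a X k k <=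
  X 0 k * Bhat p k sg Gam a b X 0 k + K * X 0 k ^+ 2.
Proof.
move=> DX; rewrite Bk // mxE eqxx; have := defect_b DX; have := ann_b DX.
have := drift_ge DX; have [_ _ K3 _ _] := K_ge; have [b0 c0 d0 v0 e0] := consts.
have s0 := sqr_ge0 (X 0 k); have := ler_wpM2r s0 K3.
have := mulr_ge0 c0 s0; have := mulr_ge0 v0 s0; have := mulr_ge0 d0 s0.
have := mulr_ge0 (mulr_ge0 (ler0n R n) e0) s0.
rewrite !ler_norml => k1 k2 k3 k4 k5 k6 /andP[x1 x2] /andP[y1 y2].
lra.
Qed.

Let hyp_h0 X : D' X -> 0 <= hh X.
Proof.
move=> DX; have := drift_ge DX; have := dann_ge DX; rewrite /hh.
have [K1 _ _ _ _] := K_ge; have [b0 c0 d0 v0 e0] := consts.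
have [X0 Xr X1 X2] := s_facts DX; have r0 := ltW rho'0.
have := ler_wpM2r r0 K1; have KK := Krho; move: lam0 lam_c1.
have e1 := ler_wpM2l d0 X2; have e2 := ler_wpM2l (addr_ge0 c0 v0) X2.
have := mulr_ge0 b0 r0; have := mulr_ge0 e0 r0; have := mulr_ge0 d0 r0.
lra.
Qed.

Let hyp_hK X : D' X -> hh X <= K.
Proof.
move=> DX; have [K1 _ _ _ _] := K_ge; have [b0 c0 d0 v0 e0] := consts.
have [_ B1 _] := Lb; have [_ B2 _] := Ld; have [_ B3 _] := Lq.
have := le_trans (ler_norm _) (B1 X (D'D DX)); have := le_trans (ler_norm _) (B3 X (D'D DX)).
have := B2 X (D'D DX); rewrite ler_norml -/cc -/cd -/cv /hh => /andP[x1 _] x2 x3.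
lra.
Qed.

Let hyp_hosc X Y : D' X -> D' Y -> `|hh X - hh Y| <= eps.
Proof.
move=> DX DY; have [K1 _ _ _ K0] := K_ge; have [b0 c0 d0 v0 e0] := consts.
have r0 := ltW rho'0; have Kr0 : 0 <= K * rho' by apply: mulr_ge0.
have n1 : 1 <= n%:R ^+ 2 :> R.
  by rewrite exprn_ege1 // ler1n; apply: leq_trans (ltn_ord k).
apply: (@le_trans _ _ (4 * K * rho')); last first.
  have K4 : 0 <= 4 * K * rho' by apply: mulr_ge0 => //; apply: mulr_ge0.
  by apply: le_trans eps_osc; rewrite -[leLHS]mul1r ler_wpM2r.
have [_ _ B1] := Hb; have [_ _ B2] := Hd; have [_ _ B3] := Hq.
have := B1 X Y (D'D DX) (D'D DY) I; have := B2 X Y (D'D DX) (D'D DY) I.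
have := B3 X Y (D'D DX) (D'D DY) I; rewrite -/cc -/cd -/cv.
have dXY := dist DX DY; have e1 := ler_wpM2l c0 dXY; have e2 := ler_wpM2l d0 dXY.
have e3 := ler_wpM2l v0 dXY.
have e4 := ler_wpM2r r0 K1; have := mulr_ge0 b0 r0; have := mulr_ge0 e0 r0.
have := mulr_ge0 d0 r0; have := mulr_ge0 c0 r0; have := mulr_ge0 v0 r0.
rewrite /hh !ler_norml => f1 f2 f3 f4 f5 /andP[x1 x2] /andP[y1 y2] /andP[z1 z2].
by apply/andP; split; lra.
Qed.

(* The mixed coefficients vanish at the boundary; the tangential block is elliptic
   by [block_ell] and the normal coefficient by [dann_lim]. *)
Let hyp_ell X z : D' X -> (lam + eps) * dotv z z <= qf (Ahat p k sg Gam a X) z.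
Proof.
move=> DX; have [K1 _ _ K4 K0] := K_ge; have [b0 c0 d0 v0 e0] := consts.
have [X0 Xr X1 X2] := s_facts DX; have r0 := ltW rho'0.
pose z' := z - z 0 k *: delta_mx 0 k.
have z'k : z' 0 k = 0 by rewrite !mxE !eqxx mulr1 subrr.
have z'i i : i != k -> z' 0 i = z 0 i by move=> ik; rewrite !mxE eqxx (negbTE ik) mulr0 subr0.
have zE : dotv z z = dotv z' z' + z 0 k ^+ 2.
  rewrite /dotv (bigD1 k) //= [in RHS](bigD1 k) //= z'k mulr0 add0r addrC expr2.
  by congr (_ + _); apply: eq_bigr => i ik; rewrite z'i.
have qE : qf (Ahat p k sg Gam a X) z = qf (a (T X)) z' +
   2 * z 0 k * (\sum_(i | i != k) conor p k sg Gam a i X / (2 * X 0 k) * z 0 i) +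
   ann p k sg Gam a X / (4 * X 0 k ^+ 2) * z 0 k ^+ 2.
  have -> : ann p k sg Gam a X / (4 * X 0 k ^+ 2) = Ahat p k sg Gam a X k k by rewrite mxE eqxx.
  rewrite /qf (bigD1 k) //= (bigD1 k) //=.
  have -> : \sum_(j | j != k) Ahat p k sg Gam a X k j * z 0 k * z 0 j =
    z 0 k * (\sum_(i | i != k) conor p k sg Gam a i X / (2 * X 0 k) * z 0 i).
    rewrite mulr_sumr; apply: eq_bigr => j jk; rewrite mxE eqxx (negbTE jk); ring.
  have -> : \sum_(i < n | i != k) \sum_(j < n) Ahat p k sg Gam a X i j * z 0 i * z 0 j =
     z 0 k * (\sum_(i | i != k) conor p k sg Gam a i X / (2 * X 0 k) * z 0 i) +
     \sum_(i < n) \sum_(j < n) a (T X) i j * z' 0 i * z' 0 j.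
    have -> : \sum_(i < n) \sum_(j < n) a (T X) i j * z' 0 i * z' 0 j =
        \sum_(i < n | i != k) \sum_(j < n) a (T X) i j * z' 0 i * z' 0 j.
      rewrite (bigD1 k) //= big1 ?add0r // => j _.
      by rewrite z'k mulr0 mul0r.
    rewrite mulr_sumr -big_split /=; apply: eq_bigr => i ik.
    rewrite (bigD1 k) //= [in RHS](bigD1 k) //= z'k mulr0 add0r.
    congr (_ + _); first by rewrite mxE (negbTE ik) eqxx; ring.
    by apply: eq_bigr => j jk; rewrite mxE (negbTE ik) (negbTE jk) !z'i.
  ring.
have cross : `|2 * z 0 k * (\sum_(i | i != k) conor p k sg Gam a i X / (2 * X 0 k) * z 0 i)| <=
   n%:R * cc * rho' * dotv z z.
  rewrite -mulrA mulr_sumr mulr_sumr; apply: le_trans (ler_norm_sum _ _ _) _.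
  have c00 : 0 <= cc * rho' * dotv z z by apply: mulr_ge0 (dotv_ge0 z); exact: mulr_ge0.
  apply: (@le_trans _ _ (\sum_(i < n) cc * rho' * dotv z z)); last first.
    by rewrite sumr_const card_ord -[X in X <= _]mulr_natl !mulrA.
  rewrite [leRHS](bigD1 k) //= ler_wpDl //; apply: ler_sum => i _.
  rewrite (_ : 2 * (z 0 k * _) = 2 * (conor p k sg Gam a i X / (2 * X 0 k)) * (z 0 k * z 0 i)); last by ring.
  rewrite normrM -enorm_sqr expr2; apply: ler_pM => //; last first.
    by rewrite normrM ler_pM // coord_le_enorm.
  rewrite normrM (ger0_norm (ler0n _ 2)); have := conor_b i DX.
  have := ler_wpM2l c0 Xr; lra.
have blk := block_ell (D'D DX) DX.2 z'k.
have zz := dotv_ge0 z'; have zk := sqr_ge0 (z 0 k).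
have annl : c1 / 4 - cd * rho' <= ann p k sg Gam a X / (4 * X 0 k ^+ 2).
  have := ann_b DX; have := dann_ge DX; rewrite ler_norml => x1 /andP[x2 _].
  have := ler_wpM2l d0 X2; have := mulr_ge0 d0 r0; lra.
have KK := Krho; have le1 : eps <= lam.
  have Kr : 0 <= 4 * K * (n.+1%:R * rho').
    by apply: mulr_ge0; [exact: mulr_ge0|exact: mulr_ge0].
  have ne : 0 <= n%:R * eps by exact: mulr_ge0.
  by move: small Kr ne; lra.
have le2 : n%:R * cc * rho' + cd * rho' <= lam.
  by apply: le_trans KK; rewrite -mulrDl ler_wpM2r.
have := ler_wpM2r zk annl; move: cross; rewrite qE zE ler_norml => /andP[cr _] an.
have t1 : 3 * lam * dotv z' z' <= lam1 * dotv z' z' by rewrite ler_wpM2r.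
have t2 : 3 * lam * z 0 k ^+ 2 <= c1 / 4 * z 0 k ^+ 2.
  by rewrite ler_wpM2r //; move: lam_c1; lra.
have t3 : (n%:R * cc * rho' + cd * rho') * (dotv z' z' + z 0 k ^+ 2) <= lam * (dotv z' z' + z 0 k ^+ 2).
  by rewrite ler_wpM2r // addr_ge0.
have t4 : eps * (dotv z' z' + z 0 k ^+ 2) <= lam * (dotv z' z' + z 0 k ^+ 2).
  by rewrite ler_wpM2r // addr_ge0.
have t5 : 0 <= cd * rho' * dotv z' z' by apply: mulr_ge0 => //; exact: mulr_ge0.
lra.
Qed.

(** In the flat coordinates the coefficients satisfy all requirements of
    [halfball_holder]: they vary by a multiple of [rho'] and are bounded below
    because of their boundary values. *)
Lemma local_holder M C : 0 <= Kf -> Ku <= M * rho' ^+ 2 -> 0 <= M ->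
  8 * (2 * Kf + 2 * K + M * (4 * K + 4 * lam + 8 * n%:R * eps + 4 * K * (n%:R + 2)))
    < lam * C ->
  forall X Y, 0 < X 0 k -> enorm X <= rho' -> 0 < Y 0 k -> enorm Y <= rho' ->
  u (T X) - u (T Y) <= C * Num.sqrt (enorm (X - Y)) + M * (dotv X X + dotv Y Y).
Proof.
move=> Kf0 MK M0 MC X Y X0 Xr Y0 Yr.
have DX : D' X by split.
have [_ _ _ _ K0] := K_ge.
apply: (@halfball_holder R n k rho' lam eps K Kf Ku (Ahat p k sg Gam a X)
  (Ahat p k sg Gam a) (Bhat p k sg Gam a b) hh (fun X => u (T X))) => //.
- by apply: le_trans (ltW rho'_lt) (fc_rho1 FC).
- exact: hyp_sym.
- by move=> z; exact: hyp_ell.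
- exact: hyp_tr.
- by move=> Z z DZ; exact: hyp_osc.
- move=> Z DZ; apply: (@continuous_comp _ _ _ T u).
    exact: (@flat_continuous _ _ _ p _ _ _ _ _ _ FC).
  by apply: (u_C2.1.1); exact: (flat_Om FC (D'D DZ)).
- by move=> Z Z' DZ DZ'; apply: u_osc; apply: (flat_Om FC); exact: D'D.
- move=> Z DZ; have [q [S [jS E]]] := flat_equation FC oOm b (rc_sym RC) u_C2 (D'D DZ).
  exists q, S; split => //; rewrite E; apply: u_eq; exact: (flat_Om FC (D'D DZ)).
Qed.

End LocalEstimate.

(** * Limits at the boundary *)

Section ContinuousExtension.
Context {R : realType} {n : nat}.
Variable Om : set 'rV[R]_n.
Implicit Types (h v : 'rV[R]_n -> R) (P : 'rV[R]_n).

Lemma within_closure_cvg h P : {within closure Om, continuous h} -> closure Om P ->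
  h y @[y --> within Om (nbhs P)] --> h P.
Proof.
move=> ch cP; have := ch P.
move=> H B HB.
have H' : nbhs_subspace (P : subspace (closure Om)) (fun y => B (h y)) := H B HB.
rewrite -(nbhs_subspace_in cP) in H'.
have H2 : nbhs P [set y | closure Om y -> B (h y)] := H'.
suff : nbhs P [set y | Om y -> B (h y)] by [].
by apply: filterS H2 => y /= Hy Oy; apply: Hy; exact: subset_closure.
Qed.

Lemma closure_proper P : closure Om P -> ProperFilter (within Om (nbhs P)).
Proof.
move=> cP; apply: Build_ProperFilter_ex => B HB.
by have [y [Oy By]] := cP _ HB; exists y; exact: By.
Qed.

Lemma extends_lim h P : extends_cont Om h -> closure Om P ->
  exists l : R, h y @[y --> within Om (nbhs P)] --> l.
Proof.
move=> [H cH HE] cP; exists (H P).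
apply: cvg_trans (within_closure_cvg cH cP); apply: near_eq_cvg.
have W : within Om (nbhs P) Om by exact: withinT.
by apply: filterS W => y Oy; exact: HE.
Qed.

Lemma pd_bar_lim v i P : extends_cont Om (pd i v) -> closure Om P ->
  pd i v y @[y --> within Om (nbhs P)] --> pd_bar Om i v P.
Proof.
move=> ev cP; have [l L] := extends_lim ev cP; have PF := closure_proper cP.
by rewrite /pd_bar (cvg_lim _ L).
Qed.

Lemma pd_bar_in v i P : open Om -> C1_on Om v -> Om P -> pd_bar Om i v P = pd i v P.
Proof.
move=> oOm [_ v1] OP; have PF := closure_proper (subset_closure OP).
apply: cvg_lim => //; have [_ c] := v1 i P OP.
by apply: cvg_trans c; apply: cvg_app; exact: cvg_within.
Qed.

Lemma closure_compact : bounded_set Om -> compact (closure Om).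
Proof.
move=> bO; apply: bounded_closed_compact; last exact: closed_closure.
have [M [Mr HM]] := bO; exists M; split => // N MN x cx.
have [e e0 eN] : exists2 e : R, 0 < e & M < N - e.
  exists ((N - M) / 2); first by rewrite divr_gt0 // subr_gt0.
  rewrite -subr_gt0 (_ : _ - M = (N - M) / 2); last by field.
  by rewrite divr_gt0 // subr_gt0.
have [y [Oy xy]] := cx _ (nbhsx_ballx x e e0).
move: xy; rewrite -ball_normE /ball_ /= => xy.
have h1 := HM _ eN y Oy; rewrite -(subrK y x).
apply: le_trans (ler_normD _ _) _; apply: (@le_trans _ _ (e + (N - e))).
  by apply: lerD => //; exact: ltW.
by rewrite addrC subrK.
Qed.

Lemma extends_bounded h : bounded_set Om -> extends_cont Om h ->
  exists2 M : R, 0 <= M & forall y, Om y -> `|h y| <= M.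
Proof.
move=> bO [H cH HE].
have [M [Mr HM]] := compact_bounded (continuous_compact cH (closure_compact bO)).
have MM : M < `|M| + 1 by rewrite (le_lt_trans (ler_norm _)) // ltrDl.
exists (`|M| + 1) => [|y Oy]; first by rewrite addr_ge0.
rewrite -HE //; apply: (HM _ MM); exists y => //; exact: subset_closure.
Qed.

End ContinuousExtension.

Section KernelOfPSD.
Context {R : realType} {n : nat}.

(** The form is minimal at [x], so that its gradient vanishes there. *)
Lemma psd_null (P : 'M[R]_n) (x : 'rV[R]_n) : P^T = P -> (forall z, 0 <= qf P z) ->
  qf P x = 0 -> forall i, \sum_j P i j * x 0 j = 0.
Proof.
move=> sP pP x0 i; apply/eqP/negP => /negP nz.
set l := \sum_j _ in nz.
pose t := - l / (P i i + 1).
have Pi : 0 <= P i i by rewrite -qf_delta.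
have P1 : 0 < P i i + 1 by rewrite ltr_wpDl.
have := pP (x + t *: delta_mx 0 i).
have -> : qf P (x + t *: delta_mx 0 i) = 2 * (t * l) + t ^+ 2 * P i i.
  rewrite qfD // qfZ qf_delta x0 add0r; congr (2 * _ + _).
  under eq_bigr => j _ do (under eq_bigr do rewrite mxE mulrCA; rewrite -mulr_sumr sum_delta).
  rewrite mulr_sumr; apply: eq_bigr => j _.
  by rewrite -{1}sP mxE; ring.
have l2 : 0 < l ^+ 2 by rewrite lt_def sqrf_eq0 nz sqr_ge0.
have -> : 2 * (t * l) + t ^+ 2 * P i i = - (l ^+ 2 * (P i i + 2) / (P i i + 1) ^+ 2).
  by rewrite /t; field; rewrite gt_eqF.
rewrite oppr_ge0 leNgt => /negP; apply.
by rewrite divr_gt0 ?exprn_gt0 // mulr_gt0 // ltr_wpDl.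
Qed.

End KernelOfPSD.

(** * Boundary values of the coefficients *)

Section BoundaryLimits.
Context {R : realType} {n : nat}.
Variables (Om : set 'rV[R]_n) (p : 'rV[R]_n) (k : 'I_n) (sg r rho Kc : R).
Variable Gam : 'rV[R]_n -> R.
Hypothesis FC : flat_chart Om p k sg r rho Kc Gam.
Hypotheses (oOm : open Om) (bOm : bounded_set Om).
Variables (a : 'rV[R]_n -> 'M[R]_n) (b : 'rV[R]_n -> 'rV[R]_n) (phi : 'rV[R]_n -> R) (c1 : R).
Hypothesis RC : regular_coefs Om Kc a b.
Hypothesis Hphi : defining_function Om phi.
Hypothesis Ha : forall i j, C2_bar Om (fun x => a x i j).
Hypothesis Hb : forall i, C1_bar Om (fun x => b x 0 i).
Hypothesis Hsym : forall x i j, closure Om x -> a x i j = a x j i.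
Hypothesis Hchar : forall x, bdry Om x -> char_form Om a phi x = 0.
Hypothesis Hpos : forall x, Om x -> pos_def (a x).
Hypothesis Hg : forall x, bdry Om x -> 0 < g_fun Om a b phi x.
Hypothesis c1_gt0 : 0 < c1.
Hypothesis Hc1 : forall x, bdry Om x -> c1 * enorm (grad_bar Om phi x) ^+ 2
   <= enorm (grad_bar Om (char_form Om a phi) x).
Implicit Types (X Y Z z y : 'rV[R]_n).

Let D := half_ball k rho.
Let T := flat p k sg Gam.
Let N := Nor k sg Gam.

Lemma pos_def_qf x z : Om x -> z != 0 -> 0 < qf (a x) z.
Proof. by move=> Ox z0; rewrite qf_mx; exact: Hpos. Qed.

Lemma qf_ge0 x z : Om x -> 0 <= qf (a x) z.
Proof.
move=> Ox; have [->|z0] := eqVneq z 0; last exact/ltW/pos_def_qf.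
by rewrite -[X in qf _ X](scale0r 0) qfZ expr0n mul0r.
Qed.

Lemma near_normal X : D X -> \forall s \near (0 : R)^'+, 0 < s <= X 0 k.
Proof.
move=> [X0 _]; near=> s; apply/andP; split; near: s.
  exact: nbhs_right_gt.
exact: nbhs_right_le.
Unshelve. all: by end_near.
Qed.

Lemma normal_curve X : D X ->
  T (setk k X s) @[s --> 0^'+] --> within Om (nbhs (T (setk k X 0))).
Proof.
move=> DX B HB.
have c : T (setk k X s) @[s --> (0 : R)^'+] --> T (setk k X 0).
  apply: cvg_at_right_filter.
  exact: (cvg_comp _ _ (@setk_continuous _ _ k X 0)
    (@flat_continuous _ _ _ p _ _ _ _ _ _ FC (setk k X 0))).
have c' := c _ HB.
apply: filterS2 (near_normal DX) c' => s ss; apply.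
by apply: (flat_Om FC); exact: half_ball_setk.
Qed.

Lemma along_normal X (h : 'rV[R]_n -> R) (l : R) : D X ->
  h y @[y --> within Om (nbhs (T (setk k X 0)))] --> l ->
  h (T (setk k X s)) @[s --> 0^'+] --> l.
Proof. by move=> DX hl; exact: (cvg_comp _ _ (normal_curve DX) hl). Qed.

Lemma phi_vanishes X : D X -> phi (T (setk k X s)) @[s --> 0^'+] --> (0 : R).
Proof.
move=> DX; have [[[pc _ _] _ _] H0 _] := Hphi; have bX := flat_bdry FC DX.
have H := along_normal DX (within_closure_cvg pc (proj1 bX)).
by move: H; rewrite (proj1 (H0 _ bX)).
Qed.

Section AtPoint.
Variable X : 'rV[R]_n.
Hypothesis DX : D X.
Let P := T (setk k X 0).
Variables (A : 'I_n -> 'I_n -> 'I_n -> R) (g : 'I_n -> R).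
Hypothesis AE : forall l i j, pd_bar Om l (fun x => a x i j) P = A l i j.
Hypothesis gradE : forall i, pd_bar Om i phi P = g i.

Let bP : bdry Om P. Proof. exact: (flat_bdry FC DX). Qed.
Let cP : closure Om P. Proof. by case: bP. Qed.
#[local] Instance P_proper : ProperFilter (within Om (nbhs P)) := closure_proper cP.

Let aW i j : a y i j @[y --> within Om (nbhs P)] --> a P i j.
Proof. by apply: (@within_closure_cvg _ _ _ (fun y => a y i j)) => //; have [[]] := Ha i j. Qed.

Let daW l i j : pd l (fun x => a x i j) y @[y --> within Om (nbhs P)] --> A l i j.
Proof. by rewrite -AE; apply: pd_bar_lim => //; have [[_ _ +] _ _] := Ha i j; exact. Qed.

Let bW i : b y 0 i @[y --> within Om (nbhs P)] --> b P 0 i.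
Proof. by apply: (@within_closure_cvg _ _ _ (fun y => b y 0 i)) => //; have [] := Hb i. Qed.

Let small_lim (f : 'rV[R]_n -> R) (c l : R) :
  (forall Y, D Y -> `|f Y| <= c * Y 0 k ^+ 2) ->
  f (setk k X s) @[s --> 0^'+] --> l -> l = 0.
Proof.
move=> fc fl.
have c2 : c * (s * s) @[s --> (0 : R)^'+] --> c * (0 * 0).
  have c1' : s @[s --> (0 : R)^'+] --> (0 : R) by apply: cvg_at_right_filter; exact: cvg_id.
  exact: (cvgM (cvg_cst c) (cvgM c1' c1')).
have H : (`|f (setk k X s)| - c * (s * s)) @[s --> (0 : R)^'+] --> `|l| - c * (0 * 0).
  exact: (cvgB (cvg_norm fl) c2).
have := @cvgr_to_le _ _ (at_right_proper_filter (0 : R)) _ _ _ 0 H.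
rewrite mul0r mulr0 subr0 normr_le0 => h; apply/eqP; apply: h.
apply: filterS (near_normal DX) => s ss.
have := fc _ (half_ball_setk DX ss); rewrite setk_k expr2.
by rewrite subr_le0.
Qed.

Let phi_bar : C2_bar Om phi. Proof. by case: Hphi. Qed.
Let phi_C2 : C2_on Om phi. Proof. by case: phi_bar. Qed.

Let gW i : pd i phi y @[y --> within Om (nbhs P)] --> g i.
Proof. by rewrite -gradE; apply: pd_bar_lim => //; have [[_ _ +] _ _] := phi_bar; exact. Qed.

Let Nk s : N (setk k X s) = N X. Proof. exact: (Nor_setk FC). Qed.

(** The defining function vanishes on the boundary, so its gradient there is
    normal. *)
Lemma grad_normal : exists2 c : R, c != 0 & forall i, g i = c * N X 0 i.
Proof.
have [_ H0 _] := Hphi.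
have [_ gnz] := H0 P bP.
have sl l : l != k -> g l + sg * pd l Gam X * g k = 0.
  move=> lk.
  pose dG Y := pd l phi (T Y) + sg * pd l Gam Y * pd k phi (T Y).
  have [[phic _ d1] _ d2] := phi_bar.
  have bnd i : exists2 M : R, 0 <= M & forall y, Om y ->
      `|pd i phi y| <= M /\ `|pd k (pd i phi) y| <= M.
    have [M1 M10 H1] := extends_bounded bOm (d1 i).
    have [M2 M20 H2] := extends_bounded bOm (d2 i k).
    exists (M1 + M2); first exact: addr_ge0.
    move=> y Oy; split; [apply: le_trans (H1 y Oy) _|apply: le_trans (H2 y Oy) _].
      by rewrite lerDl.
    by rewrite lerDr.
  have vl i : exists c, vlip k rho c (fun Y => pd i phi (T Y)).
    have [M M0 HM] := bnd i; exists (2 * M).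
    by apply: (flat_vlip_gen FC oOm M0 (phi_C2.2 i)) => y Oy; have [] := HM y Oy.
  have [cl vl1] := vl l; have [ck vk1] := vl k.
  have sg1 : `|sg| <= 1 by rewrite (sg_norm FC).
  have [cM vdG] : exists c, vlip k rho c dG.
    by eexists; exact: (wlipD vl1 (wlipM (wlipZ sg1 (dGam_vlip FC l)) vk1)).
  have small Y : D Y -> `|dG Y| <= cM * Y 0 k ^+ 2.
    move=> DY.
    apply: (tangential_deriv_small (G := fun Y => phi (T Y)) (z := delta_mx 0 l) _ _ vdG _ _ DY).
    - move=> Z DZ; exact: (flat_deriv_el FC oOm lk phi_C2.1 DZ).
    - by rewrite mxE eqxx /= eq_sym (negbTE lk).
    - move=> Z DZ; have cl' := @line_cvg _ _ Z (delta_mx 0 l).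
      have cT := cvg_comp _ _ cl' (@flat_continuous _ _ _ p _ _ _ _ _ _ FC Z).
      have OT : Om (T Z) := flat_Om FC DZ.
      have cp i : pd i phi (T (Z + t *: delta_mx 0 l)) @[t --> (0 : R)] --> pd i phi (T Z).
        exact: (cvg_comp _ _ cT (phi_C2.1.2 i _ OT).2).
      have cG : pd l Gam (Z + t *: delta_mx 0 l) @[t --> (0 : R)] --> pd l Gam Z.
        exact: (cvg_comp _ _ cl' (((fc_C2 FC).2 l).1 Z I)).
      exact: (cvgD (cp l) (cvgM (cvgM (cvg_cst sg) cG) (cp k))).
    - by move=> Z DZ; exact: phi_vanishes.
  have lim1 : dG (setk k X s) @[s --> 0^'+] --> g l + sg * pd l Gam X * g k.
    rewrite /dG (_ : (fun s => _) = fun s => pd l phi (T (setk k X s)) +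
      sg * pd l Gam X * pd k phi (T (setk k X s))); last first.
      by apply/funext => s; rewrite (dGam_k FC).
    have gs i : pd i phi (T (setk k X s)) @[s --> (0 : R)^'+] --> g i := along_normal DX (@gW i).
    exact: (cvgD (gs l) (cvgM (cvg_cst (sg * pd l Gam X)) (gs k))).
  exact: small_lim small lim1.
pose c := sg * g k; have ss := fc_sg FC.
have gE i : g i = c * N X 0 i.
  have [->|ik] := eqVneq i k.
    by rewrite (Nor_k FC) /c mulrC mulrA ss mul1r.
  have -> : N X 0 i = - pd i Gam X by rewrite mxE (negbTE ik) mul0r sub0r.
  rewrite /c; move: (g i) (g k) (pd i Gam X) (sl i ik) => x y z H.
  by rewrite -[LHS]subr0 -H; ring.
exists c => //; apply: contra gnz => /eqP c0.
by apply/eqP/rowP => i; rewrite [LHS]mxE [RHS]mxE gradE gE c0 mul0r.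
Qed.


Let aS i j : a (T (setk k X s)) i j @[s --> (0 : R)^'+] --> a P i j.
Proof. exact: (along_normal DX (@aW i j)). Qed.

Let daS l i j : pd l (fun x => a x i j) (T (setk k X s)) @[s --> (0 : R)^'+] --> A l i j.
Proof. exact: (along_normal DX (@daW l i j)). Qed.

Let bS i : b (T (setk k X s)) 0 i @[s --> (0 : R)^'+] --> b P 0 i.
Proof. exact: (along_normal (h := fun x => b x 0 i) DX (@bW i)). Qed.

Let aP_sym : (a P)^T = a P.
Proof. by apply/matrixP => i j; rewrite mxE; exact: Hsym. Qed.

Let aP_psd z : 0 <= qf (a P) z.
Proof.
have H : qf (a (T (setk k X s))) z @[s --> (0 : R)^'+] --> qf (a P) z.
  rewrite /qf; apply: cvg_sum => i; apply: cvg_sum => j.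
  exact: (cvgM (cvgM (@aS i j) (cvg_cst _)) (cvg_cst _)).
apply: (@cvgr_to_ge _ _ (at_right_proper_filter (0 : R)) _ _ _ 0 H).
apply: filterS (near_normal DX) => s ss; apply: qf_ge0.
by apply: (flat_Om FC); exact: half_ball_setk.
Qed.

(** On the boundary the leading part is positive semidefinite and annihilates
    the gradient as a quadratic form, hence as a matrix. *)
Let aP_g i : \sum_j a P i j * g j = 0.
Proof.
have -> : \sum_j a P i j * g j = \sum_j a P i j * (\row_j g j) 0 j.
  by apply: eq_bigr => j _; rewrite mxE.
apply: (psd_null aP_sym aP_psd); rewrite -(Hchar bP) /qf /char_form.
by apply: eq_bigr => l _; apply: eq_bigr => j _; rewrite !mxE !gradE; ring.
Qed.

Let aP_N i : \sum_j a P i j * N X 0 j = 0.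
Proof.
have [c c0 gE] := grad_normal.
apply: (mulfI c0); rewrite mulr0 -[RHS](aP_g i) mulr_sumr.
by apply: eq_bigr => j _; rewrite gE; ring.
Qed.

(** The gradient of [phi] is a nonzero multiple of [N], and [a P] annihilates
    it. *)
Lemma conor_tends j : conor p k sg Gam a j (setk k X s) @[s --> 0^'+] --> (0 : R).
Proof.
have z0 : \sum_i a P i j * N X 0 i = 0.
  by rewrite -[RHS](aP_N j); apply: eq_bigr => i _; rewrite (Hsym _ _ cP).
rewrite -[X in _ --> X]z0.
rewrite /conor (_ : (fun s => _) = fun s => \sum_i a (T (setk k X s)) i j * N X 0 i).
  apply: cvg_sum => i; exact: (cvgM (@aS i j) (cvg_cst _)).
by apply/funext => s; apply: eq_bigr => i _; rewrite -(Nk s).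
Qed.

Hypothesis conor_lim : forall Y j, D Y ->
  conor p k sg Gam a j (setk k Y s) @[s --> 0^'+] --> (0 : R).

Let V l := \sum_i \sum_j A l i j * N X 0 i * N X 0 j.
Let Q := sg * V k.

Lemma dann_tends : dann p k sg Gam a (setk k X s) @[s --> 0^'+] --> Q.
Proof.
rewrite /dann (_ : (fun s => _) = fun s => sg * (\sum_i \sum_j
  pd k (fun x => a x i j) (T (setk k X s)) * N X 0 i * N X 0 j)).
  apply: (cvgM (cvg_cst sg)); apply: cvg_sum => i; apply: cvg_sum => j.
  exact: (cvgM (cvgM (@daS k i j) (cvg_cst _)) (cvg_cst _)).
apply/funext => s; congr (_ * _); apply: eq_bigr => i _; apply: eq_bigr => j _.
by rewrite -(Nk s).
Qed.

(** The conormal vanishes along the boundary, and therefore so do its tangential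
    derivatives. *)
Let V_normal l : V l = N X 0 l * Q.
Proof.
have [->|lk] := eqVneq l k; first by rewrite (Nor_k FC) /Q mulrA (fc_sg FC) mul1r.
have L0 j : \sum_i ((A l i j + sg * pd l Gam X * A k i j) * N X 0 i
    - a P i j * pd l (pd i Gam) X) = 0.
  apply: (@small_lim (dconor p k sg Gam a l j) (@c_dconor R n Kc)).
    move=> Y DY; exact: (dconor_small FC oOm (rc_a RC) (rc_a0 RC) (rc_a1 RC) (rc_a2 RC) conor_lim j DY lk).
  rewrite /dconor (_ : (fun s => _) = fun s => \sum_i
     ((pd l (fun x => a x i j) (T (setk k X s)) + sg * pd l Gam X *
        pd k (fun x => a x i j) (T (setk k X s))) * N X 0 i
      - a (T (setk k X s)) i j * pd l (pd i Gam) X)).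
    apply: cvg_sum => i.
    have c1' := @daS l i j; have c2' := @daS k i j.
    have c3 := @aS i j.
    exact: (cvgB (cvgM (cvgD c1' (cvgM (cvg_cst _) c2')) (cvg_cst _)) (cvgM c3 (cvg_cst _))).
  apply/funext => s; apply: eq_bigr => i _.
  by rewrite -(Nk s) /daT /aT (dGam_k FC) (ddGam_k FC).
have : \sum_j (\sum_i ((A l i j + sg * pd l Gam X * A k i j) * N X 0 i
    - a P i j * pd l (pd i Gam) X)) * N X 0 j = 0.
  by rewrite big1 // => j _; rewrite L0 mul0r.
rewrite (_ : \sum_j _ = V l + sg * pd l Gam X * V k).
  have -> : N X 0 l = - pd l Gam X by rewrite mxE (negbTE lk) mul0r sub0r.
  by move=> H; rewrite /Q -[LHS]subr0 -H; ring.
under eq_bigr do rewrite mulr_suml.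
rewrite exchange_big /= /V mulr_sumr -big_split /=; apply: eq_bigr => i _.
have z0 : pd l (pd i Gam) X * \sum_j a P i j * N X 0 j = 0 by rewrite aP_N mulr0.
rewrite -[RHS]subr0 -[X in _ = _ - X]z0 !mulr_sumr -big_split -sumrB /=.
by apply: eq_bigr => j _; ring.
Qed.

(** [ann] is positive inside and equals [s ^+ 2 * dann] to leading order. *)
Let Q_ge0 : 0 <= Q.
Proof.
have c2 : 2 * @c_dann R n Kc * (s * s) @[s --> (0 : R)^'+] --> 2 * @c_dann R n Kc * (0 * 0).
  have c1' : s @[s --> (0 : R)^'+] --> (0 : R) by apply: cvg_at_right_filter; exact: cvg_id.
  exact: (cvgM (cvg_cst _) (cvgM c1' c1')).
have H : (dann p k sg Gam a (setk k X s) + 2 * @c_dann R n Kc * (s * s)) @[s --> (0 : R)^'+]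
    --> Q + 2 * @c_dann R n Kc * (0 * 0).
  exact: (cvgD dann_tends c2).
have := @cvgr_to_ge _ _ (at_right_proper_filter (0 : R)) _ _ _ 0 H.
rewrite mul0r mulr0 addr0; apply.
apply: filterS (near_normal DX) => s ss.
have DY := half_ball_setk DX ss; have [s0 _] := andP ss.
have := ann_small FC oOm (rc_a RC) (rc_a1 RC) (rc_a2 RC) conor_lim DY.
have : 0 <= ann p k sg Gam a (setk k X s).
  rewrite (_ : ann _ _ _ _ _ _ = qf (a (T (setk k X s))) (N (setk k X s))).
    by apply: qf_ge0; exact: (flat_Om FC).
  rewrite /ann /conor /qf exchange_big /=; apply: eq_bigr => j _.
  by rewrite mulr_suml.
rewrite setk_k ler_norml => a0 /andP[_ H1].
have s2 : 0 < s ^+ 2 by rewrite exprn_gt0.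
rewrite -(pmulr_rge0 _ s2).
apply: (le_trans a0); move: H1; rewrite -subr_ge0 => H1; rewrite -subr_ge0.
by apply: (le_trans H1); rewrite le_eqVlt; apply/orP; left; apply/eqP; ring.
Qed.

(** The terms with second derivatives of [phi] disappear in the limit because
    [a P] annihilates the gradient. *)
Let d_char l : pd_bar Om l (char_form Om a phi) P = \sum_i \sum_j A l i j * g i * g j.
Proof.
have [[_ _ _] _ d2] := phi_bar.
have hh i : exists h : R, pd l (pd i phi) y @[y --> within Om (nbhs P)] --> h.
  exact: extends_lim (d2 i l) cP.
have [h hW] := choice hh.
pose F y := \sum_i \sum_j (pd l (fun x => a x i j) y * pd i phi y * pd j phi y
   + a y i j * pd l (pd i phi) y * pd j phi y + a y i j * pd i phi y * pd l (pd j phi) y).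
have FE y : Om y -> pd l (char_form Om a phi) y = F y.
  move=> Oy; have near_Om : \forall z \near y, Om z by exact: open_nbhs_nbhs.
  pose e : 'rV[R]_n := delta_mx 0 l.
  have dv v : C1_on Om v -> is_derive y e v (pd l v y).
    by move=> v1; apply: derivableP; exact: (v1.2 l y Oy).1.
  have D1 i j : is_derive y e (fun y => a y i j * pd i phi y * pd j phi y)
     (pd l (fun x => a x i j) y * pd i phi y * pd j phi y
     + a y i j * pd l (pd i phi) y * pd j phi y + a y i j * pd i phi y * pd l (pd j phi) y).
    have da := dv _ (rc_a RC i j).1; have dp q := dv _ (phi_C2.2 q).
    apply: (is_derive_eq (is_deriveM (is_deriveM da (dp i)) (dp j))).
    have -> : ((fun y => a y i j) * pd i phi) y = a y i j * pd i phi y by [].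
    rewrite /GRing.scale /=; move: (pd l _ y) (pd l _ y) (pd l _ y) (pd i phi y) (pd j phi y).
    by move=> *; ring.
  have sumE (f : 'I_n -> 'rV[R]_n -> R) (d : 'I_n -> R) : (forall i, is_derive y e (f i) (d i)) ->
      is_derive y e (fun z => \sum_i f i z) (\sum_i d i).
    move=> fd; have := @is_derive_sum _ _ _ n f y e _ fd.
    rewrite (_ : \sum_(i < n) _ = (fun s => \sum_i f i s)) //.
    by apply/funext => s; rewrite fct_sumE.
  have [_ H] := sumE _ _ (fun i => sumE _ _ (D1 i)); rewrite /F -H.
  apply: near_eq_derive; apply: filterS near_Om => z Oz.
  apply: eq_bigr => i _; apply: eq_bigr => j _.
  by rewrite !(pd_bar_in _ oOm phi_C2.1).
have FW : F y @[y --> within Om (nbhs P)] --> \sum_i \sum_j (A l i j * g i * g j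
   + a P i j * h i * g j + a P i j * g i * h j).
  apply: cvg_sum => i; apply: cvg_sum => j; have cA := @daW l i j; have ca := @aW i j.
  exact: (cvgD (cvgD (cvgM (cvgM cA (@gW i)) (@gW j)) (cvgM (cvgM ca (@hW i)) (@gW j)))
    (cvgM (cvgM ca (@gW i)) (@hW j))).
have -> : \sum_i \sum_j A l i j * g i * g j = \sum_i \sum_j (A l i j * g i * g j
   + a P i j * h i * g j + a P i j * g i * h j).
  have z1 : \sum_i h i * \sum_j a P i j * g j = 0 by rewrite big1 // => i _; rewrite aP_g mulr0.
  have z2 : \sum_i \sum_j a P i j * g i * h j = 0.
    rewrite exchange_big /= big1 // => j _; rewrite -mulr_suml.
    under eq_bigr do rewrite (Hsym _ _ cP).
    by rewrite aP_g mul0r.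
  rewrite -[LHS]addr0 -[X in _ + X = _]z1 -[LHS]addr0 -[X in _ + X = _]z2 -!big_split /=; apply: eq_bigr => i _.
  rewrite mulr_sumr -!big_split /=; apply: eq_bigr => j _; ring.
apply: cvg_lim => //; apply: cvg_trans FW; apply: near_eq_cvg.
have W : within Om (nbhs P) Om by exact: withinT.
by apply: filterS W => y Oy; rewrite FE.
Qed.

(** With [grad phi = c *: N] the gradient of the characteristic form is
    [c ^+ 2 * Q *: N], and [N] has norm at least one. *)
Lemma dann_limit : exists2 q : R, c1 <= q &
  dann p k sg Gam a (setk k X s) @[s --> 0^'+] --> q.
Proof.
exists Q; last exact: dann_tends.
have [c c0 gc] := grad_normal.
have gB : grad_bar Om phi P = c *: N X by apply/rowP => i; rewrite [LHS]mxE gradE gc [RHS]mxE.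
have cB : grad_bar Om (char_form Om a phi) P = (c ^+ 2 * Q) *: N X.
  apply/rowP => l; rewrite [LHS]mxE d_char [RHS]mxE.
  transitivity (c ^+ 2 * V l); last by rewrite V_normal; ring.
  rewrite /V mulr_sumr; apply: eq_bigr => i _; rewrite mulr_sumr; apply: eq_bigr => j _.
  by rewrite !gc; ring.
have := Hc1 bP; rewrite gB cB !enormZ normrM (ger0_norm Q_ge0) normrX.
set e := enorm _; set d := `|c| => H.
have e1 : 1 <= e.
  apply: le_trans (coord_le_enorm _ k); rewrite (Nor_k FC) (sg_norm FC) //.
have d0 : 0 < d by rewrite normr_gt0.
have e0 : 0 < e by apply: lt_le_trans e1.
have : c1 * e <= Q.
  have w : 0 < d ^+ 2 * e by rewrite mulr_gt0 // exprn_gt0.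
  rewrite -(ler_pM2l w); apply: le_trans (le_trans H _); rewrite le_eqVlt; apply/orP; left; apply/eqP; ring.
by apply: le_trans; rewrite ler_peMr // ltW.
Qed.

(** The quotient [g_fun] does not change when the gradient of [phi] is replaced
    by [N], and for [N] its denominator is [Q]. *)
Lemma drift_limit : exists2 q : R, 0 <= q &
  (bN p k sg Gam b (setk k X s) - divN p k sg Gam a (setk k X s)) @[s --> 0^'+] --> q.
Proof.
pose B := \sum_i b P 0 i * N X 0 i; pose Dv := \sum_i \sum_j A j i j * N X 0 i.
exists (B - Dv); last first.
  apply: cvgB.
    rewrite /bN (_ : (fun s => _) = fun s => \sum_i b (T (setk k X s)) 0 i * N X 0 i).
      apply: cvg_sum => i; exact: (cvgM (@bS i) (cvg_cst _)).
    by apply/funext => s; apply: eq_bigr => i _; rewrite -(Nk s).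
  rewrite /divN (_ : (fun s => _) = fun s => \sum_i \sum_j
      pd j (fun x => a x i j) (T (setk k X s)) * N X 0 i).
    apply: cvg_sum => i; apply: cvg_sum => j.
    exact: (cvgM (@daS j i j) (cvg_cst _)).
  by apply/funext => s; apply: eq_bigr => i _; apply: eq_bigr => j _; rewrite -(Nk s).
have [q qc1 ql] := dann_limit.
have Q0 : 0 < Q.
  rewrite (_ : Q = q); first exact: lt_le_trans qc1.
  have PF := at_right_proper_filter (0 : R).
  exact: (cvg_unique (@Rhausdorff R) dann_tends ql).
have [c c0 gc] := grad_normal.
have gB : grad_bar Om phi P = c *: N X by apply/rowP => i; rewrite [LHS]mxE gradE gc [RHS]mxE.
have := Hg bP; rewrite /g_fun gB.
have -> : \sum_i b P 0 i * pd_bar Om i phi P -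
   \sum_i \sum_j pd_bar Om j (fun y => a y i j) P * pd_bar Om i phi P = c * (B - Dv).
  rewrite mulrBr /B /Dv !mulr_sumr; congr (_ - _); apply: eq_bigr => i _.
    by rewrite gradE gc; ring.
  by rewrite mulr_sumr; apply: eq_bigr => j _; rewrite gradE gc AE; ring.
have N0 : 0 < dotv (N X) (N X).
  rewrite lt_def dotv_ge0 andbT -enorm_sqr sqrf_eq0 gt_eqF //.
  by apply: lt_le_trans (coord_le_enorm _ k); rewrite (Nor_k FC) (sg_norm FC).
have -> : \sum_k0 \sum_i \sum_j pd_bar Om k0 (fun y => a y i j) P * pd_bar Om i phi P *
    pd_bar Om j phi P * (pd_bar Om k0 phi P / enorm (c *: N X) ^+ 2) = c * Q.
  rewrite enormZ exprMn real_normK ?num_real // enorm_sqr.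
  transitivity (\sum_l c ^+ 2 * V l * (c * N X 0 l / (c ^+ 2 * dotv (N X) (N X)))).
    apply: eq_bigr => l _; rewrite gradE gc; move: (c * N X 0 l / _) => w.
    rewrite /V mulr_sumr mulr_suml; apply: eq_bigr => i _.
    rewrite mulr_sumr mulr_suml; apply: eq_bigr => j _.
    by rewrite !gradE !gc AE; ring.
  transitivity (\sum_l (c * Q / dotv (N X) (N X)) * (N X 0 l * N X 0 l)).
    apply: eq_bigr => l _; rewrite V_normal; move: (dotv _ _) N0 (N X 0 l) (Q) => w w0 x y.
    by field; rewrite c0 gt_eqF.
  by rewrite -mulr_sumr -/(dotv (N X) (N X)) divfK // gt_eqF.
rewrite (_ : c * (B - Dv) / (c * Q) = (B - Dv) / Q); first by rewrite pmulr_lgt0 ?invr_gt0 // => /ltW.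
by move: (Q) Q0 => y y0; field; rewrite c0 gt_eqF.
Qed.

End AtPoint.

End BoundaryLimits.

(** * Ellipticity in the tangential directions *)

Section Spectral.
Import spectral sesquilinear.
Import complex.
Local Open Scope sesquilinear_scope.
Local Open Scope complex_scope.
Context {R : realType}.
Local Notation C := R[i].

Lemma char_poly_conj (F : comUnitRingType) n (P D : 'M[F]_n) : P \in unitmx ->
  char_poly (invmx P *m D *m P) = char_poly D.
Proof.
move=> uP; rewrite /char_poly.
have E : char_poly_mx (invmx P *m D *m P) =
    map_mx polyC (invmx P) *m char_poly_mx D *m map_mx polyC P.
  rewrite /char_poly_mx mulmxBr mulmxBl !map_mxM; congr (_ - _).
  by rewrite scalar_mxC -mulmxA -map_mxM mulVmx // map_mx1 mulmx1.
rewrite E !det_mulmx mulrAC -det_mulmx -map_mxM mulVmx // map_mx1 det1 mul1r.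
by [].
Qed.

(** A real symmetric matrix is diagonal in a complex orthonormal basis with
    rows [W1 i + 'i W2 i]; the real quadratic form only sees the sums of the
    squares of the real and imaginary components. *)
Lemma spectral_real n (A : 'M[R]_n) (lam : 'I_n -> R) : A^T = A -> eigenvalues A lam ->
  exists (W1 W2 : 'I_n -> 'rV[R]_n) (s : 'S_n),
  [/\ forall i, dotv (W1 i) (W1 i) + dotv (W2 i) (W2 i) = 1,
      forall z, dotv z z = \sum_i (dotv z (W1 i) ^+ 2 + dotv z (W2 i) ^+ 2) &
      forall z, qf A z = \sum_i lam (s i) * (dotv z (W1 i) ^+ 2 + dotv z (W2 i) ^+ 2)].
Proof.
move=> As eA; pose Ac : 'M[C]_n := map_mx (real_complex R) A.
have herm : Ac \is hermsymmx.
  apply/is_hermitianmxP; rewrite expr0 scale1r.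
  by apply/matrixP => i j; rewrite !mxE -{1}As mxE; exact: (esym (conjc_real _)).
have sE := orthomx_spectralP (hermitian_normalmx herm).
have sR := hermitian_spectral_diag_real herm.
set P := spectralmx Ac in sE; set sp := spectral_diag Ac in sE sR.
have uP : P \is unitarymx by exact: spectral_unitarymx.
have PV : invmx P = P^t* by exact: invmx_unitary.
have cp : char_poly Ac = \prod_i ('X - (sp 0 i)%:P).
  rewrite sE char_poly_conj ?spectral_unit // char_poly_trig.
    by apply: eq_bigr => i _; rewrite !mxE eqxx mulr1n.
  by apply/is_trig_mxP => i j ij; rewrite !mxE -val_eqE (ltn_eqF ij) mulr0n.
have cp2 : char_poly Ac = \prod_i ('X - ((lam i)%:C)%:P).
  rewrite -map_char_poly eA rmorph_prod; apply: eq_bigr => i _.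
  by rewrite /= map_polyXsubC.
have pe : perm_eq [tuple sp 0 i | i < n] [tuple (lam i)%:C | i < n].
  apply: prod_XsubC_eq; rewrite !big_map -!enumT !big_enum /= -cp -cp2 //.
have /tuple_permP[s sP] := pe.
have spE i : sp 0 i = (lam (s i))%:C.
  have := congr1 (fun t => nth 0 t i) sP.
  by rewrite -!tnth_nth !tnth_mktuple.
pose W1 i : 'rV[R]_n := \row_j complex.Re (P i j).
pose W2 i : 'rV[R]_n := \row_j complex.Im (P i j).
have PP : P *m P^t* = 1%:M by exact/unitarymxP.
have PP' : P^t* *m P = 1%:M by rewrite -PV mulVmx // spectral_unit.
have ReP (x y : C) (t : R) : complex.Re (x^* * t%:C * y) =
    t * (complex.Re x * complex.Re y + complex.Im x * complex.Im y).
  by case: x => x1 x2; case: y => y1 y2; simpc => /=; ring.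
have AE i j : A i j = \sum_l lam (s l) * (W1 l 0 i * W1 l 0 j + W2 l 0 i * W2 l 0 j).
  have : Ac i j = (P^t* *m diag_mx sp *m P) i j by rewrite -PV -sE.
  rewrite mul_mx_diag !mxE => /(congr1 (@complex.Re R)) /= ->.
  rewrite raddf_sum; apply: eq_bigr => l _.
  by rewrite !mxE spE /= -ReP.
have dE i j : (i == j)%:R = \sum_l (W1 l 0 i * W1 l 0 j + W2 l 0 i * W2 l 0 j) :> R.
  have := congr1 (fun M : 'M[C]_n => complex.Re (M i j)) PP'.
  rewrite !mxE raddf_sum => H; transitivity (complex.Re ((i == j)%:R : C)).
    by case: eqP.
  rewrite -H; apply: eq_bigr => l _.
  by rewrite !mxE /= -[RHS]mul1r -ReP mulr1.
have dec (c : 'I_n -> R) (z : 'rV[R]_n) : \sum_i \sum_j (\sum_l c l * (W1 l 0 i * W1 l 0 j + W2 l 0 i * W2 l 0 j))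
      * z 0 i * z 0 j = \sum_l c l * (dotv z (W1 l) ^+ 2 + dotv z (W2 l) ^+ 2).
  rewrite /dotv; under [RHS]eq_bigr do rewrite !expr2 !mulr_suml -big_split mulr_sumr /=.
  rewrite [RHS]exchange_big /=; apply: eq_bigr => i _.
  under [RHS]eq_bigr do rewrite !mulr_sumr -big_split mulr_sumr /=.
  rewrite [RHS]exchange_big /=; apply: eq_bigr => j _.
  by rewrite !mulr_suml; apply: eq_bigr => l _; ring.
exists W1, W2, s; split.
- move=> i; have := congr1 (fun M : 'M[C]_n => complex.Re (M i i)) PP.
  rewrite !mxE eqxx raddf_sum /= => <-; rewrite -big_split; apply: eq_bigr => l _.
  by rewrite !mxE; case: (P i l) => x y; simpc => /=; ring.
- move=> z; under [RHS]eq_bigr do rewrite -[_ + _]mul1r.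
  rewrite -dec; transitivity (qf 1%:M z).
    by rewrite qf_mx mulmx1 -[z]trmxK trmxK mxE; apply: eq_bigr => i _; rewrite !mxE.
  apply: eq_bigr => i _; apply: eq_bigr => j _; rewrite mxE dE.
  by under [in RHS]eq_bigr do rewrite mul1r.
- by move=> z; rewrite -dec; apply: eq_bigr => i _; apply: eq_bigr => j _; rewrite AE.
Qed.

End Spectral.

Section BlockEllipticity.
Context {R : realType} {n : nat}.

Lemma cauchy_schwarz_skip (k : 'I_n) (x y : 'rV[R]_n) :
  (dotv x y - x 0 k * y 0 k) ^+ 2 <=
    (dotv x x - x 0 k ^+ 2) * (dotv y y - y 0 k ^+ 2).
Proof.
pose pr (x : 'rV[R]_n) := x - x 0 k *: delta_mx 0 k.
have E x' y' : dotv (pr x') (pr y') = dotv x' y' - x' 0 k * y' 0 k.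
  rewrite /pr !(dotvDl, dotvDr, dotvNl, dotvNr, dotvZl, dotvZr) !dotv_delta.
  by rewrite !(dotvC (delta_mx 0 k)) !dotv_delta mxE !eqxx /=; ring.
by rewrite !expr2 -!E -expr2; exact: cauchy_schwarz.
Qed.

(** The eigenvector [w] of the eigenvalue that may degenerate is nearly parallel
    to any [N] on which the form is small, and so has a component along [e_k] as
    soon as [N] does. The form is then elliptic on the hyperplane orthogonal to
    [e_k]. *)
Lemma block_elliptic (A : 'M[R]_n) (lam : 'I_n -> R) (c0 B : R) (k : 'I_n) (N z : 'rV[R]_n) :
  A^T = A -> pos_def A -> eigenvalues A lam -> 0 < c0 ->
  (forall i : 'I_n, (i.+1 < n)%N -> c0 <= lam i) ->
  `|N 0 k| = 1 -> enorm N <= B -> qf A N <= c0 / 2 -> z 0 k = 0 ->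
  c0 / (8 * (2 * B + 1) ^+ 2) * dotv z z <= qf A z.
Proof.
move=> As pA eA c00 lamc Nk NB AN zk.
have B0 : 0 <= B by apply: le_trans NB; exact: enorm_ge0.
have lam0 i : 0 <= lam i.
  have : root (char_poly A) (lam i).
    by rewrite eA (bigD1 i) //= rootM root_XsubC eqxx.
  rewrite -eigenvalue_root_char => /eigenvalueP[v vA v0].
  have := pA v v0; rewrite vA -scalemxAl mxE => /ltW.
  have -> : (v *m v^T) 0 0 = dotv v v by rewrite mxE; apply: eq_bigr => j _; rewrite !mxE.
  rewrite pmulr_lge0 // lt_def dotv_ge0 andbT -enorm_sqr sqrf_eq0.
  by apply: contra v0 => /eqP v00; apply/eqP; exact: enorm_eq0.
have [W1 [W2 [s [W11 dE qE]]]] := spectral_real As eA.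
have n0 : (0 < n)%N by apply: leq_ltn_trans (ltn_ord k).
have lastP : (n.-1 < n)%N by rewrite prednK.
pose i0 := (s^-1)%g (Ordinal lastP).
have lam_i i : i != i0 -> c0 <= lam (s i).
  move=> ii; apply: lamc; rewrite ltn_neqAle ltn_ord andbT; apply: contra ii => /eqP e.
  by apply/eqP; rewrite /i0 -[i](permK s); congr (_ _); apply: val_inj => /=; exact: (congr1 predn e).
set w1 := W1 i0; set w2 := W2 i0.
have gap x : c0 * (dotv x x - (dotv x w1 ^+ 2 + dotv x w2 ^+ 2)) <= qf A x.
  pose F i := dotv x (W1 i) ^+ 2 + dotv x (W2 i) ^+ 2.
  have -> : dotv x x - (dotv x w1 ^+ 2 + dotv x w2 ^+ 2) = \sum_(i | i != i0) F i.
    by rewrite dE (bigD1 i0) //= [X in X - _]addrC addrK.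
  rewrite qE [leRHS](bigD1 i0) //= mulr_sumr -[leLHS]add0r.
  apply: lerD; first by rewrite mulr_ge0 // addr_ge0 // sqr_ge0.
  by apply: ler_sum => i ii; apply: ler_wpM2r (lam_i i ii); rewrite addr_ge0 // sqr_ge0.
have w11 : dotv w1 w1 + dotv w2 w2 = 1 := W11 i0.
have nk : N 0 k ^+ 2 = 1 by rewrite -real_normK ?num_real // Nk expr1n.
set a1 := w1 0 k; set a2 := w2 0 k.
have q1 := cauchy_schwarz_skip k w1 w1; have q2 := cauchy_schwarz_skip k w2 w2.
have NN : dotv N N <= B ^+ 2.
  by rewrite -enorm_sqr; apply: lerXn2r => //; rewrite nnegrE // enorm_ge0.
have part_ge0 (x : 'rV[R]_n) : 0 <= dotv x x - x 0 k ^+ 2.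
  rewrite subr_ge0 /dotv (bigD1 k) //= -expr2 lerDl; apply: sumr_ge0 => i _.
  by rewrite -expr2 sqr_ge0.
have p1 := part_ge0 w1; have p2 := part_ge0 w2; have pN := part_ge0 N.
have cN1 := cauchy_schwarz_skip k N w1; have cN2 := cauchy_schwarz_skip k N w2.
have cz1 := cauchy_schwarz_skip k z w1; have cz2 := cauchy_schwarz_skip k z w2.
have gN := gap N; have gz := gap z.
move: cN1 cN2 cz1 cz2 p1 p2 pN; rewrite zk !mul0r !subr0 expr0n subr0 nk -/a1 -/a2.
set b1 := dotv N w1 - _; set b2 := dotv N w2 - _.
move=> cN1 cN2 cz1 cz2 p1 p2 pN.
have z0 := dotv_ge0 z.
have a_le1 (x y : R) : x ^+ 2 + y ^+ 2 <= 1 -> `|x| <= 1.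
  move=> H; rewrite -(ler_pXn2r (ltn0Sn 1)) ?nnegrE // expr1n real_normK ?num_real //.
  have := sqr_ge0 y; lra.
have aw : a1 ^+ 2 + a2 ^+ 2 <= 1 by lra.
have A1 : `|a1| <= 1 := a_le1 _ _ aw.
have A2 : `|a2| <= 1 by apply: (a_le1 _ a1); rewrite addrC.
have b_le (b q : R) : b ^+ 2 <= (dotv N N - 1) * q -> 0 <= q -> q <= 1 -> `|b| <= B.
  move=> H q0 q1'; rewrite -(ler_pXn2r (ltn0Sn 1)) ?nnegrE // real_normK ?num_real //.
  apply: le_trans H _; have := ler_wpM2l pN q1'; lra.
have sa1 := sqr_ge0 a1; have sa2 := sqr_ge0 a2.
have B1 : `|b1| <= B by apply: b_le cN1 p1 _; lra.
have B2 : `|b2| <= B by apply: b_le cN2 p2 _; lra.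
pose S := `|a1| + `|a2|.
have cross : N 0 k * (b1 * a1) + N 0 k * (b2 * a2) <= B * S.
  rewrite /S mulrDr; apply: lerD; apply: le_trans (ler_norm _) _;
    by rewrite !normrM Nk mul1r; apply: ler_wpM2r.
have sq_le (x : R) : `|x| <= 1 -> x ^+ 2 <= `|x|.
  by move=> x1; rewrite -real_normK ?num_real // expr2 ler_piMr.
have S1 : a1 ^+ 2 + a2 ^+ 2 <= S by apply: lerD; exact: sq_le.
have sumb : b1 ^+ 2 + b2 ^+ 2 <= dotv N N - 1.
  have p12 : dotv w1 w1 - a1 ^+ 2 + (dotv w2 w2 - a2 ^+ 2) <= 1 by lra.
  have := ler_wpM2l pN p12; rewrite mulrDr; lra.
have half : dotv N N - (dotv N w1 ^+ 2 + dotv N w2 ^+ 2) <= 1 / 2.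
  rewrite -(ler_pM2l c00); apply: le_trans gN _; apply: le_trans AN _; lra.
have e1 : dotv N w1 ^+ 2 = b1 ^+ 2 + 2 * (N 0 k * (b1 * a1)) + a1 ^+ 2.
  have -> : dotv N w1 = b1 + N 0 k * a1 by rewrite /b1 subrK.
  by rewrite sqrrD exprMn nk; ring.
have e2 : dotv N w2 ^+ 2 = b2 ^+ 2 + 2 * (N 0 k * (b2 * a2)) + a2 ^+ 2.
  have -> : dotv N w2 = b2 + N 0 k * a2 by rewrite /b2 subrK.
  by rewrite sqrrD exprMn nk; ring.
have SB : 1 <= 2 * (2 * B + 1) * S.
  have -> : 2 * (2 * B + 1) * S = 4 * (B * S) + 2 * S by ring.
  move: half; rewrite e1 e2; lra.
have om : 1 <= 8 * (2 * B + 1) ^+ 2 * (a1 ^+ 2 + a2 ^+ 2).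
  have S2 : S ^+ 2 <= 2 * (a1 ^+ 2 + a2 ^+ 2).
    rewrite -[a1 ^+ 2]real_normK ?num_real // -[a2 ^+ 2]real_normK ?num_real // /S.
    have := sqr_ge0 (`|a1| - `|a2|); rewrite sqrrB sqrrD; lra.
  have : 1 ^+ 2 <= (2 * (2 * B + 1) * S) ^+ 2 by apply: lerXn2r => //; rewrite nnegrE; lra.
  rewrite expr1n exprMn => h; apply: le_trans h _.
  apply: le_trans (ler_wpM2l _ S2) _; first exact: sqr_ge0.
  by rewrite le_eqVlt; apply/orP; left; apply/eqP; ring.
have zgap : (a1 ^+ 2 + a2 ^+ 2) * dotv z z <= dotv z z - (dotv z w1 ^+ 2 + dotv z w2 ^+ 2).
  have -> : (a1 ^+ 2 + a2 ^+ 2) * dotv z z = dotv z z - dotv z z * (1 - a1 ^+ 2 - a2 ^+ 2) by ring.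
  rewrite -w11; lra.
apply: le_trans gz; rewrite -mulrA ler_pM2l //; apply: le_trans zgap; apply: ler_wpM2r => //.
have D0 : 0 < 8 * (2 * B + 1) ^+ 2 by rewrite mulr_gt0 // exprn_gt0 //; lra.
by rewrite -(ler_pM2l D0) mulfV ?gt_eqF.
Qed.

End BlockEllipticity.

(** * Supremum norms and changes of coordinates *)

Section Supnorm.
Context {R : realType}.

Lemma le_supnorm {T : Type} (A : set T) (h : T -> R) M x :
  (forall y, A y -> `|h y| <= M) -> A x -> `|h x| <= supnorm A h.
Proof.
move=> hM Ax; apply: ub_le_sup; last by exists x.
by exists M => _ [y Ay <-]; exact: hM.
Qed.

Lemma supnorm_le {T : Type} (A : set T) (h : T -> R) M : 0 <= M ->
  (forall y, A y -> `|h y| <= M) -> supnorm A h <= M.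
Proof.
move=> M0 hM; rewrite /supnorm.
have [->|/set0P ne] := eqVneq [set `|h x| | x in A] set0; first by rewrite sup0.
by apply: ge_sup => // _ [y Ay <-]; exact: hM.
Qed.

Lemma supnorm_ge0 {T : Type} (A : set T) (h : T -> R) M :
  (forall y, A y -> `|h y| <= M) -> 0 <= supnorm A h.
Proof.
move=> hM; have [/set0P[x Ax]|/negPn/eqP ->] := boolP (A != set0).
  by apply: le_trans (le_supnorm hM Ax).
by rewrite /supnorm image_set0 sup0.
Qed.

Lemma le_sum_one m (F : 'I_m -> R) i : (forall j, 0 <= F j) -> F i <= \sum_j F j.
Proof. by move=> F0; rewrite (bigD1 i) //= lerDl sumr_ge0. Qed.

Context {n : nat}.
Variables (A : set 'rV[R]_n) (v : 'rV[R]_n -> R) (M : R).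
Hypothesis v0 : forall y, A y -> `|v y| <= M.
Hypothesis v1 : forall i y, A y -> `|pd i v y| <= M.
Hypothesis v2 : forall i j y, A y -> `|pd j (pd i v) y| <= M.

Let s0 : 0 <= supnorm A v. Proof. exact: supnorm_ge0 v0. Qed.
Let s1 i : 0 <= supnorm A (pd i v). Proof. exact: supnorm_ge0 (v1 i). Qed.
Let s2 i j : 0 <= supnorm A (pd j (pd i v)). Proof. exact: supnorm_ge0 (v2 i j). Qed.

(** The bound [M] makes the suprema finite; otherwise they would be zero. *)
Lemma C1norm_bounds y : A y -> `|v y| <= C1norm A v /\ forall i, `|pd i v y| <= C1norm A v.
Proof.
move=> Ay; split=> [|i].
  by apply: le_trans (le_supnorm v0 Ay) _; rewrite /C1norm lerDl sumr_ge0.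
apply: le_trans (le_supnorm (v1 i) Ay) _; apply: le_trans (le_sum_one i s1) _.
by rewrite /C1norm lerDr.
Qed.

Lemma C2norm_bounds y : A y -> [/\ `|v y| <= C2norm A v,
  forall i, `|pd i v y| <= C2norm A v & forall i j, `|pd j (pd i v) y| <= C2norm A v].
Proof.
move=> Ay; have [h0 h1] := C1norm_bounds Ay.
have S2 : 0 <= \sum_(i < n) \sum_(j < n) supnorm A (pd j (pd i v)).
  by apply: sumr_ge0 => i _; exact: sumr_ge0.
split=> [|i|i j]; [apply: le_trans h0 _|apply: le_trans (h1 i) _|].
- by rewrite lerDl.
- by rewrite lerDl.
apply: le_trans (le_supnorm (v2 i j) Ay) _.
have c0 : 0 <= C1norm A v by rewrite addr_ge0 // sumr_ge0.
apply: (@le_trans _ _ (\sum_(l < n) supnorm A (pd l (pd i v)))).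
  exact: (le_sum_one j (s2 i)).
apply: (@le_trans _ _ (\sum_(i < n) \sum_(l < n) supnorm A (pd l (pd i v)))).
  by apply: (le_sum_one i (F := fun i => \sum_(l < n) supnorm A (pd l (pd i v)))) => l; exact: sumr_ge0.
by rewrite /C2norm lerDr.
Qed.

Lemma C2norm_le : 0 <= M -> C2norm A v <= (1 + n%:R + n%:R ^+ 2) * M.
Proof.
move=> M0; rewrite !mulrDl mul1r; apply: lerD; first (apply: lerD).
- exact: supnorm_le.
- rewrite -[X in X%:R]card_ord mulr_natl -sumr_const; apply: ler_sum => i _; exact: supnorm_le (v1 i).
rewrite expr2 -mulrA -[X in X%:R * _]card_ord [X in _ <= X]mulr_natl -sumr_const; apply: ler_sum => i _.
rewrite -[X in X%:R]card_ord mulr_natl -sumr_const; apply: ler_sum => j _; exact: supnorm_le (v2 i j).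
Qed.

End Supnorm.

(** Maps that send each coordinate direction to a coordinate direction or to
    zero, such as translations and the projection that forgets a coordinate. *)
Section AffineChange.
Context {R : realType} {m q : nat}.
Variables (L : 'rV[R]_m -> 'rV[R]_q) (o : 'I_m -> option 'I_q).
Hypothesis Lc : continuous L.
Hypothesis Lo : forall i h x, L (h *: delta_mx 0 i + x) =
  (if o i is Some j then h *: delta_mx 0 j else 0) + L x.
Implicit Types (v : 'rV[R]_q -> R) (c : R).

Let quot v c i x : (fun h : R => h^-1 *: (((fun x => v (L x) + c) \o shift x) (h *: delta_mx 0 i) - (v (L x) + c)))
  = (fun h : R => if o i is Some j then h^-1 *: ((v \o shift (L x)) (h *: delta_mx 0 j) - v (L x)) else 0).
Proof.
apply/funext => h /=; rewrite Lo; case: (o i) => [j|] /=; first by rewrite opprD addrACA subrr addr0.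
by rewrite add0r subrr; exact: scaler0.
Qed.

Lemma pd_affine v c i x :
  pd i (fun x => v (L x) + c) x = if o i is Some j then pd j v (L x) else 0.
Proof.
rewrite /pd /derive quot; case: (o i) => [j|] //.
by apply: cvg_lim => //; exact: cvg_cst.
Qed.

Lemma C1_affine v c : C1_on setT v -> C1_on setT (fun x => v (L x) + c).
Proof.
move=> [vc vd]; split=> [x _|i x _].
  apply: continuousD; last exact: cst_continuous.
  by apply: continuous_comp; [exact: Lc|exact: vc].
split.
  rewrite /derivable quot; case: (o i) => [j|]; first exact: (vd j _ I).1.
  exact: is_cvg_cst.
rewrite (_ : pd i _ = fun x => if o i is Some j then pd j v (L x) else 0); last first.
  by apply/funext => y; exact: pd_affine.
case: (o i) => [j|]; last exact: cst_continuous.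
by apply: continuous_comp; [exact: Lc|exact: (vd j _ I).2].
Qed.

Lemma pd2_affine v c i j x : pd j (pd i (fun x => v (L x) + c)) x =
  if (o i, o j) is (Some i', Some j') then pd j' (pd i' v) (L x) else 0.
Proof.
rewrite (_ : pd i _ = fun x => if o i is Some j then pd j v (L x) else 0); last first.
  by apply/funext => y; exact: pd_affine.
case: (o i) => [i'|]; last exact: derive_cst.
have := pd_affine (pd i' v) 0 j x.
by rewrite (_ : (fun x => _ + 0) = fun x => pd i' v (L x)) //; apply/funext => y; rewrite addr0.
Qed.

Lemma C2_affine v c : C2_on setT v -> C2_on setT (fun x => v (L x) + c).
Proof.
move=> [v1 v2]; split; first exact: C1_affine.
move=> i; rewrite (_ : pd i _ = fun x => (if o i is Some j then pd j v else cst 0) (L x) + 0).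
  apply: C1_affine; case: (o i) => [j|]; first exact: v2.
  split=> [x _|j x _]; first exact: cst_continuous.
  split; first exact: derivable_cst.
  rewrite (_ : pd j _ = cst 0); first exact: cst_continuous.
  by apply/funext => y; exact: derive_cst.
by apply/funext => y; rewrite pd_affine addr0; case: (o i).
Qed.

End AffineChange.

(** * Uniform charts *)

Section Bounds.
Context {R : realType} {n : nat}.
Implicit Types (Om A : set 'rV[R]_n) (v : 'rV[R]_n -> R).

Lemma common_bound m (A : set 'rV[R]_n) (F : 'I_m -> 'rV[R]_n -> R) :
  (forall i, exists2 M : R, 0 <= M & forall y, A y -> `|F i y| <= M) ->
  exists2 M : R, 0 <= M & forall i y, A y -> `|F i y| <= M.
Proof.
move=> H.
have /choice[M HM] : forall i, exists M, 0 <= M /\ forall y, A y -> `|F i y| <= M.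
  by move=> i; have [M] := H i; exists M.
exists (\sum_i M i) => [|i y Ay]; first by apply: sumr_ge0 => i _; have [] := HM i.
apply: le_trans ((HM i).2 y Ay) _; apply: le_sum_one => j; exact: (HM j).1.
Qed.

Lemma C2_bounded Om v : bounded_set Om -> extends_cont Om v ->
  (forall i, extends_cont Om (pd i v)) -> (forall i j, extends_cont Om (pd j (pd i v))) ->
  exists2 M : R, 0 <= M & forall y, Om y -> [/\ `|v y| <= M,
    forall i, `|pd i v y| <= M & forall i j, `|pd j (pd i v) y| <= M].
Proof.
move=> bO e0 e1 e2.
have [M0 m0 H0] := extends_bounded bO e0.
have [M1 m1 H1] := common_bound (fun i => extends_bounded bO (e1 i)).
have /choice[M2 H2] : forall i, exists M, 0 <= M /\ forall j y, Om y -> `|pd j (pd i v) y| <= M.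
  by move=> i; have [M] := common_bound (fun j => extends_bounded bO (e2 i j)); exists M.
have S0 : 0 <= \sum_i M2 i by apply: sumr_ge0 => i _; exact: (H2 i).1.
exists (M0 + M1 + \sum_i M2 i); first by rewrite !addr_ge0.
move=> y Oy; split=> [|i|i j].
- by apply: le_trans (H0 y Oy) _; rewrite -addrA lerDl addr_ge0.
- by apply: le_trans (H1 i y Oy) _; rewrite addrAC lerDr addr_ge0.
apply: le_trans ((H2 i).2 j y Oy) _; apply: (@le_trans _ _ (\sum_i M2 i)); last by rewrite lerDr addr_ge0.
by apply: le_sum_one => l; exact: (H2 l).1.
Qed.

Lemma ball_bounded v (r : R) : C2_on setT v ->
  exists2 M : R, 0 <= M & forall y, enorm y < r -> [/\ `|v y| <= M,
    forall i, `|pd i v y| <= M & forall i j, `|pd j (pd i v) y| <= M].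
Proof.
move=> [[vc vd] v2].
have ext (f : 'rV[R]_n -> R) : continuous f -> extends_cont [set y | enorm y < r] f.
  by move=> fc; exists f => //; exact: continuous_subspaceT.
have bb : bounded_set [set y : 'rV[R]_n | enorm y < r].
  exists r; split; first exact: num_real.
  move=> M rM y /= yr; apply: le_trans (norm_le_enorm y) _; exact/ltW/(lt_trans yr).
apply: (C2_bounded bb); first by apply: ext => x; exact: vc.
- by move=> i; apply: ext => x; exact: (vd i x I).2.
- by move=> i j; apply: ext => x; exact: ((v2 i).2 j x I).2.
Qed.

End Bounds.

Section Charts.
Context {R : realType} {n : nat}.
Implicit Types (Om : set 'rV[R]_n) (p q x y : 'rV[R]_n).

Lemma col'_continuous (k : 'I_n) : continuous (col' k : 'rV[R]_n -> 'rV[R]_(n.-1)).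
Proof.
move=> x; apply/(@cvgrPdist_le _ _ _ (nbhs x)) => e e0.
have : {for x, continuous (fun y : 'rV[R]_n => y)} by exact: cvg_id.
move=> /(@cvgrPdist_le _ _ _ (nbhs x)) /(_ _ e0); apply: filterS => y H.
apply: norm_le_coord; first exact: ltW.
move=> j; apply: le_trans H; apply: le_trans (coord_le_norm _ (lift k j)).
by rewrite !mxE.
Qed.

Lemma col'_affine (k i : 'I_n) (h : R) x : col' k (h *: delta_mx 0 i + x) =
  (if unlift k i is Some j then h *: delta_mx 0 j else 0) + col' k x.
Proof.
apply/rowP => j; rewrite !mxE; case: unliftP => [l ->|->].
  by rewrite !mxE (inj_eq (@lift_inj _ k)).
by rewrite !mxE eq_sym (negbTE (neq_lift k j)) mulr0 .
Qed.

Lemma enorm_col' (k : 'I_n) x : enorm (col' k x) <= enorm x.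
Proof.
rewrite !enormE ler_wsqrtr // /dotv [leRHS](@bigD1_ord _ _ _ _ k) //=.
under eq_bigr do rewrite !mxE.
by rewrite lerDr -expr2 sqr_ge0.
Qed.

Lemma near_enorm p (e : R) : 0 < e -> \forall q \near p, enorm (q - p) < e.
Proof.
move=> e0; have d0 : 0 < e / n.+1%:R by rewrite divr_gt0.
apply: filterS (nbhsx_ballx p _ d0) => q; rewrite -ball_normE /ball_ /= distrC => qp.
apply: le_lt_trans (enorm_le_norm _) _.
move: qp; rewrite ltr_pdivlMr // mulrC => qp; apply: le_lt_trans qp.
by apply: ler_wpM2r => //; rewrite ler_nat.
Qed.

(** A chart at [p] serves, after translation, at all boundary points near [p]. *)
Lemma chart_translate Om p (r K : R) : 0 < r -> C2_chart Om p r K ->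
  exists2 K1 : R, 0 < K1 & forall q, enorm (q - p) < r / 2 -> forall K', K1 <= K' ->
    C2_chart Om q K'^-1 K'.
Proof.
move=> r0 [k [b [gam [gC _ gOm]]]].
have [M M0 HM] := ball_bounded r gC.
pose c0 := 1 + (n.-1)%:R + (n.-1)%:R ^+ 2 : R.
have c00 : 0 < c0 by rewrite /c0; have := sqr_ge0 ((n.-1)%:R : R); have : 0 <= (n.-1)%:R :> R by []; lra.
exists (2 / r + c0 * (M + r)).
  by rewrite ltr_pwDl ?divr_gt0 // mulr_ge0 ?(ltW c00) // addr_ge0 // ltW.
move=> q qp K' HK.
have K0 : 2 / r <= K' by apply: le_trans HK; rewrite lerDl mulr_ge0 ?(ltW c00) // addr_ge0 // ltW.
have K1 : c0 * (M + r) <= K' by apply: le_trans HK; rewrite lerDr divr_ge0 // ltW.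
have Kr : K'^-1 <= r / 2.
  have t0 : 0 < 2 / r by rewrite divr_gt0.
  by rewrite -[r / 2]invrK lef_pV2 ?posrE ?invr_gt0 ?divr_gt0 ?invf_div // (lt_le_trans t0).
pose w := q - p; pose L (z : 'rV[R]_(n.-1)) := z + col' k w.
pose c := - ((-1) ^+ b * w 0 k).
have Lc : continuous L by move=> z; exact: (cvgD cvg_id (cvg_cst (col' k w))).
have Lo i (h : R) z : L (h *: delta_mx 0 i + z) =
    (if Some i is Some j then h *: delta_mx 0 j else 0) + L z by rewrite /L addrA.
exists k, b, (fun z => gam (L z) + c); split.
- exact: (C2_affine (o := Some) Lc Lo c gC).
- have LM z : enorm z < K'^-1 -> enorm (L z) < r.
    move=> zK; apply: le_lt_trans (enormD _ _) _.
    have := enorm_col' k w; move: (lt_le_trans zK Kr) qp; rewrite -/w; lra.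
  have cr : `|c| <= r.
    rewrite /c normrN normrM normrX normrN1 expr1n mul1r; apply: le_trans (coord_le_enorm _ _) _.
    move: qp; rewrite -/w; lra.
  have Mr : M <= M + r by rewrite lerDl ltW.
  apply: le_trans K1; apply: (@C2norm_le _ _ _ _ (M + r)); last by rewrite addr_ge0 // ltW.
  - move=> z zK; have [h0 _ _] := HM _ (LM z zK).
    by apply: le_trans (ler_normD _ _) _; exact: lerD.
  - move=> i z zK; have [_ h1 _] := HM _ (LM z zK).
    by rewrite (pd_affine (o := Some) Lo); apply: le_trans Mr.
  - move=> i j z zK; have [_ _ h2] := HM _ (LM z zK).
    by rewrite (pd2_affine (o := Some) Lo); apply: le_trans Mr.
- move=> y yK; have yr : enorm (y + w) < r.
  apply: le_lt_trans (enormD _ _) _; move: (lt_le_trans yK Kr) qp; rewrite -/w; lra.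
have -> : q + y = p + (y + w) by apply/rowP => i; rewrite !mxE; ring.
have := gOm _ yr; rewrite /L /c.
have -> : col' k (y + w) = col' k y + col' k w by apply/rowP => i; rewrite !mxE.
by rewrite mxE mulrDr ltrBlDr.
Qed.

Lemma bdry_compact Om : open Om -> bounded_set Om -> compact (bdry Om).
Proof.
move=> oOm bOm; apply: (subclosed_compact _ (closure_compact bOm)); last by move=> x [].
by apply: closedI; [exact: closed_closure|exact: open_closedC].
Qed.

(** Charts are available near every boundary point for all large [K], and the
    boundary is compact. *)
Lemma uniform_chart Om : open Om -> bounded_set Om -> C2_boundary Om ->
  exists2 K : R, 0 < K & forall p, bdry Om p -> C2_chart Om p K^-1 K.
Proof.
move=> oOm bOm CB.
have /compact_near_coveringP nc := bdry_compact oOm bOm.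
have H : \forall K \near +oo, bdry Om `<=` (fun p => C2_chart Om p K^-1 K).
  apply: (nc R (pinfty_nbhs R) (fun K p => C2_chart Om p K^-1 K)) => p bp.
  have [r [K0 [r0 ch]]] := CB p bp; have [K1 K10 HK] := chart_translate r0 ch.
  have nq : \forall q \near p, enorm (q - p) < r / 2 by apply: near_enorm; rewrite divr_gt0.
  exists ([set q | enorm (q - p) < r / 2], [set K | K1 <= K]) => /=.
    by split; [exact: nq|exact: (nbhs_pinfty_ge (num_real K1))].
  by move=> [q K] [/= qp KK]; exact: HK.
have [K [KH K0]] := filter_ex (filterI H (nbhs_pinfty_gt (num_real (0 : R)))).
by exists K.
Qed.

(** The infimum that defines [bdry_C2norm] is over a nonempty set by
    [uniform_chart], hence is nearly attained. *)
Lemma chart_of_norm Om (Kd : R) : open Om -> bounded_set Om -> C2_boundary Om ->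
  bdry_C2norm Om <= Kd ->
  exists K : R, [/\ 0 < K, K <= Kd + 1 & forall p, bdry Om p -> C2_chart Om p K^-1 K].
Proof.
move=> oOm bOm CB HK; have [K0 K00 HK0] := uniform_chart oOm bOm CB.
have : bdry_C2norm Om < Kd + 1 by apply: le_lt_trans HK _; rewrite ltrDl.
move=> /(inf_lt (ex_intro _ K0 (conj K00 HK0)))[K [K1 K2] K3].
by exists K; split => //; exact: ltW.
Qed.

(** The graph passes through the centre of the chart, because this point is in
    the closure of the domain but not in the domain. *)
Lemma flat_chart_of_chart Om p (K Kc rho : R) : bdry Om p -> 0 < K -> C2_chart Om p K^-1 K ->
  K <= Kc -> 1 <= Kc -> 0 < rho -> rho <= 1 -> (2 * n%:R + 1) * Kc * rho < Kc^-1 ->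
  exists k sg Gam, flat_chart Om p k sg Kc^-1 rho Kc Gam.
Proof.
move=> [cp nOp] K0 [k [b [gam [gC gK gOm]]]] KK K1 rho0 rho1 rhor.
have Kc0 : 0 < Kc by lra.
have rr : Kc^-1 <= K^-1 by rewrite lef_pV2 ?posrE.
have [M M0 HM] := ball_bounded K^-1 gC.
have gb z : enorm z < Kc^-1 -> [/\ forall i, `|pd i gam z| <= Kc &
    forall i j, `|pd j (pd i gam) z| <= Kc].
  move=> zr; have zA : [set z | enorm z < K^-1] z by exact: lt_le_trans zr rr.
  have [|||_ h1 h2] := @C2norm_bounds _ _ [set z | enorm z < K^-1] gam M _ _ _ z zA.
  - by move=> y yK; have [] := HM y yK.
  - by move=> l y yK; have [] := HM y yK.
  - by move=> l l' y yK; have [] := HM y yK.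
  by split=> [i|i j]; apply: le_trans KK; apply: le_trans gK.
pose L := (col' k : 'rV[R]_n -> 'rV[R]_(n.-1)).
have Lc : continuous L := @col'_continuous k.
have Lo i h x := col'_affine k i h x.
have Lr X : enorm X < Kc^-1 -> enorm (L X) < Kc^-1 by apply: le_lt_trans; exact: enorm_col'.
have GE : (fun X => gam (L X)) = fun X => gam (L X) + 0 by apply/funext => X; rewrite addr0.
have n0 : (0 < n)%N by apply: leq_ltn_trans (ltn_ord k).
exists k, ((-1) ^+ b), (fun X => gam (L X)); split => //.
- by rewrite -expr2 sqrr_sign.
- by rewrite GE; exact: (C2_affine (o := unlift k) Lc Lo 0 gC).
- move=> X t; congr gam; rewrite addrC /L Lo; case: unliftP => [l kl|_]; last by rewrite add0r.
  by have := neq_lift k l; rewrite -kl eqxx.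
- have g0 : 0 <= gam (L 0).
    have := gOm 0; rewrite addr0 enorm0 mxE mulr0 => /(_ _) H.
    rewrite leNgt; apply/negP => h; apply: nOp; apply/H => //; by rewrite invr_gt0.
  apply/eqP; rewrite eq_le g0 andbT.
  have PF := closure_proper cp.
  pose F y := gam (L (y - p)) - (-1) ^+ b * (y - p) 0 k.
  have Fc : F y @[y --> within Om (nbhs p)] --> F p.
    apply: cvg_trans (_ : F y @[y --> nbhs p] --> F p); first by apply: cvg_app; exact: cvg_within.
    have cs : {for p, continuous (fun y : 'rV[R]_n => y - p)} by exact: (cvgB cvg_id (cvg_cst p)).
    have ck : {for p, continuous (fun y : 'rV[R]_n => (y - p) 0 k)}.
      have c2 : {for p - p, continuous (fun z : 'rV[R]_n => z 0 k)} by exact: coord_continuous.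
      exact: (cvg_comp _ _ cs c2).
    have cg : {for p, continuous (fun y : 'rV[R]_n => gam (L (y - p)))}.
      have c2 := @Lc (p - p); have c3 := gC.1.1 (L (p - p)) I.
      exact: (cvg_comp _ _ (cvg_comp _ _ cs c2) c3).
    exact: (cvgB cg (cvgM (cvg_cst _) ck)).
  have : F p <= 0.
    apply: (@cvgr_to_le _ _ PF _ _ _ 0 Fc).
    have nb : \forall y \near p, enorm (y - p) < K^-1 by apply: near_enorm; rewrite invr_gt0.
    have W : within Om (nbhs p) Om by exact: withinT.
    have nb' : within Om (nbhs p) [set y | enorm (y - p) < K^-1] .
      by apply: filterS nb => y yK _.
    apply: filterS2 nb' W => y yK Oy; have := gOm _ yK; rewrite subrKC => -[h _].
    by rewrite subr_le0 ltW // h.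
  by rewrite /F subrr mxE mulr0 subr0.
- move=> X i Xr; rewrite GE (pd_affine (o := unlift k) Lo); case: unlift => [j|]; last by rewrite normr0 ltW.
  by have [h _] := gb _ (Lr X Xr).
- move=> X i j Xr; rewrite GE (pd2_affine (o := unlift k) Lo).
  case: (unlift k i) => [i'|]; case: (unlift k j) => [j'|]; rewrite ?normr0 ?(ltW Kc0) //.
  by have [_ h] := gb _ (Lr X Xr).
- by move=> y yr; apply: gOm; exact: lt_le_trans yr rr.
Qed.

End Charts.

(** * Choice of the constants *)

Section Constants.
Context {R : realType}.
Variable n : nat.

(** Bounds the norm of [Nor], whose components are bounded by [c_basic]. *)
Definition normal_bound (Kc : R) : R := n%:R * @c_basic R n Kc.
(** The constant of [block_elliptic] for the normal [Nor]. *)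
Definition block_const (c0 Kc : R) : R := c0 / (8 * (2 * normal_bound Kc + 1) ^+ 2).

Lemma c_total_ge (Kc : R) : 0 <= Kc -> 0 <= @c_dann R n Kc <= c_total n Kc.
Proof.
move=> K0.
have cb0 : 0 <= @c_basic R n Kc by rewrite /c_basic !(mulr_ge0, addr_ge0).
have h1 : 0 <= @c_conor R n Kc by rewrite /c_conor !(mulr_ge0, addr_ge0).
have h2 : 0 <= @c_dann R n Kc by rewrite /c_dann !(mulr_ge0, addr_ge0).
have h3 : 0 <= @c_divN R n Kc by rewrite /c_divN !(mulr_ge0, addr_ge0).
have h4 : 0 <= @c_dconor R n Kc by rewrite /c_dconor !(mulr_ge0, addr_ge0).
rewrite h2 /= /c_total -[leLHS]mul1r; apply: ler_pM => //; first by rewrite ler1n.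
move: h1 h2 h3 h4 cb0; lra.
Qed.

(** All error terms are multiples of [c_total n Kc * rho'], so that [rho'] is
    chosen after the ellipticity constant [lam], and [C] at the end. *)
Lemma local_constants (c0 c1 Ka Kb Kd Ku Kf : R) : 0 < c0 -> 0 < c1 ->
  exists Kc rho rho' lam eps M C : R, let K := c_total n Kc in
  [/\ [/\ 1 <= Kc, Ka <= Kc, Kb <= Kc & Kd + 1 <= Kc],
      [/\ 0 < rho, rho <= 1 & (2 * n%:R + 1) * Kc * rho < Kc^-1],
      [/\ 0 < lam, 0 <= eps, 0 < rho', rho' < rho & 3 * K * rho' <= c0 / 2],
      [/\ 12 * lam <= c1, 3 * lam <= block_const c0 Kc, n%:R ^+ 2 * (4 * K * rho') <= eps &
          (4 * n%:R + 1) * eps + 4 * K * (n.+1%:R * rho') <= lam] &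
      [/\ Ku <= M * rho' ^+ 2, 0 <= M, 0 <= C &
          8 * (2 * Kf + 2 * K + M * (4 * K + 4 * lam + 8 * n%:R * eps + 4 * K * (n%:R + 2)))
            < lam * C]].
Proof.
move=> c00 c10.
pose Kc : R := 2 + `|Ka| + `|Kb| + `|Kd|.
have [na nb nd] : [/\ 0 <= `|Ka|, 0 <= `|Kb| & 0 <= `|Kd|] by [].
have [la lb ld] : [/\ Ka <= `|Ka|, Kb <= `|Kb| & Kd <= `|Kd|] by split; exact: ler_norm.
have Kc1 : 1 <= Kc by rewrite /Kc; lra.
have Kc0 : 0 < Kc by lra.
have /andP[d0 dK] := c_total_ge (ltW Kc0).
pose K := c_total n Kc; have K0 : 0 <= K := le_trans d0 dK.
have nn : 0 <= n%:R :> R by [].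
pose rho : R := ((2 * n%:R + 2) * Kc ^+ 2)^-1.
have D0 : 0 < (2 * n%:R + 2) * Kc ^+ 2 by rewrite mulr_gt0 ?exprn_gt0 //; lra.
have rho0 : 0 < rho by rewrite invr_gt0.
have B0 : 0 < 8 * (2 * normal_bound Kc + 1) ^+ 2.
  rewrite mulr_gt0 // exprn_gt0 // ltr_wpDl // mulr_ge0 // /normal_bound mulr_ge0 //.
  by rewrite /c_basic !(mulr_ge0, addr_ge0) // ltW.
have bc0 : 0 < block_const c0 Kc by rewrite divr_gt0.
pose lam := Num.min (block_const c0 Kc / 3) (c1 / 12).
have lam0 : 0 < lam by rewrite lt_min !divr_gt0.
have lam1 : lam <= block_const c0 Kc / 3 by rewrite ge_min lexx.
have lam2 : lam <= c1 / 12 by rewrite ge_min lexx orbT.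
pose W : R := (4 * n%:R + 1) * (4 * n%:R ^+ 2) + 4 * n.+1%:R + 3.
have W1 : 0 <= (4 * n%:R + 1) * (4 * n%:R ^+ 2) :> R.
  by rewrite !mulr_ge0 ?addr_ge0 ?mulr_ge0 ?exprn_ge0.
have W0 : 0 < W by rewrite /W ltr_wpDl // addr_ge0 // mulr_ge0.
pose m0 := Num.min lam (c0 / 2).
have m00 : 0 < m0 by rewrite lt_min lam0 divr_gt0.
pose rho' := Num.min (rho / 2) (m0 / (W * (K + 1))).
have K1 : 0 < K + 1 by rewrite ltr_wpDl.
have rp0 : 0 < rho' by rewrite lt_min !divr_gt0 // mulr_gt0.
have rp1 : rho' <= rho / 2 by rewrite ge_min lexx.
have rp2 : W * K * rho' <= m0.
  have : rho' <= m0 / (W * (K + 1)) by rewrite ge_min lexx orbT.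
  rewrite ler_pdivlMr ?mulr_gt0 // => h; apply: le_trans h.
  by rewrite mulrC; apply: ler_wpM2l; rewrite ?(ltW rp0) // ler_wpM2l ?(ltW W0) // lerDl.
have Kr0 : 0 <= K * rho' by rewrite mulr_ge0 // ltW.
have m1 : m0 <= lam by rewrite ge_min lexx.
have m2 : m0 <= c0 / 2 by rewrite ge_min lexx orbT.
pose eps := n%:R ^+ 2 * (4 * K * rho').
have eps0 : 0 <= eps by rewrite mulr_ge0 ?exprn_ge0 // -mulrA mulr_ge0.
have We : W * K * rho' = (4 * n%:R + 1) * eps + 4 * K * (n.+1%:R * rho') + 3 * K * rho'.
  by rewrite /W /eps; ring.
have e1 : 0 <= (4 * n%:R + 1) * eps by rewrite mulr_ge0 // addr_ge0 // mulr_ge0.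
have e2 : 0 <= 4 * K * (n.+1%:R * rho').
  by rewrite mulr_ge0 // mulr_ge0 // ltW.
have e3 : 0 <= 3 * K * rho' by rewrite -mulrA mulr_ge0.
pose M := `|Ku| / rho' ^+ 2.
pose Q := 8 * (2 * Kf + 2 * K + M * (4 * K + 4 * lam + 8 * n%:R * eps + 4 * K * (n%:R + 2))).
exists Kc, rho, rho', lam, eps, M, ((`|Q| + 1) / lam) => /=; split.
- by split => //; rewrite /Kc; lra.
- split => //.
    rewrite /rho invf_le1 // -[leLHS]mulr1; apply: ler_pM => //; first by lra.
    by rewrite expr_ge1 // ltW.
  rewrite /rho invfM mulrA; rewrite -[ltRHS]mul1r.
  have -> : (2 * n%:R + 1) * Kc * (2 * n%:R + 2)^-1 * (Kc ^+ 2)^-1 =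
      ((2 * n%:R + 1) / (2 * n%:R + 2)) * Kc^-1.
    by field; rewrite !gt_eqF //; lra.
  by rewrite ltr_pM2r ?invr_gt0 // ltr_pdivrMr ?mul1r; lra.
- by split => //; [lra|rewrite -/K; lra].
- split => //; [by lra|by lra|rewrite -/K; lra].
split.
- by rewrite /M divfK ?gt_eqF ?exprn_gt0 // ler_norm.
- by rewrite divr_ge0 // exprn_ge0 // ltW.
- by rewrite divr_ge0 ?addr_ge0 // ltW.
by rewrite [ltRHS]mulrC divfK ?gt_eqF // -/K -/Q (le_lt_trans (ler_norm _)) // ltrDl.
Qed.

End Constants.

(** * Oscillation of solutions at the boundary *)

Section Unflattening.
Context {R : realType} {n : nat}.
Variables (Om : set 'rV[R]_n) (p : 'rV[R]_n) (k : 'I_n) (sg r rho Kc : R).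
Variable Gam : 'rV[R]_n -> R.
Hypothesis FC : flat_chart Om p k sg r rho Kc Gam.

(** Distances of order [d] become distances of order [sqrt d] in the flat
    coordinates because the height is replaced by its square root. *)
Lemma unflatten x : Om x -> enorm (x - p) < r -> enorm (x - p) <= 1 ->
  exists X, [/\ flat p k sg Gam X = x, 0 < X 0 k &
    enorm X <= n%:R * Num.sqrt ((1 + n%:R * Kc) * enorm (x - p))].
Proof.
move=> Ox xr x1; set y := x - p; have ss := fc_sg FC; have K1 := fc_K FC.
have Gy : Gam y < sg * y 0 k by apply/(fc_Om FC) => //; rewrite /y subrKC.
pose h := sg * y 0 k - Gam y; have h0 : 0 < h by rewrite subr_gt0.
pose X := setk k y (Num.sqrt h).
have Xk : X 0 k = Num.sqrt h by rewrite /X setk_k.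
have GX : Gam X = Gam y by rewrite /X /setk (fc_indep FC).
exists X; split.
- apply/rowP => i; rewrite /flat [LHS]mxE [X in _ + X]mxE; have [->|ik] := eqVneq i k.
    have E : Gam y + h = sg * y 0 k by rewrite /h addrC subrK.
    by rewrite GX Xk sqr_sqrtr ?(ltW h0) // E mulrA ss mul1r /y !mxE; ring.
  by rewrite /X setk_neq // /y !mxE; ring.
- by rewrite Xk sqrtr_gt0.
have y0 := enorm_ge0 y.
have c1 : 1 <= 1 + n%:R * Kc by rewrite lerDl mulr_ge0 //; lra.
have hy : h <= (1 + n%:R * Kc) * enorm y.
  have := Gam_le FC xr; rewrite -/y ler_norml => /andP[g1 _].
  have : sg * y 0 k <= enorm y.
    by apply: le_trans (ler_norm _) _; rewrite normrM (sg_norm FC) mul1r coord_le_enorm.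
  rewrite /h; lra.
have yy : enorm y <= Num.sqrt ((1 + n%:R * Kc) * enorm y).
  rewrite -[leLHS]ger0_norm // -sqrtr_sqr ler_wsqrtr // expr2 ler_wpM2r //.
  exact: le_trans x1 c1.
apply: le_trans (enorm_le_sum _) _.
apply: (@le_trans _ _ (\sum_(i < n) Num.sqrt ((1 + n%:R * Kc) * enorm y))).
  apply: ler_sum => i _; have [->|ik] := eqVneq i k.
    by rewrite Xk ger0_norm ?sqrtr_ge0 // ler_wsqrtr.
  by rewrite /X setk_neq // (le_trans (coord_le_enorm _ _)).
by rewrite sumr_const card_ord -[leLHS]mulr_natl.
Qed.

End Unflattening.

Section BoundaryOscillation.
(** At this distance from a boundary point its chart is available and the flat
    coordinates are at most [rho']. *)
Definition osc_radius {R : realType} n (Kc rho' : R) : R :=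
  Num.min (Kc^-1 / 2) ((rho' / (n%:R * Num.sqrt (1 + n%:R * Kc) + 1)) ^+ 2).
Definition osc_const {R : realType} n (Kc M C : R) : R :=
  C * Num.sqrt (2 * (n%:R * Num.sqrt (1 + n%:R * Kc)))
  + 2 * M * (n%:R * Num.sqrt (1 + n%:R * Kc)) ^+ 2.

Context {R : realType} {n : nat}.
Variables (Kc rho rho' lam eps M C c0 c1 Ku Ka Kb Kd Kf : R).
Let K := @c_total R n Kc.
Hypotheses (c00 : 0 < c0) (c10 : 0 < c1).
Hypothesis H1 : [/\ 1 <= Kc, Ka <= Kc, Kb <= Kc & Kd + 1 <= Kc].
Hypothesis H2 : [/\ 0 < rho, rho <= 1 & (2 * n%:R + 1) * Kc * rho < Kc^-1].
Hypothesis H3 : [/\ 0 < lam, 0 <= eps, 0 < rho', rho' < rho & 3 * K * rho' <= c0 / 2].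
Hypothesis H4 : [/\ 12 * lam <= c1, 3 * lam <= @block_const R n c0 Kc, n%:R ^+ 2 * (4 * K * rho') <= eps &
          (4 * n%:R + 1) * eps + 4 * K * (n.+1%:R * rho') <= lam].
Hypothesis H5 : [/\ Ku <= M * rho' ^+ 2, 0 <= M, 0 <= C &
          8 * (2 * Kf + 2 * K + M * (4 * K + 4 * lam + 8 * n%:R * eps + 4 * K * (n%:R + 2)))
            < lam * C].
Variables (Om : set 'rV[R]_n) (phi : 'rV[R]_n -> R)
    (a : 'rV[R]_n -> 'M[R]_n) (b : 'rV[R]_n -> 'rV[R]_n) (m u F : 'rV[R]_n -> R).
Hypothesis dOm : bounded_domain Om.
Hypothesis CB : C2_boundary Om.
Hypothesis Hphi : defining_function Om phi.
Hypothesis Ha : forall i j, C2_bar Om (fun x => a x i j).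
Hypothesis Hsym : forall x i j, closure Om x -> a x i j = a x j i.
Hypothesis Hb : forall i, C1_bar Om (fun x => b x 0 i).
Hypothesis Hchar : forall x, bdry Om x -> char_form Om a phi x = 0.
Hypothesis Hell : forall x, Om x -> pos_def (a x) /\
     exists lam : 'I_n -> R, [/\ eigenvalues (a x) lam,
       forall i : 'I_n, (i.+1 < n)%N -> c0 <= lam i &
       forall i : 'I_n, i.+1 = n -> lam i = m x * phi x].
Hypothesis Hg : forall x, bdry Om x -> 0 < g_fun Om a b phi x.
Hypothesis u_C2 : C2_on Om u.
Hypothesis u_eq : forall x, Om x ->
     \sum_(i < n) \sum_(j < n) a x i j * pd j (pd i u) x
     + \sum_(i < n) b x 0 i * pd i u x + F x = 0.
Hypothesis u_osc : forall x y, Om x -> Om y -> u x - u y <= Ku.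
Hypothesis F_le : forall x, Om x -> `|F x| <= Kf.
Hypothesis Kf0 : 0 <= Kf.
Hypothesis HKa : forall i j, C2norm Om (fun x => a x i j) <= Ka.
Hypothesis HKb : forall i, C1norm Om (fun x => b x 0 i) <= Kb.
Hypothesis HKd : bdry_C2norm Om <= Kd.
Hypothesis Hc1 : forall x, bdry Om x ->
     c1 * enorm (grad_bar Om phi x) ^+ 2
       <= enorm (grad_bar Om (char_form Om a phi) x).

Implicit Types (X Y Z x y z : 'rV[R]_n).

Let oOm : open Om. Proof. by case: dOm. Qed.
Let bOm : bounded_set Om. Proof. by case: dOm. Qed.

(** The suprema in the norms are finite since the coefficients and their
    derivatives extend continuously to a compact set. *)
Lemma regular_coefs_of_norms : regular_coefs Om Kc a b.
Proof.
have [K1 KKa KKb _] := H1.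
have ba i j y : Om y -> [/\ `|a y i j| <= Kc, forall l, `|pd l (fun x => a x i j) y| <= Kc &
    forall l l', `|pd l' (pd l (fun x => a x i j)) y| <= Kc].
  move=> Oy; have [[vc _ d1] _ d2] := Ha i j.
  have e0 : extends_cont Om (fun x => a x i j) by exists (fun x => a x i j).
  have [M' _ HM] := C2_bounded bOm e0 d1 d2.
  have [|||h0 h1 h2] := @C2norm_bounds _ _ Om (fun x => a x i j) M' _ _ _ y Oy.
  - by move=> z Oz; have [] := HM z Oz.
  - by move=> l z Oz; have [] := HM z Oz.
  - by move=> l l' z Oz; have [] := HM z Oz.
  have w := le_trans (HKa i j) KKa.
  by split=> [|l|l l']; apply: le_trans w.
have bb i y : Om y -> `|b y 0 i| <= Kc /\ forall l, `|pd l (fun x => b x 0 i) y| <= Kc.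
  move=> Oy; have [vc _ d1] := Hb i.
  have e0 : extends_cont Om (fun x => b x 0 i) by exists (fun x => b x 0 i).
  have [M0 _ HM0] := extends_bounded bOm e0.
  have [M1 _ HM1] := common_bound (fun l => extends_bounded bOm (d1 l)).
  have [||h0 h1] := @C1norm_bounds _ _ Om (fun x => b x 0 i) (`|M0| + `|M1|) _ _ y Oy.
  - by move=> z Oz; apply: le_trans (HM0 z Oz) _; rewrite (le_trans (ler_norm _)) // lerDl.
  - by move=> l z Oz; apply: le_trans (HM1 l z Oz) _; rewrite (le_trans (ler_norm _)) // lerDr.
  have w := le_trans (HKb i) KKb.
  by split=> [|l]; apply: le_trans w.
split.
- by move=> i j; have [] := Ha i j.
- by move=> i; have [] := Hb i.
- by move=> i j y Oy; have [] := ba i j y Oy.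
- by move=> l i j y Oy; have [_ h _] := ba i j y Oy.
- by move=> l' l i j y Oy; have [_ _ h] := ba i j y Oy.
- by move=> i y Oy; have [] := bb i y Oy.
- by move=> l i y Oy; have [_ h] := bb i y Oy.
- by move=> y i j Oy; apply: Hsym; exact: subset_closure.
Qed.

Section AtChart.
Variables (p : 'rV[R]_n) (k : 'I_n) (sg : R) (Gam : 'rV[R]_n -> R).
Hypothesis FC : flat_chart Om p k sg Kc^-1 rho Kc Gam.
Let RC := regular_coefs_of_norms.
Let T := flat p k sg Gam.
Let D := half_ball k rho.

Let Hpos x : Om x -> pos_def (a x). Proof. by move=> Ox; have [] := Hell Ox. Qed.

Let conor_lim X j : D X -> conor p k sg Gam a j (setk k X s) @[s --> 0^'+] --> (0 : R).
Proof.
by move=> DX; apply: (conor_tends FC oOm bOm Hphi Ha Hsym Hchar Hpos DX (fun=> erefl)).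
Qed.

(* Within distance [rho'] of the centre [ann] is at most [c0 / 2], hence
   [block_elliptic] applies to the normal. *)
Let block X z : D X -> enorm X <= rho' -> z 0 k = 0 ->
  @block_const R n c0 Kc * dotv z z <= qf (a (T X)) z.
Proof.
move=> DX Xr zk; have OX := flat_Om FC DX.
have [pd [ev [evE ev0 _]]] := Hell OX.
have [_ _ rp0 rr Kr] := H3; have [r0 r1 _] := H2; have [K1 _ _ _] := H1.
have [X0 _] := DX.
have Kc0 : 0 <= Kc by exact: le_trans K1.
have /andP[d0 dK] := c_total_ge n Kc0.
have K0 : 0 <= K := le_trans d0 dK.
apply: (block_elliptic (N := Nor k sg Gam X) _ pd evE c00 ev0 _ _ _ zk).
- by apply/matrixP => i j; rewrite mxE; exact: (rc_sym RC).
- by rewrite (Nor_k FC) (sg_norm FC).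
- apply: le_trans (enorm_le_sum _) _.
  rewrite /normal_bound -[X in X%:R * _]card_ord mulr_natl -sumr_const.
  by apply: ler_sum => i _; have [_ h _] := Nor_hlip FC i; exact: h.
have -> : qf (a (T X)) (Nor k sg Gam X) = ann p k sg Gam a X.
  rewrite /ann /conor /qf exchange_big /=; apply: eq_bigr => j _.
  by rewrite mulr_suml.
have small := ann_small FC oOm (rc_a RC) (rc_a1 RC) (rc_a2 RC) conor_lim DX.
have [_ dle _] := dann_vlip FC oOm (rc_a RC) (rc_a1 RC) (rc_a2 RC).
have dX := dle X DX.
have s1 : X 0 k <= rho'.
  by apply: le_trans (ler_norm _) (le_trans (coord_le_enorm _ _) Xr).
have s2 : X 0 k ^+ 2 <= rho'.
  rewrite expr2 -[leRHS]mul1r; apply: ler_pM => //; [exact: ltW|exact: ltW|].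
  by apply: le_trans s1 (le_trans (ltW rr) r1).
have s4 : X 0 k ^+ 4 <= rho'.
  rewrite (_ : X 0 k ^+ 4 = X 0 k ^+ 2 * X 0 k ^+ 2); last by ring.
  rewrite -[leRHS]mul1r; apply: ler_pM; rewrite ?sqr_ge0 //.
  exact: le_trans s2 (le_trans (ltW rr) r1).
apply: le_trans Kr; rewrite -(addrNK (X 0 k ^+ 2 * dann p k sg Gam a X) (ann p k sg Gam a X)).
have -> : 3 * K * rho' = 2 * K * rho' + rho' * K by ring.
apply: lerD.
  apply: le_trans (ler_norm _) (le_trans small _).
  by apply: ler_pM => //; [exact: mulr_ge0|exact: exprn_even_ge0|exact: ler_wpM2l].
apply: le_trans (ler_norm _) _; rewrite normrM ger0_norm ?sqr_ge0 //.
by apply: ler_pM => //; [exact: sqr_ge0|exact: le_trans dK].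
Qed.

Lemma chart_oscillation X Y : 0 < X 0 k -> enorm X <= rho' -> 0 < Y 0 k -> enorm Y <= rho' ->
  u (T X) - u (T Y) <= C * Num.sqrt (enorm (X - Y)) + M * (dotv X X + dotv Y Y).
Proof.
have [lam0 eps0 rp0 rr _] := H3; have [l1 l2 l3 l4] := H4; have [MK M0 _ MC] := H5.
apply: (local_holder FC oOm RC lam0 eps0 rp0 rr l1 l2 l3 l4 conor_lim _ _ block u_C2 u_osc _ Kf0 MK M0 MC).
- move=> Z DZ; exact: (dann_limit FC oOm bOm RC Hphi Ha Hsym Hchar Hpos c10 Hc1 DZ
    (fun _ _ _ => erefl) (fun=> erefl) conor_lim).
- move=> Z DZ; exact: (drift_limit FC oOm bOm RC Hphi Ha Hb Hsym Hchar Hpos Hg c10 Hc1 DZ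
    (fun _ _ _ => erefl) (fun=> erefl) conor_lim).
move=> x Ox; have /eqP := u_eq Ox; rewrite addr_eq0 => /eqP ->.
by rewrite normrN; exact: F_le.
Qed.

End AtChart.

Let E := n%:R * Num.sqrt (1 + n%:R * Kc).

(** The flat coordinates of points at distance [d] from [p] have size of order
    [sqrt d], and the estimate in a chart loses another square root. *)
Lemma boundary_oscillation p d x x' : bdry Om p -> 0 <= d -> d <= osc_radius n Kc rho' ->
  Om x -> Om x' -> enorm (x - p) <= d -> enorm (x' - p) <= d ->
  u x - u x' <= osc_const n Kc M C * Num.sqrt (Num.sqrt d).
Proof.
move=> bp d0 dr Ox Ox' xd xd'.
have [K1 _ _ KKd] := H1; have [r0 r1 r2] := H2; have [_ _ rp0 _ _] := H3; have [_ M0 C0 _] := H5.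
have [K2 [K20 K2d CH]] := chart_of_norm oOm bOm CB HKd.
have [k [sg [Gam FC]]] := flat_chart_of_chart bp K20 (CH p bp) (le_trans K2d KKd) K1 r0 r1 r2.
have Kc0 : 0 < Kc by exact: lt_le_trans K1.
have c0' : 0 <= 1 + n%:R * Kc by rewrite addr_ge0 // mulr_ge0 // ltW.
have E0 : 0 <= E by rewrite mulr_ge0 // sqrtr_ge0.
move: dr; rewrite /osc_radius le_min -/E => /andP[dr1 dr2].
have Ki0 : 0 < Kc^-1 by rewrite invr_gt0.
have dK : d < Kc^-1 by move: dr1 Ki0; lra.
have Ki1 : Kc^-1 <= 1 by rewrite invf_le1.
have d1 : d <= 1 by exact: le_trans (ltW dK) Ki1.
have sd0 : 0 <= Num.sqrt d by exact: sqrtr_ge0.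
have E1 : 0 < E + 1 by rewrite ltr_wpDl.
have Er : E * Num.sqrt d <= rho'.
  have : Num.sqrt d <= rho' / (E + 1).
    by rewrite -[leRHS]ger0_norm ?divr_ge0 ?(ltW rp0) ?(ltW E1) // -sqrtr_sqr ler_wsqrtr.
  rewrite ler_pdivlMr // => h; apply: le_trans h; rewrite mulrC.
  by apply: ler_wpM2l => //; rewrite lerDl.
have un y : Om y -> enorm (y - p) <= d -> exists X, [/\ flat p k sg Gam X = y, 0 < X 0 k &
    enorm X <= E * Num.sqrt d].
  move=> Oy yd; have [X [h1 h2 h3]] := unflatten FC Oy (le_lt_trans yd dK) (le_trans yd d1).
  exists X; split => //; apply: le_trans h3 _.
  rewrite /E -mulrA -sqrtrM // ler_wpM2l // ler_wsqrtr // ler_wpM2l //.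
have [X [<- X0 Xd]] := un x Ox xd; have [X' [<- X0' Xd']] := un x' Ox' xd'.
apply: le_trans (chart_oscillation FC X0 (le_trans Xd Er) X0' (le_trans Xd' Er)) _.
set s := Num.sqrt (Num.sqrt d).
have s0 : 0 <= s by exact: sqrtr_ge0.
have s1 : s <= 1 by rewrite -sqrtr1 ler_wsqrtr // -sqrtr1 ler_wsqrtr.
have sq : (E * Num.sqrt d) ^+ 2 <= E ^+ 2 * s.
  rewrite exprMn sqr_sqrtr // ler_wpM2l ?sqr_ge0 //.
  rewrite -(sqr_sqrtr d0) -[Num.sqrt d](sqr_sqrtr sd0) -/s -exprM.
  by rewrite exprS ler_piMr // exprn_ile1.
have dv Z : enorm Z <= E * Num.sqrt d -> dotv Z Z <= E ^+ 2 * s.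
  move=> h; apply: le_trans sq; rewrite -enorm_sqr; apply: lerXn2r => //; rewrite nnegrE ?enorm_ge0 //.
  exact: mulr_ge0.
have dX := dv X Xd; have dX' := dv X' Xd'.
rewrite /osc_const -/E mulrDl -mulrA; apply: lerD.
  apply: ler_wpM2l => //; rewrite /s -sqrtrM ?mulr_ge0 // ler_wsqrtr //.
  apply: le_trans (enormD _ _) _; rewrite enormN; move: Xd Xd'; lra.
rewrite [leRHS](_ : _ = M * (E ^+ 2 * s + E ^+ 2 * s)); last by ring.
by apply: ler_wpM2l => //; exact: lerD.
Qed.

End BoundaryOscillation.

(** * Extension to the closure *)

(** Continuity at the boundary with a uniform modulus lets a bounded function be
    extended by its limits. *)
Lemma holder_extension {R : realType} {n : nat} (Om : set 'rV[R]_n) (u : 'rV[R]_n -> R)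
    (C2 dl Ku : R) : 0 < dl -> 0 <= C2 -> 0 <= Ku ->
  (forall x, Om x -> `|u x| <= Ku) ->
  (forall p d x x', bdry Om p -> 0 <= d -> d <= dl -> Om x -> Om x' ->
     enorm (x - p) <= d -> enorm (x' - p) <= d ->
     u x - u x' <= C2 * Num.sqrt (Num.sqrt d)) ->
  exists ubar : 'rV[R]_n -> R, (forall x, Om x -> ubar x = u x) /\
    forall x y, closure Om x -> bdry Om y ->
      `|ubar x - ubar y| <= (C2 + 2 * Ku / Num.sqrt (Num.sqrt dl)) * enorm (x - y) `^ 4^-1.
Proof.
move=> dl0 C20 Ku0 uK osc.
pose w (t : R) := Num.sqrt (Num.sqrt t).
have w0 t : 0 <= w t by exact: sqrtr_ge0.
have w_le s t : s <= t -> w s <= w t by move=> st; rewrite ler_wsqrtr // ler_wsqrtr.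
have wdl : 0 < w dl by rewrite !sqrtr_gt0.
have wc : continuous w by move=> t; exact: (cvg_comp _ _ (@sqrt_continuous _ t) (@sqrt_continuous _ _)).
have oscn p d x x' : bdry Om p -> 0 <= d -> d <= dl -> Om x -> Om x' ->
     enorm (x - p) <= d -> enorm (x' - p) <= d -> `|u x - u x'| <= C2 * w d.
  move=> bp d0 dd Ox Ox' h h'; rewrite ler_norml lerNl opprB.
  by rewrite (osc p d x' x) //= (osc p d x x').
pose ubar x := if `[< Om x >] then u x else lim (u y @[y --> within Om (nbhs x)]).
have ubarE x : Om x -> ubar x = u x by move=> Ox; rewrite /ubar asboolT.
have in_Om (p : 'rV[R]_n) : within Om (nbhs p) Om by exact: withinT.
have near_p (p : 'rV[R]_n) (e : R) : 0 < e -> \forall y \near within Om (nbhs p), enorm (y - p) < e.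
  by move=> e0; apply: filterS (near_enorm p e0) => y ye _.
(* The values of [u] near a boundary point form a Cauchy filter. *)
have lim_p p : bdry Om p -> u y @[y --> within Om (nbhs p)] --> ubar p.
  move=> bp; have [cp nOp] := bp; have PF := closure_proper cp.
  rewrite /ubar asboolF //; apply/cauchy_cvgP/cauchy_exP => e e0.
  have wcv : C2 * w d @[d --> (0 : R)^'+] --> (0 : R).
    have z0 : C2 * w 0 = 0 by rewrite /w !sqrtr0 mulr0.
    have c0 : w d @[d --> (0 : R)^'+] --> w 0 by apply: cvg_at_right_filter; exact: wc.
    by rewrite -[X in _ --> X]z0; exact: (cvgM (cvg_cst C2) c0).
  have small : \forall d \near (0 : R)^'+, `|C2 * w d| < e.
    by have /cvgr0Pnorm_lt := wcv; exact.
  have rng : \forall d \near (0 : R)^'+, 0 < d <= dl.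
    near=> d; apply/andP; split; near: d; [exact: nbhs_right_gt|exact: nbhs_right_le].
  have [d [wd /andP[d0 dd]]] := filter_ex (FF := at_right_proper_filter (0 : R)) (filterI small rng).
  have [x [xd Ox]] := filter_ex (filterI (near_p p d d0) (in_Om p)).
  exists (u x); apply: filterS2 (near_p p d d0) (in_Om p) => y yd Oy.
  rewrite -ball_normE /ball_ /=; apply: le_lt_trans wd; rewrite [leRHS]ger0_norm ?mulr_ge0 //.
  by apply: (oscn p d) => //; exact: ltW.
pose C := C2 + 2 * Ku / w dl.
have Kd0 : 0 <= 2 * Ku / w dl by rewrite divr_ge0 // mulr_ge0.
(* Far from the boundary point the bound on [u] gives the estimate. *)
have inner p x : bdry Om p -> Om x -> `|u x - ubar p| <= C * w (enorm (x - p)).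
  move=> bp Ox; have [cp nOp] := bp; have PF := closure_proper cp.
  have H : `|u x - u y| @[y --> within Om (nbhs p)] --> `|u x - ubar p|.
    exact: (cvg_norm (cvgB (cvg_cst (u x)) (lim_p p bp))).
  apply: (@cvgr_to_le _ _ PF _ _ _ _ H).
  have xp : 0 < enorm (x - p).
    rewrite lt_def enorm_ge0 andbT; apply/negP => /eqP /enorm_eq0 /eqP; rewrite subr_eq0 => /eqP xp.
    by apply: nOp; rewrite -xp.
  have [xd|xd] := leP (enorm (x - p)) dl.
    apply: filterS2 (near_p p _ xp) (in_Om p) => y yd Oy.
    apply: (@le_trans _ _ (C2 * w (enorm (x - p)))); last by rewrite ler_wpM2r // lerDl.
    by apply: (oscn p) => //; exact: ltW.
  apply: filterS (in_Om p) => y Oy; apply: (@le_trans _ _ (2 * Ku)).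
    by apply: le_trans (ler_normB _ _) _; have := uK x Ox; have := uK y Oy; lra.
  apply: (@le_trans _ _ (2 * Ku / w dl * w dl)); first by rewrite divfK ?gt_eqF.
  by apply: ler_pM => //; [rewrite lerDr|apply: w_le; exact: ltW].
exists ubar; split => // x p cx bp.
have -> : enorm (x - p) `^ 4^-1 = w (enorm (x - p)).
  rewrite (_ : 4^-1 = 2^-1 * 2^-1 :> R); last by field.
  by rewrite powRrM !powR12_sqrt ?sqrtr_ge0 ?enorm_ge0.
rewrite -/(w dl) -/C.
have [Ox|nOx] := pselect (Om x); first by rewrite ubarE //; exact: inner.
have PF := closure_proper cx.
have H1 : `|u y - ubar p| @[y --> within Om (nbhs x)] --> `|ubar x - ubar p|.
  exact: (cvg_norm (cvgB (lim_p x (conj cx nOx)) (cvg_cst (ubar p)))).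
have H2 : C * w (enorm (y - p)) @[y --> within Om (nbhs x)] --> C * w (enorm (x - p)).
  apply: cvg_trans (_ : C * w (enorm (y - p)) @[y --> nbhs x] --> _).
    by apply: cvg_app; exact: cvg_within.
  have c1 : (y - p) @[y --> x] --> x - p by exact: (cvgB cvg_id (cvg_cst p)).
  have c2 := cvg_comp _ _ c1 (@enorm_continuous R n (x - p)).
  exact: (cvgM (cvg_cst C) (cvg_comp _ _ c2 (@wc _))).
have H : (`|u y - ubar p| - C * w (enorm (y - p))) @[y --> within Om (nbhs x)]
    --> `|ubar x - ubar p| - C * w (enorm (x - p)) by exact: (cvgB H1 H2).
rewrite -subr_le0; apply: (@cvgr_to_le _ _ PF _ _ _ 0 H).
by apply: filterS (in_Om x) => y Oy; rewrite subr_le0; exact: inner.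
Unshelve. all: by end_near.
Qed.

Lemma source_bound {R : realType} {n : nat} (Om : set 'rV[R]_n) (f : 'rV[R]_n * R -> R)
    (u : 'rV[R]_n -> R) (Kf : R) : bounded_set Om ->
  {within closure Om `*` [set t : R | 0 <= t], continuous f} ->
  (exists M : R, forall x, Om x -> `|u x| <= M) -> (forall x, Om x -> 0 < u x) ->
  supnorm (closure Om `*` [set t : R | 0 <= t <= supnorm Om u]) f <= Kf ->
  forall x, Om x -> `|f (x, u x)| <= Kf.
Proof.
move=> bO fc [M uM] u0 fK x Ox; apply: le_trans fK.
set S := supnorm Om u; set A := closure Om `*` _.
have cA : compact A.
  apply: compact_setX; first exact: closure_compact.
  have -> : [set t : R | 0 <= t <= S] = `[0, S]%classic.
    by apply/seteqP; split => t /=; rewrite in_itv.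
  exact: segment_compact.
have fA : {within A, continuous f}.
  by apply: continuous_subspaceW fc => -[y t] [/= cy /andP[t0 _]].
have [B [Br HB]] := compact_bounded (continuous_compact fA cA).
have BB : B < `|B| + 1 by rewrite (le_lt_trans (ler_norm _)) // ltrDl.
apply: (@le_supnorm _ _ A f (`|B| + 1)); first by move=> z Az; apply: (HB _ BB); exists z.
split; first exact: subset_closure.
have ux := u0 x Ox; rewrite /= (ltW ux) /=.
by apply: le_trans (ler_norm _) _; exact: (le_supnorm uM).
Qed.

Theorem theorem1p2 (R : realType) (n : nat) (hn : (2 <= n)%N)
    (Ku Ka Kb Kd Kf c0 c1 : R) (hc0 : 0 < c0) (hc1 : 0 < c1) :
  exists C beta : R, 0 < beta < 1 /\
  forall (Om : set 'rV[R]_n) (phi : 'rV[R]_n -> R)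
    (a : 'rV[R]_n -> 'M[R]_n) (b : 'rV[R]_n -> 'rV[R]_n)
    (f : 'rV[R]_n * R -> R) (m u : 'rV[R]_n -> R),
  bounded_domain Om ->
  C2_boundary Om ->
  defining_function Om phi ->
  (forall i j, C2_bar Om (fun x => a x i j)) ->
  (forall x i j, closure Om x -> a x i j = a x j i) ->
  (forall i, C1_bar Om (fun x => b x 0 i)) ->
  {within closure Om `*` [set t : R | 0 <= t], continuous f} ->
  (forall x, bdry Om x ->
     char_form Om a phi x = 0 /\ grad_bar Om (char_form Om a phi) x != 0) ->
  {within closure Om, continuous m} ->
  (forall x, closure Om x -> 0 < m x) ->
  (forall x, Om x -> pos_def (a x) /\
     exists lam : 'I_n -> R, [/\ eigenvalues (a x) lam,
       forall i : 'I_n, (i.+1 < n)%N -> c0 <= lam i &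
       forall i : 'I_n, i.+1 = n -> lam i = m x * phi x]) ->
  (forall x, bdry Om x -> 0 < g_fun Om a b phi x) ->
  C2_on Om u ->
  (exists M : R, forall x, Om x -> `|u x| <= M) ->
  (forall x, Om x -> 0 < u x) ->
  (forall x, Om x ->
     \sum_(i < n) \sum_(j < n) a x i j * pd j (pd i u) x
     + \sum_(i < n) b x 0 i * pd i u x + f (x, u x) = 0) ->
  supnorm Om u <= Ku ->
  (forall i j, C2norm Om (fun x => a x i j) <= Ka) ->
  (forall i, C1norm Om (fun x => b x 0 i) <= Kb) ->
  bdry_C2norm Om <= Kd ->
  supnorm (closure Om `*` [set t : R | 0 <= t <= supnorm Om u]) f <= Kf ->
  (forall x, bdry Om x ->
     c1 * enorm (grad_bar Om phi x) ^+ 2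
       <= enorm (grad_bar Om (char_form Om a phi) x)) ->
  exists ubar : 'rV[R]_n -> R,
    (forall x, Om x -> ubar x = u x) /\
    (forall x y, closure Om x -> bdry Om y ->
       `|ubar x - ubar y| <= C * enorm (x - y) `^ beta).
Proof.
have [Kc [rho [rho' [lam [eps [M [C0 [H1 H2 H3 H4 H5]]]]]]]] :=
  local_constants n Ka Kb Kd Ku Kf hc0 hc1.
pose dl := osc_radius n Kc rho'; pose C2 := osc_const n Kc M C0.
exists (C2 + 2 * `|Ku| / Num.sqrt (Num.sqrt dl)), 4^-1.
split; first by apply/andP; split; [rewrite invr_gt0|rewrite invf_lt1 // ltr1n].
move=> Om phi a b f m u dOm CB Hphi Ha Hsym Hb fc Hbd mc m0 Hell Hg uC2 ub u0 ueq
  uK HKa HKb HKd fK Hc1.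
have [oOm _ [x0 Ox0] bOm] := dOm; have [MU uM] := ub.
have [K1 _ _ _] := H1; have [_ _ rp0 _ _] := H3; have [_ M0 C00 _] := H5.
have Kc0 : 0 < Kc by exact: lt_le_trans K1.
have uKu x : Om x -> `|u x| <= Ku by move=> Ox; apply: le_trans uK; exact: (le_supnorm uM).
have uosc x y : Om x -> Om y -> u x - u y <= Ku.
  move=> Ox Oy; have := le_trans (ler_norm _) (uKu x Ox); have := u0 y Oy; lra.
have FK := source_bound bOm fc ub u0 fK.
have Kf0 : 0 <= Kf by apply: le_trans (FK x0 Ox0).
have dl0 : 0 < dl.
  rewrite /dl /osc_radius lt_min divr_gt0 ?invr_gt0 //= exprn_gt0 //; apply: divr_gt0 => //.
have C20 : 0 <= C2.
  by rewrite /C2 /osc_const addr_ge0 // mulr_ge0 ?sqrtr_ge0 ?sqr_ge0 // mulr_ge0.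
apply: (holder_extension dl0 C20 (normr_ge0 Ku)).
  by move=> x Ox; apply: le_trans (uKu x Ox) (ler_norm _).
move=> p d x x' bp d0 dd Ox Ox' xd xd'.
exact: (boundary_oscillation (F := fun x => f (x, u x)) hc0 hc1 H1 H2 H3 H4 H5 dOm CB Hphi Ha
  Hsym Hb (fun x bx => (Hbd x bx).1) Hell Hg uC2 ueq uosc FK Kf0 HKa HKb HKd Hc1 bp d0 dd Ox Ox' xd xd').
Qed.
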